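(* Let the density of all configurations considered be fixed. Denote the Cartesian tensor of one-dimensional periodic configurations by $$\Gamma_\times=\Gamma_1\times\cdots\times\Gamma_d,\qquad \Gamma_l \text{ a periodic configuration in } \mathbb{R},\ l=1,\dots,d. \qquad ( * )$$ Denote by $\Gamma_\otimes$ the minimizing configuration of the energy among periodic configurations of type $( * )$. Then, for any fixed $\alpha>0$, we have $$E_{\phi_\alpha}(\Gamma_\otimes)\le E_{\phi_\alpha}(\Gamma_\times),$$ with equality if and only if $\Gamma_l$ is equispaced for all $l=1,\dots,d$. In other words, $\Gamma_\otimes$ is a (cuboid-shaped) lattice. Moreover, for any fixed density $\rho>0$, the cubic lattice $\rho^{-1/d}\mathbb{Z}^d$ is universally optimal among all periodic configurations of type $( * )$.
   Context: For $\alpha>0$ let $\phi_\alpha(r)=e^{-\alpha r^2}$, $r\in\mathbb{R}_+$. A periodic configuration in $\mathbb{R}^d$ is a set $\Gamma=\bigcup_{j=1}^J(\Lambda+x_j)$ with $\Lambda\subset\mathbb{R}^d$ a full-rank lattice and $x_j-x_k\notin\Lambda$ for all $j\neq k$. Its density $\rho(\Gamma)$ is the average number of points per unit volume, $\rho(\Gamma)=\lim_{R\to\infty}|\Gamma\cap B_R^d(0)|/\mathrm{vol}(B_R^d(0))$, where $B_R^d(0)$ is the ball of radius $R$ centered at $0$ in $\mathbb{R}^d$. Its energy is $$E_{\phi_\alpha}(\Gamma)=\frac1J\sum_{j,k=1}^J\ \sum_{\substack{\lambda\in\Lambda\\ \lambda+x_j-x_k\neq 0}}\phi_\alpha(|\lambda+x_j-x_k|),$$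 which is invariant under shifts $\Gamma\mapsto\Gamma+x$, $x\in\mathbb{R}^d$. A periodic configuration in $\mathbb{R}$ is equispaced if it has the form $c\,\mathbb{Z}+x$ with $c>0$, $x\in\mathbb{R}$. A cuboid-shaped lattice is one of the form $\beta_1\mathbb{Z}\times\cdots\times\beta_d\mathbb{Z}$ with $\beta_1,\dots,\beta_d>0$. A configuration $\Gamma_0$ is universally optimal within a class of periodic configurations of fixed density if $\Gamma_0$ belongs to the class and $E_{\phi_\alpha}(\Gamma_0)\le E_{\phi_\alpha}(\Gamma)$ for all $\Gamma$ in the class (of the same density) and all $\alpha>0$.
   Formalization: The ''if'' half of the equality clause is stated only with the density of each factor Γ_l fixed, as it fails when only the product density is fixed (βZ×β⁻¹Z, β→0); for fixed product density only ''only if'' is stated. Γ_⊗ is a cuboid-shaped lattice up to translation. *)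

(* Defs.v *)
From HB Require Import structures.
From mathcomp Require Import all_boot all_order all_algebra finmap.
From mathcomp Require Import all_classical all_reals all_analysis.

Set Implicit Arguments.
Unset Strict Implicit.
Unset Printing Implicit Defensive.

Import Order.TTheory GRing.Theory Num.Theory.
Import numFieldNormedType.Exports.

Local Open Scope classical_set_scope.
Local Open Scope ring_scope.

(* The library norm on 'rV[R]_d is the sup norm, hence this definition. *)
Definition enorm (R : realType) (d : nat) (v : 'rV[R]_d) : R :=
  Num.sqrt (\sum_(i < d) v ord0 i ^+ 2).

Definition eball (R : realType) (d : nat) (r : R) : set 'rV[R]_d :=
  [set v | enorm v <= r].

(* d-dimensional Lebesgue measure, computed as an iterated integral (Tonelli).
   It is meant for Borel sets only; it is used below for balls. *)
Fixpoint volume (R : realType) (d : nat) : set 'rV[R]_d -> \bar R :=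
  match d with
  | 0 => fun A : set 'rV[R]_0 => (\1_A 0)%:E
  | n.+1 => fun A : set 'rV[R]_(1 + n) =>
      (\int[@lebesgue_measure R]_t volume [set v | A (row_mx t%:M v)])%E
  end.

(* The lattice Z^d B generated by the rows of B; it has full rank exactly when
   B \in unitmx. *)
Definition lattice (R : realType) (d : nat) (B : 'M[R]_d) : set 'rV[R]_d :=
  [set v | exists z : 'rV[int]_d, v = map_mx intr z *m B].

(* A presentation of a periodic configuration; the configuration itself is the
   set [points] below.  Statements quantify over all presentations of a set. *)
Record periodic_config (R : realType) (d : nat) := PeriodicConfig {
  pc_basis : 'M[R]_d;
  pc_basis_unit : pc_basis \in unitmx;
  pc_num : nat;
  pc_num_gt0 : (0 < pc_num)%N;
  pc_shift : 'I_pc_num -> 'rV[R]_d;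
  pc_shift_distinct : forall j k : 'I_pc_num, j != k ->
    ~ lattice pc_basis (pc_shift j - pc_shift k)
}.

Definition points (R : realType) (d : nat) (G : periodic_config R d) :
    set 'rV[R]_d :=
  \bigcup_(j in [set: 'I_(pc_num G)])
    [set l + pc_shift j | l in lattice (pc_basis G)].

Definition has_density (R : realType) (d : nat) (G : periodic_config R d)
    (rho : R) : Prop :=
  #|` fset_set (points G `&` eball r)|%:R / fine (volume (eball (d := d) r))
    @[r --> +oo] --> rho.

Definition gaussian (R : realType) (alpha r : R) : R :=
  expR (- alpha * r ^+ 2).

Definition energy (R : realType) (d : nat) (alpha : R)
    (G : periodic_config R d) : \bar R :=
  (((pc_num G)%:R^-1)%:E *
    \sum_(j < pc_num G) \sum_(k < pc_num G)
      \esum_(l in [set l | lattice (pc_basis G) l /\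
                           (l + pc_shift j - pc_shift k != 0)%R])
        (gaussian alpha (enorm (l + pc_shift j - pc_shift k)%R))%:E)%E.

Definition line_points (R : realType) (G : periodic_config R 1) : set R :=
  [set t | points G (const_mx t)].

Definition equispaced (R : realType) (G : periodic_config R 1) : Prop :=
  exists c x : R, 0 < c /\
    line_points G = [set c * z%:~R + x | z in [set: int]].

Definition is_tensor (R : realType) (d : nat) (G : periodic_config R d)
    (Gl : 'I_d -> periodic_config R 1) : Prop :=
  points G = [set v | forall l : 'I_d, line_points (Gl l) (v ord0 l)].

Definition tensor_class (R : realType) (d : nat) (rho : R) :
    set (periodic_config R d) :=
  [set G | (exists Gl, is_tensor G Gl) /\ has_density G rho].

Definition factor_tensor_class (R : realType) (d : nat) (rho : 'I_d -> R) :
    set (periodic_config R d) :=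
  [set G | exists2 Gl, is_tensor G Gl & forall l, has_density (Gl l) (rho l)].

Definition energy_minimizer (R : realType) (d : nat) (alpha : R)
    (C : set (periodic_config R d)) (G0 : periodic_config R d) : Prop :=
  C G0 /\ forall G, C G -> (energy alpha G0 <= energy alpha G)%E.

Definition universally_optimal (R : realType) (d : nat)
    (C : set (periodic_config R d)) (G0 : periodic_config R d) : Prop :=
  C G0 /\ forall G, C G -> forall alpha : R, 0 < alpha ->
    (energy alpha G0 <= energy alpha G)%E.

(* Up to a translation by x, under which the energy is invariant. *)
Definition cuboid_shaped (R : realType) (d : nat) (G : periodic_config R d) :
    Prop :=
  exists (beta : 'I_d -> R) (x : 'rV[R]_d), (forall l, 0 < beta l) /\
    points G = [set v | exists z : 'I_d -> int,
                  forall l, v ord0 l = beta l * (z l)%:~R + x ord0 l].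

Lemma single_shift_distinct (R : realType) (d : nat) (B : 'M[R]_d)
    (j k : 'I_1) :
  j != k -> ~ lattice B ((fun=> 0) j - (fun=> 0) k).
Proof. by rewrite !ord1 eqxx. Qed.

Definition lattice_config (R : realType) (d : nat) (B : 'M[R]_d)
    (B_unit : B \in unitmx) : periodic_config R d :=
  @PeriodicConfig R d B B_unit 1 isT (fun=> 0) (@single_shift_distinct R d B).

Lemma cubic_basis_unit (R : realType) (d : nat) (rho : R) :
  0 < rho -> (rho `^ (- d%:R^-1))%:M \in @unitmx R d.
Proof.
move=> rho0; rewrite unitmxE det_scalar unitrX// unitfE.
by rewrite gt_eqF// powR_gt0.
Qed.

Definition cubic_lattice (R : realType) (d : nat) (rho : R)
    (rho_gt0 : 0 < rho) : periodic_config R d :=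
  lattice_config (cubic_basis_unit d rho_gt0).

(* Main.v *)
(** Adding the self-interaction turns [energy] into the mean, over one period,
    of the Gaussian potential of the whole point set.  For a tensor this mean
    factors, so [energy + 1] is the product of the one-dimensional means, and
    everything follows from two facts on Gaussian sums.

    1. On the line, equispaced points are the only minimizers.  By Poisson
    summation the mean of a configuration [y_1, ..., y_N] of period [L] is
    [sum_(j, k) theta (2 pi (y_j - y_k) / L)] up to a constant, and by the
    triple product [theta] is a limit of polynomials in [2 + 2 cos x] with
    nonnegative coefficients.  It thus suffices to treat the powers
    [(2 + 2 cos x)^i].  Each of them dominates a cosine polynomial of degree
    [< N] with nonnegative coefficients that agrees with it at the nodes
    [2 pi k / N], [0 < k < N]; such polynomials have a minimal pair sum at
    equispaced points.  Conversely equality for [i = N - 1] makes the first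
    [N - 1] power sums vanish, and this forces equispacing.

    2. At a fixed product of the densities the cube is best: with
    [theta_Z s = sum_n exp (- s n^2)], the function [x |-> ln (theta_Z (pi e^x)) + x / 4]
    is even by Poisson summation, and convex for [x >= -1/10] by an
    elementary estimate, hence convex, and Jensen's inequality applies.

    Densities are computed by comparing the volume of a ball with the number of
    points in it, one coordinate at a time; scaling the lattice [Z^d] then shows
    that balls of radii [r] and [r + c] have asymptotically the same volume. *)

Require Import Defs.
From HB Require Import structures.
From mathcomp Require Import all_boot all_order all_algebra finmap.
From mathcomp Require Import all_classical all_reals all_analysis.
From mathcomp Require Import measurable_realfun ring lra zify.
Import Order.TTheory GRing.Theory Num.Theory.
Import numFieldNormedType.Exports.
Local Open Scope classical_set_scope.
Local Open Scope ring_scope.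

Set Implicit Arguments.
Unset Strict Implicit.
Unset Printing Implicit Defensive.

(** * Cosine polynomials and the Fejer kernel *)

(** The variable [2 + 2 cos x] carries the argument. It is nonnegative, so multiplying by it
    preserves minorants, and a factor [1 + 2 w cos x + w^2] of the triple product is affine in it
    with the nonnegative coefficients [(1 - w)^2] and [w]. The equality case needs more than an
    inequality between limits: the weight of the power [N - 1] must stay away from [0]. It is
    bounded below by a positive multiple of theta at [pi], an alternating series, whose positivity
    is read off from the Gaussian side of Poisson summation. Poisson summation comes out of the
    binomial theorem with a constant known only as the limit of a Wallis sequence; self-duality at
    [x = 0] fixes its value later. The half-line of convexity has to reach beyond [0] to the left,
    so that evenness can carry Jensen's inequality over to the whole line; the margin [1/10] keeps
    [pi e^x] above [9/5] with no more than [pi >= 2]. The lattice of a tensor need not be a product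
    of lattices, so energies are compared through averages that do not depend on the
    presentation. *)

Definition cospoly (R : realType) (b : nat -> R) (n : nat) (x : R) : R :=
  b 0%N + \sum_(m < n) 2 * b m.+1 * cos (m.+1%:R * x).

Lemma eq_cospoly (R : realType) (b c : nat -> R) (n : nat) (x : R) :
  (forall m, (m <= n)%N -> b m = c m) -> cospoly b n x = cospoly c n x.
Proof.
move=> bc; rewrite /cospoly bc//; congr (_ + _).
by apply: eq_bigr => m _; rewrite bc.
Qed.

Lemma cospolyD (R : realType) (b c : nat -> R) (n : nat) (x : R) :
  cospoly (fun m => b m + c m) n x = cospoly b n x + cospoly c n x.
Proof.
rewrite /cospoly addrACA -big_split /=; congr (_ + _).
by apply: eq_bigr => m _; rewrite mulrDr mulrDl.
Qed.

Lemma cospolyZ (R : realType) (a : R) (b : nat -> R) (n : nat) (x : R) :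
  cospoly (fun m => a * b m) n x = a * cospoly b n x.
Proof.
rewrite /cospoly mulrDr mulr_sumr; congr (_ + _).
by apply: eq_bigr => m _; ring.
Qed.

(** [cospoly b n] is the Fourier sum of the even extension of [b] to [[-n, n]], hence its factors 2;
    in that extension both neighbours of [0] have the value [b 1]. *)
Definition nbr_sum (R : realType) (b : nat -> R) (m : nat) : R :=
  if m is k.+1 then b k + b k.+2 else 2 * b 1%N.

Lemma cos_mul2 (R : realType) (k : nat) (x : R) :
  2 * cos x * cos (k.+1%:R * x) = cos (k.+2%:R * x) + cos (k%:R * x).
Proof.
have -> : k.+2%:R * x = k.+1%:R * x + x by rewrite -!natr1; ring.
have -> : k%:R * x = k.+1%:R * x - x by rewrite -!natr1; ring.
by rewrite cosD cosB; ring.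
Qed.

(** Truncation disturbs the neighbour rule only at the top: [b n] spills over to frequency [n + 1],
    while [nbr_sum] at [n] counts a [b n.+1] that is not part of the polynomial. *)
Lemma cos_mul_cospoly (R : realType) (b : nat -> R) (n : nat) (x : R) :
  2 * cos x * cospoly b n x =
  cospoly (nbr_sum b) n x
  + 2 * b n * cos (n.+1%:R * x) - 2 * b n.+1 * cos (n%:R * x).
Proof.
elim: n => [|n IHn]; first by rewrite /cospoly !big_ord0 /= mul0r cos0 mul1r; ring.
have S c : cospoly c n.+1 x = cospoly c n x + 2 * c n.+1 * cos (n.+1%:R * x).
  by rewrite /cospoly big_ord_recr/= addrA.
rewrite !S mulrDr IHn /=.
have := cos_mul2 n x.
set c0 := cos _; set c1 := cos _; set c2 := cos _ => H.
have -> : 2 * cos x * (2 * b n.+1 * c1) = 2 * b n.+1 * (2 * cos x * c1) by ring.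
by rewrite /c1 H -/c0; ring.
Qed.

(** By the addition formula each frequency [m] contributes the squared modulus of the exponential
    sum of the [m * x i]. Nonnegative coefficients thus bound the pair sum below by its constant
    term. *)
Lemma cospoly_double_sum (R : realType) (I : finType) (x : I -> R)
    (b : nat -> R) (n : nat) :
  \sum_i \sum_j cospoly b n (x i - x j) =
  #|I|%:R ^+ 2 * b 0%N + \sum_(m < n) 2 * b m.+1 *
     ((\sum_i cos (m.+1%:R * x i)) ^+ 2 + (\sum_i sin (m.+1%:R * x i)) ^+ 2).
Proof.
under eq_bigr do rewrite big_split/=.
rewrite big_split /=; congr (_ + _).
  by rewrite !sumr_const -mulrnA -[LHS]mulr_natl natrM.
under eq_bigr do rewrite exchange_big/=.
rewrite exchange_big /=; apply: eq_bigr => m _.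
rewrite !expr2 !mulr_suml -big_split /= mulr_sumr; apply: eq_bigr => i _.
rewrite !mulr_sumr -big_split /= mulr_sumr; apply: eq_bigr => j _.
by rewrite mulrBr cosB.
Qed.

(** The Fejer kernel without its usual factor [1 / N], that is,
    [|1 + e^(ix) + ... + e^(i(N-1)x)|^2]. *)
Definition fejer (R : realType) (N : nat) : R -> R :=
  cospoly (fun m => N%:R - m%:R) N.-1.

(** The coefficients form a tent, whose second difference is concentrated at the apex [0] and at the
    ends [N] and [-N]. *)
Lemma fejerE (R : realType) (N : nat) (x : R) : (0 < N)%N ->
  (2 - 2 * cos x) * fejer N x = 2 - 2 * cos (N%:R * x).
Proof.
case: N => // n _; rewrite /fejer /= mulrBl cos_mul_cospoly.
rewrite -cospolyZ.
have -> : cospoly (fun m => 2 * (n.+1%:R - m%:R)) n x =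
   cospoly (fun m => nbr_sum (fun m => n.+1%:R - m%:R : R) m) n x + 2.
  rewrite -[2 in RHS](_ : cospoly (fun m => 2 *+ (m == 0%N)) n x = 2); last first.
    by rewrite /cospoly big1 ?addr0// => m _; rewrite mulr0n mulr0 mul0r.
  rewrite -cospolyD; apply: eq_cospoly => -[|m] _ /=; rewrite -!natr1; ring.
rewrite -!natr1; ring.
Qed.

Lemma cos_nat_eq1 (R : realType) (m : nat) (x : R) : cos x = 1 -> cos (m%:R * x) = 1.
Proof.
move=> cx; have sx : sin x = 0 by apply: cos1sin0; rewrite cx normr1.
elim: m => [|m IHm]; first by rewrite mul0r cos0.
by rewrite -natr1 mulrDl mul1r cosD IHm cx sx; ring.
Qed.

Lemma fejer_eq1 (R : realType) (N : nat) (x : R) : cos x = 1 ->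
  fejer N x = N%:R ^+ 2.
Proof.
move=> cx; rewrite /fejer /cospoly subr0.
have -> : \sum_(m < N.-1) 2 * (N%:R - m.+1%:R) * cos (m.+1%:R * x) =
   \sum_(m < N.-1) 2 * (N%:R - m.+1%:R).
  by apply: eq_bigr => m _; rewrite cos_nat_eq1// mulr1.
have -> n : \sum_(m < n) 2 * (N%:R - m.+1%:R) = n%:R * (2 * N%:R - n.+1%:R) :> R.
  elim: n => [|n IHn]; first by rewrite big_ord0 mul0r.
  by rewrite big_ord_recr /= IHn -!natr1; ring.
by case: N => [|n] /=; rewrite -?natr1; ring.
Qed.

Lemma fejer_ge0 (R : realType) (N : nat) (x : R) : 0 <= fejer N x.
Proof.
case: N => [|N]; first by rewrite /fejer /cospoly big_ord0 subr0 addr0.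
have [cx|cx] := eqVneq (cos x) 1; first by rewrite fejer_eq1// exprn_ge0.
have p : 0 < 2 - 2 * cos x by have := cos_le1 x; lra.
by rewrite -(pmulr_rge0 _ p) fejerE// subr_ge0 ger_pMr// cos_le1.
Qed.

Lemma cos2pin (R : realType) (n : nat) : cos (2 * pi * n%:R) = 1 :> R.
Proof. by rewrite mulrC cos_nat_eq1// mulr_natl cos2pi. Qed.

Lemma cos_eq1_node (R : realType) (N k : nat) : (0 < k < N)%N ->
  cos (2 * pi * k%:R / N%:R) != 1 :> R.
Proof.
move=> /andP[k0 kN]; have N0 : (0 < N%:R :> R) by rewrite ltr0n; lia.
set y : R := pi * k%:R / N%:R.
have y0 : 0 < y < pi.
  rewrite /y divr_gt0 ?mulr_gt0 ?pi_gt0 ?ltr0n ?k0 ?(ltn_trans k0)//=.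
  by rewrite ltr_pdivrMr// ltr_pM2l ?pi_gt0// ltr_nat.

have -> : 2 * pi * k%:R / N%:R = y *+ 2 by rewrite /y -mulr_natl; ring.
have sy := sin_gt0_pi y0.
rewrite cos_mulr2n cos2sin2; apply/eqP => H.
have S : sin y ^+ 2 = 0 by lra.
by move/eqP: S; rewrite sqrf_eq0 gt_eqF.
Qed.

Lemma fejer_node (R : realType) (N k : nat) : (0 < k < N)%N ->
  fejer N (2 * pi * k%:R / N%:R) = 0 :> R.
Proof.
move=> kN; have N0 : (0 < N)%N by lia.
have c1 := @cos_eq1_node R _ _ kN.
have := @fejerE R N (2 * pi * k%:R / N%:R) N0.
rewrite [N%:R * _]mulrC divfK ?pnatr_eq0 -?lt0n// cos2pin mulr1 subrr.
move/eqP; rewrite mulf_eq0 => /orP[/eqP H|/eqP//].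
by case/eqP: c1; lra.
Qed.

(** * Cosine polynomials below the powers of [2 + 2 cos x] *)

(* If [D s] is the coefficient at frequency [N - s] of a cosine polynomial of
   degree [< N], then [lp_step D] is that of its product by [2 + 2 cos x], minus
   the multiple [D 2] of the Fejer kernel which brings the degree below [N]
   again (see [lp_step_cospoly]).  The kernel is nonnegative and vanishes at the
   nodes, so starting from [1] this yields minorants that agree with
   [(2 + 2 cos x)^i] at the nodes. *)
Definition lp_step (R : realType) (D : int -> R) (s : int) : R :=
  D (s - 1) + 2 * D s + D (s + 1) - s%:~R * D 2.

(** Compares two steps of [D] that are mirror images in [[0, N]]. The base case has second
    difference [-2] at [N], which spreads to the left under iteration, so convexity is maintained
    only on the left half; on the right half steps are controlled by their mirror images instead. *)
Definition lp_asym (R : realType) (N : nat) (D : int -> R) (s : int) : R :=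
  (D (N%:Z + 1 - s) - D (N%:Z - s)) - (D s - D (s - 1)).

Definition diff2 (R : realType) (D : int -> R) (s : int) : R :=
  D (s + 1) - 2 * D s + D (s - 1).

(* The last two fields make [D] nonnegative on [0, N] and survive [lp_step]. *)
Record lp_inv (R : realType) (N : nat) (D : int -> R) : Prop := LpInv {
  lp_at1 : D 1 = 0;
  lp_odd : forall s, D (- s) = - D s;
  lp_refl : forall s, D (N%:Z + s) - D (N%:Z - s) = 2 * D s;
  lp_asym_ge0 : forall s : int, 1 <= s -> 2 * s <= N%:Z -> 0 <= lp_asym N D s;
  lp_diff2_ge0 : forall s : int, 1 <= s -> 2 * s <= N%:Z - 1 -> 0 <= diff2 D s
}.

(** Values of [D] are atoms for [ring] and [lra], so arguments that are equal in [int] are first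
    made syntactically equal. *)
Ltac unify_args D :=
  repeat match goal with |- context [D ?a] =>
    match goal with |- context [D ?b] =>
      tryif constr_eq a b then fail else
      replace (D a) with (D b) by (congr (D _); ring) end end.

(** The correction [s * D 2] is linear in [s]: it adds the same amount to both compared steps and
    drops out, leaving the plain binomial recursion. It drops out of [diff2] likewise. *)
Lemma lp_asym_step (R : realType) (N : nat) (D : int -> R) (s : int) :
  lp_asym N (lp_step D) s =
  lp_asym N D (s - 1) + 2 * lp_asym N D s + lp_asym N D (s + 1).
Proof.
by rewrite /lp_asym /lp_step; unify_args D; rewrite !rmorphB !rmorphD /=; ring.
Qed.

Lemma diff2_step (R : realType) (D : int -> R) (s : int) :
  diff2 (lp_step D) s =
  diff2 D (s - 1) + 2 * diff2 D s + diff2 D (s + 1).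
Proof.
by rewrite /diff2 /lp_step; unify_args D; rewrite !rmorphB !rmorphD /=; ring.
Qed.

Lemma lp_inv_at0 (R : realType) (N : nat) (D : int -> R) : lp_inv N D -> D 0 = 0.
Proof. by case=> _ /(_ 0) + _ _ _; rewrite oppr0; lra. Qed.

Lemma lp_asym_reflr (R : realType) (N : nat) (D : int -> R) (s : int) :
  lp_asym N D (N%:Z + 1 - s) = - lp_asym N D s.
Proof. by rewrite /lp_asym; unify_args D; ring. Qed.

(** Together with the antisymmetry about [(N + 1) / 2], this one about [1 / 2] acts as a Dirichlet
    condition at the ends of the left half, under which the binomial recursion keeps the sign. *)
Lemma lp_asym_refll (R : realType) (N : nat) (D : int -> R) (s : int) :
  lp_inv N D -> lp_asym N D (1 - s) = - lp_asym N D s.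
Proof.
move=> [_ odd refl _ _]; rewrite /lp_asym.
have := odd s; have := odd (s - 1); have := refl s; have := refl (s - 1).
by unify_args D; lra.
Qed.

(** Around the middle of [[0, N]] the asymmetry is itself made of second differences. This controls
    [diff2] at the first place beyond the range where its sign is known. *)
Lemma lp_asym_mid (R : realType) (N : nat) (D : int -> R) (s : int) :
  2 * (s + 1) = N%:Z -> lp_asym N D (s + 1) = diff2 D (s + 1).
Proof. by rewrite /lp_asym /diff2 => <-; unify_args D; ring. Qed.

Lemma lp_asym_mid1 (R : realType) (N : nat) (D : int -> R) (s : int) :
  2 * s + 1 = N%:Z -> lp_asym N D s = diff2 D s + diff2 D (s + 1).
Proof. by rewrite /lp_asym /diff2 => <-; unify_args D; ring. Qed.

Lemma lp_inv_step (R : realType) (N : nat) (D : int -> R) : (1 < N)%N ->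
  lp_inv N D -> lp_inv N (lp_step D).
Proof.
move=> N1 inv; have D0 := lp_inv_at0 inv.
have Al s := lp_asym_refll s inv.
have Ar s := lp_asym_reflr N D s.
case: (inv) => D1 odd refl A_ge0 K_ge0; split.
- rewrite /lp_step mulr1z.
  by unify_args D; rewrite (_ : D (1 - 1) = D 0)//; lra.
- move=> s; rewrite /lp_step rmorphN /=.
  have := odd (s - 1); have := odd (s + 1); have := odd s.
  by unify_args D; lra.
- move=> s; rewrite /lp_step rmorphB rmorphD /=.
  have := refl (s - 1); have := refl (s + 1); have := refl s.
  by unify_args D; lra.
- move=> s s1 sN; rewrite lp_asym_step.
  have As := A_ge0 _ s1 sN.
  (* The recursion is grouped as [(A (s-1) + A s) + (A s + A (s+1))]. If a neighbour leaves the
     range, antisymmetry either cancels its pair or makes that neighbour vanish. *)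
  have A1 : 0 <= lp_asym N D (s - 1) + lp_asym N D s.
    have [->|s_neq1] := eqVneq s 1.
      by have := Al 1; rewrite !subrr => ->; rewrite addNr.
    rewrite addr_ge0// A_ge0//; clear -s1 sN s_neq1; lia.
  have A2 : 0 <= lp_asym N D s + lp_asym N D (s + 1).
    have [e|s_neq] := eqVneq (2 * s) N%:Z.
      have := Ar s; rewrite -e (_ : 2 * s + 1 - s = s + 1); last by ring.
      by move=> ->; rewrite subrr.
    have [e|s_neq'] := eqVneq (2 * s + 1) N%:Z.
      have := Ar (s + 1); rewrite -e (_ : 2 * s + 1 + 1 - (s + 1) = s + 1); last by ring.
      by lra.
    by rewrite addr_ge0// A_ge0//; clear -s1 sN s_neq s_neq'; lia.
  by lra.
- move=> s s1 sN; rewrite diff2_step.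
  have Ks := K_ge0 _ s1 sN.
  have K0 : 0 <= diff2 D (s - 1).
    have [->|s_neq1] := eqVneq s 1.
      by rewrite subrr /diff2 add0r sub0r odd D0; lra.
    by apply: K_ge0; clear -s1 sN s_neq1; lia.
  have K2 : 0 <= diff2 D s + diff2 D (s + 1).
    have [e|s_neq] := eqVneq (2 * (s + 1)) N%:Z.
      rewrite -(lp_asym_mid D e) addr_ge0// A_ge0//; clear -e s1; lia.
    have [e|s_neq'] := eqVneq (2 * s + 1) N%:Z.
      by rewrite -(lp_asym_mid1 D e) A_ge0//; clear -e s1; lia.
    by rewrite addr_ge0// K_ge0//; clear -s1 sN s_neq s_neq'; lia.
  by lra.
Qed.

(** On [[0, N]] these are the coefficients of the constant [1]: the value at [N] is [1] and the
    others vanish. The values elsewhere are forced by oddness and the reflection rule. *)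
Definition lp_base (R : realType) (N : nat) (s : int) : R :=
  if (N%:Z %| s)%Z then s%:~R / N%:R else 0.

Lemma lp_base_eq0 (R : realType) (N : nat) (s : int) :
  0 <= s -> s < N%:Z -> lp_base R N s = 0.
Proof.
case: s => // s _ sN; rewrite /lp_base; case: ifPn => //.
rewrite dvdzE /= => /dvdnP[[|k] sk]; first by rewrite sk mul0r.
by move: sN; rewrite sk; clear; nia.
Qed.

Lemma lp_base_ge0 (R : realType) (N : nat) (s : int) : 0 <= s -> 0 <= lp_base R N s.
Proof. by move=> s0; rewrite /lp_base; case: ifPn => // _; rewrite divr_ge0 ?ler0z. Qed.

Lemma lp_inv_base (R : realType) (N : nat) : (1 < N)%N -> lp_inv N (lp_base R N).
Proof.
move=> N1; split.
- by rewrite lp_base_eq0//; lia.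
- move=> s; rewrite /lp_base rpredN; case: ifP => _; rewrite ?oppr0//.
  by rewrite rmorphN mulNr.
- move=> s; rewrite /lp_base.
  rewrite rpredDl ?dvdzz// rpredBl ?dvdzz//.
  case: ifP => _; last by rewrite subrr mulr0.
  by rewrite rmorphB rmorphD /=; ring.
- move=> s s1 sN; rewrite /lp_asym.
  rewrite (lp_base_eq0 R (s := s)) ?(lp_base_eq0 R (s := s - 1)) ?(lp_base_eq0 R (s := N%:Z - s)); try lia.
  by rewrite !subr0 lp_base_ge0//; lia.
- move=> s s1 sN; rewrite /diff2 !lp_base_eq0 ?mulr0 ?subrr ?addr0//; lia.
Qed.

(** On the left half convexity propagates from the step [D 1 - D 0 = 0]; a step on the right half is
    at least its mirror image on the left. *)
Lemma lp_inv_incr (R : realType) (N : nat) (D : int -> R) (s : nat) :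
  (1 < N)%N -> lp_inv N D -> (0 < s <= N)%N -> D (s%:Z - 1) <= D s%:Z.
Proof.
move=> N1 inv; have D0 := lp_inv_at0 inv.
case: (inv) => D1 _ _ A_ge0 K_ge0.
have left (t : nat) : (0 < t)%N -> (2 * t <= N + 1)%N -> 0 <= D t%:Z - D (t%:Z - 1).
  elim: t => // -[_ _ _|t IHt _ tN]; first by rewrite subrr D0 D1 subrr.
  have t0 := IHt isT ltac:(lia).
  have := K_ge0 t.+1%:Z ltac:(lia) ltac:(lia).
  have -> : t.+2%:Z = t.+1%:Z + 1 by lia.
  by rewrite /diff2 addrK; lra.
move=> /andP[s0 sN]; rewrite -subr_ge0.
have [sle|sgt] := leqP (2 * s) (N + 1); first exact: left.
have := A_ge0 (N + 1 - s)%N%:Z ltac:(lia) ltac:(lia).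
have := left (N + 1 - s)%N ltac:(lia) ltac:(lia).
rewrite /lp_asym (_ : N%:Z + 1 - (N + 1 - s)%N%:Z = s%:Z); last by lia.
rewrite (_ : N%:Z - (N + 1 - s)%N%:Z = s%:Z - 1); last by lia.
by lra.
Qed.

Lemma lp_inv_ge0 (R : realType) (N : nat) (D : int -> R) (s : nat) :
  (1 < N)%N -> lp_inv N D -> (s <= N)%N -> 0 <= D s%:Z.
Proof.
move=> N1 inv; elim: s => [|s IHs] sN; first by rewrite (lp_inv_at0 inv).
apply: le_trans (IHs (ltnW sN)) _.
have := lp_inv_incr N1 inv (s := s.+1) sN.
by rewrite -addn1 PoszD addrK.
Qed.

Definition lp_coef (R : realType) (N i : nat) : int -> R :=
  iter i (@lp_step R) (lp_base R N).

Lemma lp_inv_coef (R : realType) (N i : nat) : (1 < N)%N -> lp_inv N (lp_coef R N i).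
Proof.
by move=> N1; elim: i => [|i IHi]; [exact: lp_inv_base|exact: lp_inv_step].
Qed.

Definition lp_minorant (R : realType) (N i : nat) : R -> R :=
  cospoly (fun m => lp_coef R N i (N%:Z - m%:Z)) N.-1.

(** The invariants fit the product rule: [D 1 = 0] and [D 0 = 0] remove its two boundary terms, and
    [D (N + 1) = D (N - 1)] lets the coefficients continue evenly through frequency [0]. *)
Lemma lp_step_cospoly (R : realType) (N : nat) (D : int -> R) (x : R) :
  (0 < N)%N -> lp_inv N D ->
  (2 + 2 * cos x) * cospoly (fun m => D (N%:Z - m%:Z)) N.-1 x =
  cospoly (fun m => lp_step D (N%:Z - m%:Z)) N.-1 x + D 2 * fejer N x.
Proof.
case: N => // n _ inv.
rewrite /fejer mulrDl cos_mul_cospoly -!cospolyZ -cospolyD /=.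
have -> : D (n.+1%:Z - n%:Z) = 0.
  by rewrite -addn1 PoszD addrAC subrr add0r (lp_at1 inv).
rewrite subrr (lp_inv_at0 inv) !mulr0 !mul0r subr0 addr0 -cospolyD.
apply: eq_cospoly => -[_|m mn] /=; rewrite /lp_step.
  have := lp_refl inv 1; rewrite (lp_at1 inv) !subr0 mulr0 => /subr0_eq ->.
  by rewrite pmulrn; ring.
have -> : n.+1%:Z - m.+1%:Z + 1 = n.+1%:Z - m%:Z by rewrite -[m.+1]addn1 PoszD; ring.
have -> : n.+1%:Z - m.+2%:Z = n.+1%:Z - m.+1%:Z - 1.
  by rewrite -[m.+2]addn1 PoszD; ring.
by rewrite rmorphB /= -!pmulrn; ring.
Qed.

Lemma lp_minorantS (R : realType) (N i : nat) (x : R) : (1 < N)%N ->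
  (2 + 2 * cos x) * lp_minorant N i x =
  lp_minorant N i.+1 x + lp_coef R N i 2 * fejer N x.
Proof.
by move=> N1; exact: lp_step_cospoly (ltnW N1) (lp_inv_coef R i N1).
Qed.

Lemma lp_minorant0 (R : realType) (N : nat) (x : R) : (1 < N)%N ->
  lp_minorant N 0 x = 1.
Proof.
move=> N1; rewrite /lp_minorant /cospoly /lp_coef /= subr0 big1 ?addr0.
  by rewrite /lp_base dvdzz divff// pnatr_eq0; lia.
move=> m _; have mN := ltn_ord m.
by rewrite lp_base_eq0 ?mulr0 ?mul0r//; clear -mN N1; lia.
Qed.

Lemma lp_minorant_le (R : realType) (N i : nat) (x : R) : (1 < N)%N ->
  lp_minorant N i x <= (2 + 2 * cos x) ^+ i.
Proof.
move=> N1; elim: i => [|i IHi]; first by rewrite lp_minorant0 ?expr0.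
have c0 : 0 <= 2 + 2 * cos x by have := cos_geN1 x; lra.
rewrite exprS; apply: le_trans (ler_wpM2l c0 IHi).
rewrite lp_minorantS// lerDl mulr_ge0 ?fejer_ge0//.
by have := @lp_inv_ge0 R N _ 2 N1 (lp_inv_coef R i N1) N1.
Qed.

Lemma lp_minorant_node (R : realType) (N i k : nat) : (1 < N)%N -> (0 < k < N)%N ->
  lp_minorant N i (2 * pi * k%:R / N%:R) =
  (2 + 2 * cos (2 * pi * k%:R / N%:R)) ^+ i :> R.
Proof.
move=> N1 kN; elim: i => [|i IHi]; first by rewrite lp_minorant0 ?expr0.
by rewrite exprS -IHi lp_minorantS// fejer_node// mulr0 addr0.
Qed.

(** * Sums over equispaced nodes and the linear programming bound *)

Lemma cosDn2pi (R : realType) (a : R) (n : nat) : cos (a + 2 * pi * n%:R) = cos a.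
Proof.
have -> : 2 * pi * n%:R = (pi *+ 2) *+ n :> R by rewrite mulr_natr mulr_natl.
by rewrite (periodicn (@cosD2pi R)).
Qed.

Lemma sinDn2pi (R : realType) (a : R) (n : nat) : sin (a + 2 * pi * n%:R) = sin a.
Proof.
have -> : 2 * pi * n%:R = (pi *+ 2) *+ n :> R by rewrite mulr_natr mulr_natl.
by rewrite (periodicn (@sinD2pi R)).
Qed.

Lemma sum_cos_node (R : realType) (N j : nat) (a : R) : (0 < N)%N ->
  \sum_(k < N) cos (a + 2 * pi * (j%:R * k%:R / N%:R)) =
  if (N %| j)%N then N%:R * cos a else 0.
Proof.
move=> N0; have NR : N%:R != 0 :> R by rewrite pnatr_eq0 -lt0n.
case: ifPn => [/dvdnP[q ->]|ndiv].
  under eq_bigr => k _.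
    rewrite (_ : _ * k%:R / _ = (q * k)%N%:R) ?cosDn2pi; last first.
      by rewrite !natrM; field.
    over.
  by rewrite sumr_const card_ord -[LHS]mulr_natl.
(* Only the residue of [j] matters. It puts [y] into [(0, pi)], where [sin y] is nonzero, and
   multiplication by [2 sin y] makes the sum telescope. *)
set r := (j %% N)%N.
have rN : (0 < r < N)%N by rewrite ltn_mod N0 lt0n andbT.
set y : R := pi * r%:R / N%:R.
have y0 : 0 < y < pi.
  case/andP: rN => r0 rN.
  rewrite /y divr_gt0 ?mulr_gt0 ?pi_gt0 ?ltr0n//=.
  by rewrite ltr_pdivrMr ?ltr0n// ltr_pM2l ?pi_gt0// ltr_nat.
have sy : sin y != 0 by rewrite gt_eqF// sin_gt0_pi.
apply/eqP; rewrite -(mulrI_eq0 _ (@lregP _ (2 * sin y) _)); last first.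
  by rewrite mulf_neq0// pnatr_eq0.
have step k : 2 * sin y * cos (a + 2 * pi * (j%:R * k%:R / N%:R)) =
    sin (a - y + 2 * y * k.+1%:R) - sin (a - y + 2 * y * k%:R).
  have -> : a + 2 * pi * (j%:R * k%:R / N%:R) =
      a + 2 * y * k%:R + 2 * pi * (j %/ N * k)%:R.
    by rewrite {1}(divn_eq j N) natrD !natrM /y -/r; field.
  rewrite cosDn2pi -[k.+1%:R]natr1.
  have -> : a - y + 2 * y * (k%:R + 1) = a + 2 * y * k%:R + y by ring.
  have -> : a - y + 2 * y * k%:R = a + 2 * y * k%:R - y by ring.
  by rewrite sinD sinB; ring.
rewrite mulr_sumr.
under eq_bigr do rewrite step.
rewrite -(big_mkord xpredT (fun k => sin (a - y + 2 * y * k.+1%:R) -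
  sin (a - y + 2 * y * k%:R))) telescope_sumr// mulr0 addr0.
have -> : 2 * y * N%:R = 2 * pi * r%:R by rewrite /y; field.
by rewrite sinDn2pi subrr.
Qed.

Lemma sum_cospoly_node (R : realType) (b : nat -> R) (N n : nat) : (n < N)%N ->
  \sum_(k < N) cospoly b n (2 * pi * k%:R / N%:R) = N%:R * b 0%N.
Proof.
move=> nN; rewrite big_split /= sumr_const card_ord -[RHS]addr0 -[_ *+ _]mulr_natl.
congr (_ + _); rewrite exchange_big /=; apply: big1 => m _.
rewrite -mulr_sumr (_ : \sum_(k < N) _ = 0) ?mulr0//.
have /(@sum_cos_node R N m.+1 0) : (0 < N)%N by lia.
rewrite gtnNdvd//; last by have := ltn_ord m; lia.
move=> {2}<-; apply: eq_bigr => k _; rewrite add0r; congr cos.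
by rewrite !mulrA; ring.
Qed.

(** Linear programming bound. With nonnegative coefficients, the minorant has a pair sum of at least
    [N^2] times its constant coefficient; having degree [< N], it sums over the nodes to exactly [N]
    times that coefficient. *)
Lemma cos_gap_ge0 (R : realType) (N i : nat) (x : 'I_N -> R) :
  N%:R * \sum_(k < N) (2 + 2 * cos (2 * pi * k%:R / N%:R)) ^+ i <=
  \sum_j \sum_k (2 + 2 * cos (x j - x k)) ^+ i.
Proof.
case: N => [|[|N]] in x *; first by rewrite mul0r big_ord0.
  by rewrite !big_ord1 /= mulr0 mul0r subrr mul1r.
set M := N.+2; have M1 : (1 < M)%N by [].
set f := fun y : R => (2 + 2 * cos y) ^+ i.
have fh y : lp_minorant M i y <= f y by exact: lp_minorant_le.
(* At the node [0] the minorant may lie strictly below [f]. The excess is counted [M] times on both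
   sides: here through the factor [M] in front of the node sum, below on the diagonal of the pair
   sum. *)
have node : \sum_(k < M) f (2 * pi * k%:R / M%:R) =
    (f 0 - lp_minorant M i 0) + M%:R * lp_coef R M i M%:Z.
  have <- : \sum_(k < M) lp_minorant M i (2 * pi * k%:R / M%:R) =
      M%:R * lp_coef R M i M%:Z.
    have := @sum_cospoly_node R (fun m => lp_coef R M i (M%:Z - m%:Z)) M N.+1 (ltnSn _).
    by rewrite subr0.
  rewrite [LHS]big_ord_recl [in RHS]big_ord_recl !mulr0 !mul0r addrA subrK; congr (_ + _).
  apply: eq_bigr => k _; rewrite lp_minorant_node//.
  by rewrite lift0; have := ltn_ord k.
rewrite node.
have -> : \sum_j \sum_k (2 + 2 * cos (x j - x k)) ^+ i =
    M%:R * (f 0 - lp_minorant M i 0) +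
    \sum_(j < M) (lp_minorant M i 0 + \sum_(k < M | k != j) f (x j - x k)).
  rewrite big_split /= sumr_const card_ord -[lp_minorant _ _ _ *+ _]mulr_natl.
  rewrite addrA -mulrDr subrK.
  have -> : M%:R * f 0 = \sum_(j < M) f 0 by rewrite sumr_const card_ord mulr_natl.
  rewrite -big_split /=.
  by apply: eq_bigr => j _; rewrite [LHS](bigD1 j)//= subrr.
rewrite mulrDr lerD2l.
apply: (@le_trans _ _ (\sum_(j < M) \sum_(k < M) lp_minorant M i (x j - x k))).
  rewrite cospoly_double_sum card_ord subr0 expr2 mulrA lerDl.
  apply: sumr_ge0 => m _; rewrite mulr_ge0 ?addr_ge0 ?sqr_ge0// mulr_ge0//.
  rewrite subzn; last by rewrite ltnW// ltnS; exact: ltn_ord m.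
  by apply: (lp_inv_ge0 M1 (lp_inv_coef R i M1)); rewrite leq_subr.
apply: ler_sum => j _; rewrite (bigD1 j)//= subrr lerD2l.
by apply: ler_sum => k _; exact: fh.
Qed.

(** Binomial theorem for [(e^(ix/2) + e^(-ix/2))^(2n)]. *)
Lemma cos_expE (R : realType) (n : nat) (x : R) :
  (2 + 2 * cos x) ^+ n = cospoly (fun m => 'C(n.*2, n + m)%:R) n x.
Proof.
elim: n => [|n IHn]; first by rewrite /cospoly big_ord0 expr0 bin0 addr0.
rewrite exprS IHn mulrDl cos_mul_cospoly -!cospolyZ.
rewrite [in X in _ - X]bin_small ?mulr0 ?mul0r ?subr0; last by rewrite -addnn; lia.
rewrite addrA -cospolyD /cospoly [in RHS]big_ord_recr /= [RHS]addrA; congr (_ + _).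
  congr (_ + _); last apply: eq_bigr => m _; last congr (_ * _ * _).
    have C1 : 'C(n.*2.+1, n) = 'C(n.*2.+1, n.+1).
      by rewrite -(@bin_sub _ n) -?addnn; [congr 'C(_, _)|]; lia.
    rewrite !addn0 addn1 doubleS binS C1 binS !natrD; ring.
  by rewrite !addnS !addSn doubleS !binS !natrD; ring.
by rewrite !addnn !binn.
Qed.

Lemma sum_cospoly_shift (R : realType) (I : finType) (x : I -> R)
    (b : nat -> R) (n : nat) (y : R) :
  (forall m, (m < n)%N -> \sum_i cos (m.+1%:R * x i) = 0) ->
  (forall m, (m < n)%N -> \sum_i sin (m.+1%:R * x i) = 0) ->
  \sum_i cospoly b n (x i - y) = #|I|%:R * b 0%N.
Proof.
move=> C0 S0; rewrite big_split /= sumr_const -[RHS]addr0 -[_ *+ _]mulr_natl.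
congr (_ + _); rewrite exchange_big /=; apply: big1 => m _.
rewrite -mulr_sumr (_ : \sum_i _ = 0) ?mulr0//.
under eq_bigr do rewrite mulrBr cosB.
by rewrite big_split /= -!mulr_suml C0// S0// !mul0r addr0.
Qed.

(* When the gap closes, the first [N - 1] power sums vanish, so the Fejer
   kernel centred at a point has the same sum over all points as its value at
   that point. *)
Lemma cos_gap_eq0 (R : realType) (N : nat) (x : 'I_N -> R) :
  \sum_j \sum_k (2 + 2 * cos (x j - x k)) ^+ N.-1 =
  N%:R * \sum_(k < N) (2 + 2 * cos (2 * pi * k%:R / N%:R)) ^+ N.-1 ->
  forall j k, cos (N%:R * (x j - x k)) = 1.
Proof.
case: N => [|N] in x *; first by move=> _ [].
rewrite /= => gap0.
(* The exponent is just large enough for every frequency below the number of points to occur with a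
   positive coefficient, so a vanishing gap annihilates all these power sums. *)
have {gap0} : \sum_(m < N) 2 * 'C(N.*2, N + m.+1)%:R *
     ((\sum_i cos (m.+1%:R * x i)) ^+ 2 + (\sum_i sin (m.+1%:R * x i)) ^+ 2) = 0.
  move: gap0; under eq_bigr do under eq_bigr do rewrite cos_expE.
  under [in RHS]eq_bigr do rewrite cos_expE.
  rewrite cospoly_double_sum sum_cospoly_node// card_ord => H.
  by apply: (addrI (N.+1%:R ^+ 2 * 'C(N.*2, N + 0)%:R)); rewrite addr0 H; ring.
move/eqP; rewrite psumr_eq0; last first.
  by move=> m _; rewrite mulr_ge0// addr_ge0 ?sqr_ge0.
move=> /allP S0.
have {}S0 m : (m < N)%N -> (\sum_i cos (m.+1%:R * x i)) ^+ 2 +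
    (\sum_i sin (m.+1%:R * x i)) ^+ 2 == 0.
  move=> mN; have := S0 (Ordinal mN) (mem_index_enum _).
  rewrite mulf_eq0 mulf_eq0 !pnatr_eq0 /= -leqn0 leqNgt bin_gt0.
  by rewrite -addnn leq_add2l mN.
have C0 m : (m < N)%N -> \sum_i cos (m.+1%:R * x i) = 0.
  by move=> /S0; rewrite paddr_eq0 ?sqr_ge0// !sqrf_eq0 => /andP[/eqP].
have {S0}S0 m : (m < N)%N -> \sum_i sin (m.+1%:R * x i) = 0.
  by move=> /S0; rewrite paddr_eq0 ?sqr_ge0// !sqrf_eq0 => /andP[_ /eqP].
move=> j k; have [->|jk] := eqVneq j k; first by rewrite subrr mulr0 cos0.
have := @sum_cospoly_shift R _ x (fun m => N.+1%:R - m%:R) N (x k) C0 S0.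
rewrite -/(fejer N.+1) subr0 card_ord (bigD1 k)//= -/(fejer N.+1 _).
rewrite subrr fejer_eq1 ?cos0// -expr2 => H.
have /eqP : \sum_(i | i != k) fejer N.+1 (x i - x k) = 0.
  by apply: (addrI (N.+1%:R ^+ 2)); rewrite addr0.
rewrite psumr_eq0; last by move=> l _; exact: fejer_ge0.
move=> /allP /(_ j (mem_index_enum _)); rewrite jk /= => /eqP F0.
have := @fejerE R N.+1 (x j - x k) isT.
by rewrite F0 mulr0; lra.
Qed.

(** * Dominated convergence of series *)

Lemma is_cvg_series_dominated (R : realType) (u M : nat -> R) :
  (forall k, `|u k| <= M k) -> cvgn (series M) -> cvgn (series u).
Proof.
move=> uM cM; apply: normed_cvg.
by apply: series_le_cvg cM => //= n; apply: le_trans (uM n).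
Qed.

Lemma series_tail_le (R : realType) (u M : nat -> R) (K : nat) :
  (forall k, `|u k| <= M k) -> cvgn (series M) ->
  `|limn (series u) - series u K| <= limn (series M) - series M K.
Proof.
move=> uM cM; have cu := is_cvg_series_dominated uM cM.
have cvgd (v : nat -> R) : cvgn (series v) ->
    (series v n - series v K) @[n --> \oo] --> limn (series v) - series v K.
  by move=> cv; apply: cvgB => //; exact: cvg_cst.
have cn : `|series u n - series u K| @[n --> \oo] --> `|limn (series u) - series u K|.
  by apply: cvg_norm; exact: cvgd.
apply: (ler_cvg_to cn (cvgd _ cM)).
exists K => // m /= Km; rewrite !sub_series Km.
by apply: le_trans (ler_norm_sum _ _ _) _; apply: ler_sum => k _.
Qed.

(** Tannery's theorem. The tails beyond [K] are bounded by that of [M], uniformly in [n], and the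
    [K] leading terms converge; each of the three errors is at most [e / 3]. *)
Lemma tannery (R : realType) (a : nat -> nat -> R) (b M : nat -> R) :
  (\forall n \near \oo, forall k, `|a n k| <= M k) -> cvgn (series M) ->
  (forall k, a n k @[n --> \oo] --> b k) ->
  limn (series (a n)) @[n --> \oo] --> limn (series b).
Proof.
move=> aM cM ab.
have bM k : `|b k| <= M k.
  have abk : `|a n k| @[n --> \oo] --> `|b k| by apply: cvg_norm; exact: ab.
  by apply: (cvgr_to_le abk); apply: filterS aM => n; exact.
apply/cvgrPdist_le => e e0.
have e3 : 0 < e / 3 by rewrite divr_gt0.
have /cvgrPdist_le/(_ _ e3)[K _ HK] : series M n @[n --> \oo] --> limn (series M).
  by [].
have {}HK : limn (series M) - series M K <= e / 3.
  by apply: le_trans (HK K _); rewrite /= ?ler_norm.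
have cK : series (a n) K @[n --> \oo] --> series b K.
  by apply: cvg_big => [|k _]; [exact: add_continuous|exact: ab].
move/cvgrPdist_le/(_ _ e3): cK; move: aM; apply: filterS2 => n aM abK.
have t1 := le_trans (series_tail_le K aM cM) HK.
have t2 := le_trans (series_tail_le K bM cM) HK.
move: abK t1 t2; rewrite !ler_norml; lra.
Qed.

(** * The triple product *)

(* A finite form of the triple product: [tp_prod] has coefficients proportional
   to [tp_ratio], ratios of Gaussian binomials in [q^2]. *)
Definition tp_ratio (R : realType) (q : R) (M j : nat) : R :=
  q ^+ (j ^ 2) * \prod_(i < j) ((1 - q ^+ 2 ^+ (M - i)) / (1 - q ^+ 2 ^+ (M + i.+1))).

(** A factor is [(1 + w e^(ix)) (1 + w e^(-ix))] for an odd power [w] of [q], arranged to have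
    nonnegative coefficients in [2 + 2 cos x]. *)
Definition tp_prod (R : realType) (q : R) (M : nat) (x : R) : R :=
  \prod_(i < M) ((1 - q ^+ i.*2.+1) ^+ 2 + q ^+ i.*2.+1 * (2 + 2 * cos x)).

(** The constant coefficient of [tp_prod]: multiplication by one more factor turns coefficients [1]
    and [r] at frequencies [0] and [1] into the constant [1 + w^2 + 2 w r]. *)
Definition tp_scale (R : realType) (q : R) (M : nat) : R :=
  \prod_(i < M) (1 + q ^+ i.*2.+1 ^+ 2 + q ^+ i.*2.+1 * (2 * tp_ratio q i 1)).

Lemma tp_ratioS (R : realType) (q : R) (M j : nat) : tp_ratio q M j.+1 =
  tp_ratio q M j * (q ^+ j.*2.+1 *
    ((1 - q ^+ 2 ^+ (M - j)) / (1 - q ^+ 2 ^+ (M + j.+1)))).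
Proof.
rewrite /tp_ratio big_ord_recr /= (_ : (j.+1 ^ 2 = j ^ 2 + j.*2.+1)%N).
  by rewrite exprD; ring.
by rewrite -addnn; nia.
Qed.

Lemma tp_ratio_gt (R : realType) (q : R) (M j : nat) : (M < j)%N -> tp_ratio q M j = 0.
Proof.
move=> Mj; rewrite /tp_ratio (bigD1 (Ordinal Mj))//= subnn expr0 subrr.
by rewrite mul0r mul0r mulr0.
Qed.

Lemma one_sub_expr_gt0 (R : realType) (q : R) (n : nat) :
  0 < q < 1 -> 0 < 1 - q ^+ 2 ^+ n.+1.
Proof.
move=> /andP[q0 q1]; rewrite subr_gt0 exprn_ilt1 ?exprn_ge0 ?(ltW q0)//.
by rewrite exprn_ilt1 ?(ltW q0).
Qed.

(* Writing [u = Q^(M-k)] and [e = Q^k] with [Q = q^2], this is a polynomial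
   identity in [u], [e] and [q]. *)
Lemma tp_ratio_rec (R : realType) (q : R) (M k : nat) : 0 < q < 1 ->
  (1 + q ^+ M.*2.+1 ^+ 2 + q ^+ M.*2.+1 * (2 * tp_ratio q M 1)) *
    tp_ratio q M.+1 k.+1 =
  (1 + q ^+ M.*2.+1 ^+ 2) * tp_ratio q M k.+1 +
  q ^+ M.*2.+1 * (tp_ratio q M k + tp_ratio q M k.+2).
Proof.
move=> q01; case: (leqP k M) => [kM|Mk]; last first.
  have z j : (M < j)%N -> tp_ratio q M j = 0 by move=> /(tp_ratio_gt q).
  rewrite (z k)// (z k.+1); last by lia.
  rewrite (z k.+2); last by lia.
  by rewrite (@tp_ratio_gt _ _ M.+1 k.+1)// !(mulr0, addr0).
(* In the quotient of the rows [M] and [M + 1] all but the extreme factors cancel; the relation is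
   stated without denominators. *)
have shift : (1 - q ^+ 2 ^+ (M - k).+1) * (1 - q ^+ 2 ^+ (M + k.+1)) *
   tp_ratio q M.+1 k = tp_ratio q M k * (1 - q ^+ 2 ^+ M.+1) ^+ 2.
  elim: k kM => [|k IHk] kM.
    by rewrite subn0 addn1 /tp_ratio !big_ord0; ring.
  have := IHk (ltnW kM); rewrite !tp_ratioS.
  rewrite (_ : (M - k.+1).+1 = M - k)%N; last by lia.
  rewrite (_ : (M.+1 - k = (M - k).+1)%N); last by lia.
  rewrite (_ : (M.+1 + k.+1 = (M + k.+1).+1)%N); last by lia.
  rewrite (_ : (M + k.+2 = (M + k.+1).+1)%N); last by lia.
  rewrite addnS.
  have p1 := one_sub_expr_gt0 (M + k).+1 q01.
  have p2 := one_sub_expr_gt0 (M + k) q01.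
  set c := 1 - _ ^+ (M + k).+1 in p2 *; set d := 1 - _ ^+ (M + k).+2 in p1 *.
  set a := 1 - _ ^+ (M - k).+1; set b := 1 - _ ^+ (M - k).
  set Z := (1 - q ^+ 2 ^+ M.+1) ^+ 2.
  set r := tp_ratio q M k; set r' := tp_ratio q M.+1 k => H.
  transitivity (b * q ^+ k.*2.+1 * (a * c * r') / c); first by field; rewrite !gt_eqF.
  by rewrite H; field; rewrite gt_eqF.
have {}shift : tp_ratio q M.+1 k.+1 = tp_ratio q M k * (q ^+ k.*2.+1 *
   ((1 - q ^+ 2 ^+ M.+1) ^+ 2 /
    ((1 - q ^+ 2 ^+ (M + k).+1) * (1 - q ^+ 2 ^+ (M + k).+2)))).
  have p1 := one_sub_expr_gt0 (M + k).+1 q01.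
  have p2 := one_sub_expr_gt0 (M + k) q01.
  rewrite tp_ratioS subSn// addSn addnS.
  move: shift p1 p2; rewrite addnS.
  set c := 1 - _ ^+ (M + k).+1; set d := 1 - _ ^+ (M + k).+2.
  set a := 1 - _ ^+ (M - k).+1; set Z := 1 - q ^+ 2 ^+ M.+1.
  move=> H p1 p2.
  transitivity (q ^+ k.*2.+1 * (a * c * tp_ratio q M.+1 k) / (c * d)).
    by field; rewrite !gt_eqF.
  by rewrite H; field; rewrite !gt_eqF.
set E := q ^+ 2 ^+ k; set u := q ^+ 2 ^+ (M - k).
have m : q ^+ 2 ^+ M = u * E by rewrite -exprD subnK.
have r1 : tp_ratio q M 1 = q * ((1 - u * E) / (1 - u * E * q ^+ 2)).
  by rewrite -m /tp_ratio big_ord1 subn0 addn1 expr1 -exprSr.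
have eMk : q ^+ 2 ^+ (M + k).+1 = u * E ^+ 2 * q ^+ 2 by rewrite exprSr exprD m -/E; ring.
have eMk1 : q ^+ 2 ^+ (M + k).+2 = u * E ^+ 2 * q ^+ 4.
  by rewrite exprSr eMk; ring.
have ek : q ^+ k.*2.+1 = E * q by rewrite exprSr -mul2n exprM -/E.
have eM : q ^+ M.*2.+1 = u * E * q by rewrite exprSr -mul2n exprM m.
have s1 : tp_ratio q M k.+1 =
    tp_ratio q M k * (E * q * ((1 - u) / (1 - u * E ^+ 2 * q ^+ 2))).
  by rewrite tp_ratioS ek addnS eMk.
have s2 : tp_ratio q M k.+2 = tp_ratio q M k.+1 *
    (E * q * ((q ^+ 2 - u) / (1 - u * E ^+ 2 * q ^+ 4))).
  have [->|nkM] := eqVneq k M; first by rewrite !tp_ratio_gt ?mul0r.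
  rewrite [LHS]tp_ratioS !addnS eMk1 doubleS exprSr exprSr ek.
  have -> : u = q ^+ 2 ^+ (M - k.+1) * q ^+ 2 by rewrite -exprSr; congr (_ ^+ _); lia.
  by ring.
have p0 := one_sub_expr_gt0 M q01.
have p1 := one_sub_expr_gt0 (M + k).+1 q01.
have p2 := one_sub_expr_gt0 (M + k) q01.
move: p0 p1 p2; rewrite s2 shift s1 r1 ek eM eMk eMk1 exprSr m => p0 p1 p2.
by field; rewrite !gt_eqF.
Qed.

Lemma tp_ratio_ge0 (R : realType) (q : R) (M j : nat) : 0 < q < 1 ->
  0 <= tp_ratio q M j.
Proof.
move=> q01; have [/ltW q0 /ltW q1] := andP q01.
rewrite mulr_ge0 ?exprn_ge0//; apply: prodr_ge0 => i _.
by rewrite divr_ge0// subr_ge0 exprn_ile1 ?exprn_ge0// exprn_ile1.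
Qed.

Lemma tp_ratio_le (R : realType) (q : R) (M j : nat) : 0 < q < 1 ->
  tp_ratio q M j <= q ^+ (j ^ 2).
Proof.
move=> q01; have [/ltW q0 /ltW q1] := andP q01.
rewrite ler_piMr ?exprn_ge0//; apply: prodr_ile1 => i _.
have Q1 n : q ^+ 2 ^+ n <= 1 by rewrite exprn_ile1 ?exprn_ge0// exprn_ile1.
rewrite divr_ge0 ?subr_ge0//= addnS ler_pdivrMr ?one_sub_expr_gt0// mul1r.
rewrite lerD2l lerN2 ler_wiXn2l ?exprn_ge0 ?exprn_ile1//.
by lia.
Qed.

Lemma tp_scale_gt0 (R : realType) (q : R) (M : nat) : 0 < q < 1 -> 0 < tp_scale q M.
Proof.
move=> q01; have [q0 _] := andP q01; apply: prodr_gt0 => i _.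
apply: ltr_wpDr; last by apply: ltr_wpDr => //; exact: sqr_ge0.
by apply: mulr_ge0; [exact: exprn_ge0 (ltW q0)|apply: mulr_ge0 => //; exact: tp_ratio_ge0].
Qed.

Lemma cospolyS (R : realType) (b : nat -> R) (n : nat) (x : R) :
  cospoly b n.+1 x = cospoly b n x + 2 * b n.+1 * cos (n.+1%:R * x).
Proof. by rewrite /cospoly big_ord_recr/= addrA. Qed.

Lemma tp_prodE (R : realType) (q : R) (M : nat) (x : R) : 0 < q < 1 ->
  tp_prod q M x = tp_scale q M * cospoly (tp_ratio q M) M x.
Proof.
move=> q01; elim: M => [|M IHM].
  by rewrite /tp_prod /tp_scale !big_ord0 /cospoly big_ord0 /tp_ratio big_ord0; ring.
rewrite /tp_prod /tp_scale !big_ord_recr /= -/(tp_prod q M x) -/(tp_scale q M) IHM.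
set w := q ^+ M.*2.+1; set l := 1 + w ^+ 2 + _.
have -> : (1 - w) ^+ 2 + w * (2 + 2 * cos x) = 1 + w ^+ 2 + w * (2 * cos x) by ring.
rewrite -!mulrA; congr (_ * _); rewrite mulrC mulrDl -[w * _ * _]mulrA.
rewrite cos_mul_cospoly [tp_ratio q M M.+1]tp_ratio_gt// mulr0 mul0r subr0.
rewrite [w * _]mulrDr addrA -!cospolyZ -cospolyD.
rewrite cospolyS; congr (_ + _).
  apply: eq_cospoly => -[_|m mM]; last by rewrite -tp_ratio_rec.
  by rewrite /= /l /tp_ratio !big_ord0; ring.
have := tp_ratio_rec M M q01.
rewrite (tp_ratio_gt _ (ltnSn M)) (@tp_ratio_gt _ _ M M.+2)// -/w -/l => H.
transitivity (2 * (l * tp_ratio q M.+1 M.+1) * cos (M.+1%:R * x)); last by ring.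
by rewrite H; ring.
Qed.

Definition theta_cos (R : realType) (q x : R) : R :=
  1 + limn (series (fun j => 2 * q ^+ (j.+1 ^ 2) * cos (j.+1%:R * x))).

Lemma is_cvg_theta_dom (R : realType) (q : R) : 0 < q < 1 ->
  cvgn (series (fun j => 2 * q ^+ (j.+1 ^ 2))).
Proof.
move=> q01; have [q0 q1] := andP q01.
have c : cvgn (series (geometric 2 q)).
  by apply: is_cvg_geometric_series; rewrite ger0_norm ?ltW.
have q_ge0 n : 0 <= 2 * q ^+ n by rewrite mulr_ge0// exprn_ge0// ltW.
apply: series_le_cvg c => // n; rewrite /geometric /= ler_pM2l//.
by rewrite ler_wiXn2l ?ltW//; nia.
Qed.

Lemma cvg_expr_sub (R : realType) (q : R) (f : nat -> nat) : 0 < q < 1 ->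
  (forall B, \forall n \near \oo, (B <= f n)%N) ->
  (1 - q ^+ 2 ^+ f n) @[n --> \oo] --> (1 : R).
Proof.
move=> q01 fy; have [q0 q1] := andP q01.
rewrite -[X in _ --> X]subr0; apply: cvgB; first exact: cvg_cst.
apply: (@cvg_comp _ _ _ f (fun n => q ^+ 2 ^+ n) _ \oo); first exact/cvgnyPge.
apply: cvg_expr; rewrite ger0_norm ?exprn_ge0 ?(ltW q0)//.
by rewrite exprn_ilt1 ?(ltW q0).
Qed.

Lemma cvg_tp_ratio (R : realType) (q : R) (j : nat) : 0 < q < 1 ->
  tp_ratio q M j @[M --> \oo] --> q ^+ (j ^ 2).
Proof.
move=> q01; rewrite -[X in _ --> X]mulr1; apply: cvgM; first exact: cvg_cst.
rewrite [X in _ --> X](_ : 1 = \prod_(i < j) (1 : R)); last by rewrite big1_eq.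
apply: cvg_big => [|i _]; first exact: mul_continuous.
rewrite -[X in _ --> X]divr1; apply: cvgM.
  apply: cvg_expr_sub => // B; exists (B + i)%N => // n /=; lia.
apply: cvgV; first exact: oner_neq0.
by apply: cvg_expr_sub => // B; exists B => // n /=; lia.
Qed.

(** Dividing by the constant coefficient avoids infinite products: only coefficient ratios have to
    converge, and these are dominated by [q^(j^2)]. *)
Lemma cvg_tp_prod (R : realType) (q x : R) : 0 < q < 1 ->
  tp_prod q M x / tp_scale q M @[M --> \oo] --> theta_cos q x.
Proof.
move=> q01; have [q0 q1] := andP q01.
set a := fun M j => 2 * tp_ratio q M j.+1 * cos (j.+1%:R * x).
have -> : (fun M => tp_prod q M x / tp_scale q M) = (fun M => 1 + limn (series (a M))).
  apply/funext => M; rewrite tp_prodE// mulrAC divff ?mul1r; last first.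
    by rewrite gt_eqF// tp_scale_gt0.
  rewrite /cospoly {1}/tp_ratio big_ord0 mulr1 expr0; congr (_ + _).
  apply/esym; apply: (@lim_near_cst R) => //.
  exists M => // n /= Mn; rewrite /series /= -(subnKC Mn) big_mkord big_split_ord /=.
  rewrite [X in _ + X]big1 ?addr0// => i _.
  by rewrite /a tp_ratio_gt ?mulr0 ?mul0r//= ltnS leq_addr.
apply: cvgD; first exact: cvg_cst.
apply: (tannery (M := fun j => 2 * q ^+ (j.+1 ^ 2))).
- apply: nearW => n k; rewrite normrM (ger0_norm (_ : 0 <= 2 * _)); last first.
    by rewrite mulr_ge0 ?tp_ratio_ge0.
  rewrite -[leRHS]mulr1; apply: ler_pM => //; last exact: cos_max.
    by rewrite mulr_ge0 ?tp_ratio_ge0.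
  by rewrite ler_pM2l// tp_ratio_le.
- exact: is_cvg_theta_dom.
- move=> k; apply: cvgMl; apply: cvgMr; exact: cvg_tp_ratio.
Qed.

(** * From powers of [2 + 2 cos x] to theta *)

Definition tp_poly (R : realType) (q : R) (M : nat) : {poly R} :=
  \prod_(i < M) (((1 - q ^+ i.*2.+1) ^+ 2)%:P + q ^+ i.*2.+1 *: 'X).

Lemma tp_polyE (R : realType) (q : R) (M : nat) (x : R) :
  tp_prod q M x = (tp_poly q M).[2 + 2 * cos x].
Proof.
by rewrite horner_prod; apply: eq_bigr => i _; rewrite !hornerE.
Qed.

Lemma coef_tp_polyS (R : realType) (q : R) (M k : nat) :
  (tp_poly q M.+1)`_k = (1 - q ^+ M.*2.+1) ^+ 2 * (tp_poly q M)`_k +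
    q ^+ M.*2.+1 * (if k is k'.+1 then (tp_poly q M)`_k' else 0).
Proof.
rewrite /tp_poly big_ord_recr /= -/(tp_poly q M) mulrC mulrDl coefD coefCM.
by rewrite -mul_polyC -[_ * 'X * _]mulrA coefCM coefXM; case: k.
Qed.

Lemma coef_tp_poly_ge0 (R : realType) (q : R) (M k : nat) :
  0 < q < 1 -> 0 <= (tp_poly q M)`_k.
Proof.
move=> q01; have [q0 _] := andP q01.
elim: M k => [|M IHM] k; first by rewrite /tp_poly big_ord0 coef1 ler0n.
rewrite coef_tp_polyS addr_ge0// mulr_ge0 ?sqr_ge0 ?exprn_ge0 ?(ltW q0)//.
by case: k.
Qed.

(** Take the linear term of the first [n] factors and the constant term of the others. Constant
    terms are at most [1], so those remaining have a product at least that of all of them, which is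
    the value at [pi], where [2 + 2 cos x] vanishes. Divided by [tp_scale], the bound survives the
    limit in [M]. *)
Lemma coef_tp_poly_ge (R : realType) (q : R) (n M : nat) : 0 < q < 1 ->
  (n <= M)%N ->
  (\prod_(i < n) q ^+ i.*2.+1) * tp_prod q M pi <= (tp_poly q M)`_n.
Proof.
move=> q01; have [q0 q1] := andP q01.
have tpS m : tp_prod q m.+1 pi = tp_prod q m pi * (1 - q ^+ m.*2.+1) ^+ 2.
  by rewrite /tp_prod big_ord_recr /= cospi mulrN1 subrr mulr0 addr0.
have tp0 m : 0 <= tp_prod q m pi.
  elim: m => [|m IHm]; first by rewrite /tp_prod big_ord0.
  by rewrite tpS mulr_ge0 ?sqr_ge0.
have tp1 m : tp_prod q m pi <= 1.
  elim: m => [|m IHm]; first by rewrite /tp_prod big_ord0.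
  have qm : 0 <= q ^+ m.*2.+1 <= 1 by rewrite exprn_ge0 ?exprn_ile1 ?ltW.
  rewrite tpS mulr_ile1 ?sqr_ge0//; case/andP: qm => qm0 qm1.
  by rewrite exprn_ile1 ?subr_ge0// lerBlDr lerDl.
have diag : \prod_(i < n) q ^+ i.*2.+1 <= (tp_poly q n)`_n.
  elim: n => [|n IHn]; first by rewrite /tp_poly !big_ord0 coef1.
  rewrite big_ord_recr /= coef_tp_polyS mulrC.
  apply: ler_wpDl; first by rewrite mulr_ge0 ?sqr_ge0 ?coef_tp_poly_ge0.
  by rewrite ler_wpM2l// exprn_ge0// ltW.
have prod0 : 0 <= \prod_(i < n) q ^+ i.*2.+1.
  by apply: prodr_ge0 => i _; rewrite exprn_ge0// ltW.
elim: M => [|M IHM].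
  rewrite leqn0 => /eqP n0; rewrite n0 in diag prod0 *.
  by apply: le_trans diag; rewrite ler_piMr.
rewrite leq_eqVlt => /predU1P[nM|nM].
  by rewrite -nM; apply: le_trans diag; rewrite ler_piMr.
rewrite tpS mulrA mulrC coef_tp_polyS; apply: ler_wpDr.
  rewrite mulr_ge0 ?exprn_ge0 ?(ltW q0)//.
  by case: (n) => // ?; exact: coef_tp_poly_ge0.
by rewrite ler_wpM2l ?sqr_ge0 ?IHM.
Qed.

Definition pair_gap (R : realType) (N : nat) (x : 'I_N -> R) (f : R -> R) : R :=
  \sum_j \sum_k f (x j - x k) - N%:R * \sum_(k < N) f (2 * pi * k%:R / N%:R).

Lemma eq_pair_gap (R : realType) (N : nat) (x : 'I_N -> R) (f g : R -> R) :
  f =1 g -> pair_gap x f = pair_gap x g.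
Proof. by move=> /funext ->. Qed.

Lemma pair_gapZ (R : realType) (N : nat) (x : 'I_N -> R) (f : R -> R) (c : R) :
  pair_gap x (fun y => c * f y) = c * pair_gap x f.
Proof.
rewrite /pair_gap -mulr_sumr; under eq_bigr do rewrite -mulr_sumr.
by rewrite -mulr_sumr; ring.
Qed.

Lemma pair_gap_sum (R : realType) (N n : nat) (x : 'I_N -> R) (f : nat -> R -> R) :
  pair_gap x (fun y => \sum_(i < n) f i y) = \sum_(i < n) pair_gap x (f i).
Proof.
rewrite /pair_gap sumrB -mulr_sumr; congr (_ - _ * _); last exact: exchange_big.
by rewrite [RHS]exchange_big; apply: eq_bigr => j _; rewrite exchange_big.
Qed.

Lemma cvg_pair_gap (R : realType) (N : nat) (x : 'I_N -> R) (f : nat -> R -> R)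
    (g : R -> R) :
  (forall y, f n y @[n --> \oo] --> g y) ->
  pair_gap x (f n) @[n --> \oo] --> pair_gap x g.
Proof.
move=> fg; apply: cvgB; last apply: cvgMr.
  apply: cvg_big => [|i _]; first exact: add_continuous.
  by apply: cvg_big => [|j _]; [exact: add_continuous|exact: fg].
by apply: cvg_big => [|j _]; [exact: add_continuous|exact: fg].
Qed.

(** All powers have a nonnegative gap and enter with nonnegative weight. Only the power [N - 1] is
    kept, since the vanishing of its gap detects equispacing. *)
Lemma pair_gap_theta (R : realType) (N : nat) (x : 'I_N -> R) (q : R) :
  0 < q < 1 ->
  (\prod_(i < N.-1) q ^+ i.*2.+1) * theta_cos q pi *
    pair_gap x (fun y => (2 + 2 * cos y) ^+ N.-1) <=
  pair_gap x (theta_cos q).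
Proof.
move=> q01.
set c := \prod_(i < N.-1) _; pose F (i : nat) (y : R) := (2 + 2 * cos y) ^+ i.
have F0 i : 0 <= pair_gap x (F i) by rewrite subr_ge0; exact: cos_gap_ge0.
have cl := @cvg_pair_gap _ _ x _ _ (fun y => @cvg_tp_prod _ q y q01).
have cr : c * (tp_prod q M pi / tp_scale q M) * pair_gap x (F N.-1) @[M --> \oo] -->
    c * theta_cos q pi * pair_gap x (F N.-1).
  by apply: cvgMl; apply: cvgMr; exact: cvg_tp_prod.
apply: (ler_cvg_to cr cl); exists N.-1 => // M /= NM.
have -> : pair_gap x (fun y => tp_prod q M y / tp_scale q M) =
    (tp_scale q M)^-1 * \sum_(i < size (tp_poly q M)) (tp_poly q M)`_i * pair_gap x (F i).
  under eq_bigr do rewrite -pair_gapZ.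
  rewrite -(@pair_gap_sum _ _ _ x (fun i y => (tp_poly q M)`_i * F i y)).
  rewrite -pair_gapZ; apply: eq_pair_gap => y.
  by rewrite tp_polyE horner_coef mulrC.
rewrite mulrA -mulrA mulrC -mulrA ler_wpM2l ?invr_ge0 ?(ltW (tp_scale_gt0 _ _))//.
rewrite mulrC.
have cN := coef_tp_poly_ge q01 NM.
apply: (@le_trans _ _ ((tp_poly q M)`_N.-1 * pair_gap x (F N.-1))).
  by rewrite ler_wpM2r.
have [sN|sN] := ltnP N.-1 (size (tp_poly q M)).
  rewrite (bigD1 (Ordinal sN))//= lerDl; apply: sumr_ge0 => i _.
  by rewrite mulr_ge0 ?coef_tp_poly_ge0.
rewrite nth_default// mul0r; apply: sumr_ge0 => i _.
by rewrite mulr_ge0 ?coef_tp_poly_ge0.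
Qed.

(** * Poisson summation *)

Lemma is_derive_ge0_le (R : realType) (f df : R -> R) (a b : R) : a <= b ->
  (forall x, a <= x <= b -> is_derive x 1 f (df x)) ->
  (forall x, a <= x <= b -> 0 <= df x) -> f a <= f b.
Proof.
move=> ab fdf df0.
have in_ab x : x \in `[a, b] -> a <= x <= b by rewrite in_itv.
have [|c|c] := @MVT_segment R f df a b ab.
- by move=> x /subset_itv_oo_cc/in_ab; exact: fdf.
- apply: derivable_within_continuous => x /in_ab /fdf h; exact: ex_derive.
- move=> /in_ab /df0 dc E; rewrite -subr_ge0 E mulr_ge0// subr_ge0//.
Qed.

Lemma sin_le_id (R : realType) (x : R) : 0 <= x -> sin x <= x.
Proof.
move=> x0.
have : id 0 - sin 0 <= id x - sin x.
  exact: (@is_derive_ge0_le R (id - sin) (fun x => 1 - cos x)).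
by rewrite sin0 subr0 subr_ge0.
Qed.

Lemma sin_sqr_le (R : realType) (x : R) : sin x ^+ 2 <= x ^+ 2.
Proof.
wlog x0 : x / 0 <= x.
  move=> H; have [/H//|x0] := leP 0 x.
  by have := H (- x); rewrite sinN !sqrrN oppr_ge0 ltW//; exact.
have [xpi|xpi] := leP x 2.
  rewrite lerXn2r ?nnegrE//; last exact: sin_le_id.
  by apply: sin_ge0_pi; rewrite x0 (le_trans xpi)// pi_ge2.
have : sin x ^+ 2 <= 1 by rewrite sin2cos2 lerBlDr lerDl sqr_ge0.
by move=> /le_trans; apply; rewrite expr_ge1//; lra.
Qed.

Lemma mul_cos_le_sin (R : realType) (x : R) : 0 <= x <= pi -> x * cos x <= sin x.
Proof.
move=> /andP[x0 xpi].
have : sin 0 - id 0 * cos 0 <= sin x - id x * cos x.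
  apply: (@is_derive_ge0_le R (sin - id * cos) (fun x => x * sin x)) => // y /andP[y0 yx].
    apply: is_derive_eq; rewrite /GRing.scale /=; ring.
  by rewrite mulr_ge0// sin_ge0_pi// y0 (le_trans yx).
by rewrite sin0 mul0r subr0 subr_ge0.
Qed.

(** For [x >= 0] the derivative of [cos x * expR (x^2 / 2)] has the sign of [x * cos x - sin x], so
    this product decreases from its value [1] at [0]. *)
Lemma cos_le_expR (R : realType) (x : R) : `|x| <= pi / 2 ->
  cos x <= expR (- x ^+ 2 / 2).
Proof.
wlog x0 : x / 0 <= x.
  move=> H; have [/H//|x0 xpi] := leP 0 x.
  by have := H (- x); rewrite cosN sqrrN normrN oppr_ge0 ltW//; exact.
rewrite ger0_norm// => xpi.
pose e (y : R) := expR (y ^+ 2 / 2).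
have de (y : R) : is_derive y 1 e (y * e y).
  have d1 : is_derive y 1 (fun y : R => y ^+ 2 / 2) y.
    have -> : (fun y : R => y ^+ 2 / 2) = 2^-1 \*: (@id R ^+ 2).
      by apply/funext => z /=; rewrite /GRing.scale /= mulrC.
    by apply: is_derive_eq; rewrite /GRing.scale /=; field.
  have -> : e = expR \o (fun y : R => y ^+ 2 / 2) by [].
  by apply: is_derive_eq; rewrite mulrC.
have : - (cos 0 * e 0) <= - (cos x * e x).
  apply: (@is_derive_ge0_le R (- (cos * e)) (fun x => (sin x - x * cos x) * e x)) => // y /andP[y0 yx].
    by apply: is_derive_eq; rewrite /GRing.scale /=; ring.
  rewrite mulr_ge0 ?expR_ge0// subr_ge0 mul_cos_le_sin// y0 (le_trans yx)//.
  by apply: le_trans xpi _; rewrite ler_pdivrMr// ler_peMr ?pi_ge0// ler1n.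
rewrite lerN2 cos0 /e expr0n mul0r expR0 mulr1 mulNr expRN.
by move=> H; rewrite -[leRHS]mul1r ler_pdivlMr ?expR_gt0.
Qed.

(** * Central binomial coefficients as discrete Gaussians *)

Definition bin_ratio (R : realType) (n k : nat) : R :=
  'C(n.*2, n + k)%:R / 'C(n.*2, n)%:R.

Lemma bin_mid_gt0 (R : realType) (n : nat) : 0 < 'C(n.*2, n)%:R :> R.
Proof. by rewrite ltr0n bin_gt0 -addnn leq_addr. Qed.

Lemma bin_ratioS (R : realType) (n k : nat) : (k <= n)%N ->
  bin_ratio R n k.+1 * (n + k).+1%:R = bin_ratio R n k * (n - k)%:R.
Proof.
move=> kn; have := mul_bin_left n.*2 (n + k).
rewrite (_ : n.*2 - (n + k) = n - k)%N; last by lia.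
move=> /(congr1 (fun m => m%:R : R)); rewrite !natrM => H.
rewrite /bin_ratio addnS mulrAC [_ * _.+1%:R]mulrC H; ring.
Qed.

Lemma bin_ratio0 (R : realType) (n : nat) : bin_ratio R n 0 = 1.
Proof. by rewrite /bin_ratio addn0 divff// gt_eqF// bin_mid_gt0. Qed.

Lemma bin_ratio_gt (R : realType) (n k : nat) : (n < k)%N -> bin_ratio R n k = 0.
Proof. by move=> nk; rewrite /bin_ratio bin_small ?mul0r//; lia. Qed.

Lemma bin_ratio_ge0 (R : realType) (n k : nat) : 0 <= bin_ratio R n k.
Proof. by rewrite divr_ge0. Qed.

(** Consecutive quotients are [1 - (2k+1) / (n+k+1)], at most [expR (- (2k+1) / (n+K))], and the odd
    numbers add up to [k^2]. The lower bound treats the inverse quotients in the same way. *)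
Lemma bin_ratio_le (R : realType) (n k K : nat) : (k <= K)%N -> (k <= n)%N ->
  bin_ratio R n k <= expR (- (k%:R ^+ 2 / (n + K)%:R)).
Proof.
elim: k => [|k IHk] kK kn; first by rewrite bin_ratio0 expr0n mul0r oppr0 expR0.
have nK0 : 0 < (n + K)%:R :> R by rewrite ltr0n; lia.
have nk0 : 0 < (n + k).+1%:R :> R by rewrite ltr0n.
have := bin_ratioS R (ltnW kn); rewrite natrB; last exact: ltnW.
move=> /(canRL (mulfK (lt0r_neq0 nk0))) ->; rewrite -[bin_ratio _ _ _ * _ / _]mulrA.
have -> : - (k.+1%:R ^+ 2 / (n + K)%:R) =
    - (k%:R ^+ 2 / (n + K)%:R) + - ((2 * k%:R + 1) / (n + K)%:R) :> R.
  by move: ((n + K)%:R) nK0 => N N0; rewrite -natr1; field; rewrite lt0r_neq0.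
rewrite expRD ler_pM ?bin_ratio_ge0 ?IHk ?divr_ge0 ?subr_ge0 ?ler_nat//; try lia.
apply: le_trans (expR_ge1Dx _).
have -> : (n%:R - k%:R) / (n + k).+1%:R = 1 - (2 * k%:R + 1) / (n + k).+1%:R :> R.
  by rewrite -natr1 natrD; field; rewrite -natrD natr1 pnatr_eq0.
rewrite lerD2l lerN2 ler_wpM2l//.
by rewrite lef_pV2 ?posrE// ler_nat; lia.
Qed.

Lemma bin_ratio_ge (R : realType) (n k K : nat) : (k <= K)%N -> (K < n)%N ->
  expR (- (k%:R ^+ 2 / (n - K)%:R)) <= bin_ratio R n k.
Proof.
move=> + Kn; have nK0 : 0 < (n - K)%:R :> R by rewrite ltr0n; lia.
elim: k => [|k IHk] kK; first by rewrite bin_ratio0 expr0n mul0r oppr0 expR0.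
have nk0 : 0 < (n + k).+1%:R :> R by rewrite ltr0n.
have nk1 : 0 < (n - k)%:R :> R by rewrite ltr0n; lia.
have kn : (k <= n)%N by lia.
have := bin_ratioS R kn; move=> /(canRL (mulfK (lt0r_neq0 nk0))) ->; rewrite -[bin_ratio _ _ _ * _ / _]mulrA.
have -> : - (k.+1%:R ^+ 2 / (n - K)%:R) =
    - (k%:R ^+ 2 / (n - K)%:R) + - ((2 * k%:R + 1) / (n - K)%:R) :> R.
  by move: ((n - K)%:R) nK0 => N N0; rewrite -natr1; field; rewrite lt0r_neq0.
rewrite expRD ler_pM ?expR_ge0 ?IHk//; first by lia.
rewrite expRN -[leRHS]invrK lef_pV2 ?posrE ?expR_gt0 ?invr_gt0 ?divr_gt0//.
apply: le_trans (expR_ge1Dx _); rewrite invf_div.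
have -> : (n + k).+1%:R / (n - k)%:R = 1 + (2 * k%:R + 1) / (n - k)%:R :> R.
  have E : (n - k)%:R = n%:R - k%:R :> R by rewrite natrB//; lia.
  by rewrite -natr1 natrD E; field; rewrite -E lt0r_neq0.
rewrite lerD2l ler_wpM2l//.
by rewrite lef_pV2 ?posrE// ler_nat; lia.
Qed.

Definition wallis (R : realType) (n : nat) : R :=
  n%:R * ('C(n.*2, n)%:R / 4 ^+ n) ^+ 2.

Lemma bin_midS (R : realType) (n : nat) :
  'C(n.+1.*2, n.+1)%:R = 2 * (2 * n%:R + 1) / (n%:R + 1) * 'C(n.*2, n)%:R :> R.
Proof.
have C1 : 'C(n.*2.+1, n) = 'C(n.*2.+1, n.+1).
  by rewrite -(@bin_sub _ n) -?addnn; [congr 'C(_, _)|]; lia.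
have n0 : n%:R + 1 != 0 :> R by rewrite natr1 pnatr_eq0.
have /(congr1 (fun m => m%:R : R)) := mul_bin_diag n.*2.+1 n.
rewrite !natrM -!natr1 -mul2n natrM mul2n => H.
rewrite doubleS binS C1 natrD; apply: (mulfI n0).
by rewrite mulrDr -H; field.
Qed.

(** The sequence increases, and with [2n + 1] in place of the factor [n] it decreases from [1]. The
    value [1 / pi] of the limit is recovered only in [theta_func_eq]. *)
Lemma wallis_cvg (R : realType) : exists2 k : R, 0 < k & wallis R n @[n --> \oo] --> k.
Proof.
have S n : wallis R n.+1 = (n%:R + 1) * ((2 * n%:R + 1) / (2 * (n%:R + 1)) *
    ('C(n.*2, n)%:R / 4 ^+ n)) ^+ 2.
  rewrite /wallis bin_midS -[n.+1%:R]natr1 [4 ^+ n.+1]exprS; congr (_ * _ ^+ 2).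
  have p4 : 4 ^+ n != 0 :> R by rewrite expf_neq0.
  by field; rewrite p4 natr1 pnatr_eq0.
have nd : nondecreasing_seq (wallis R).
  apply/nondecreasing_seqP => n; rewrite S /wallis.
  set C := 'C(_, _)%:R / _.
  have n0 : 0 < n%:R + 1 :> R by rewrite natr1 ltr0n.
  rewrite -subr_ge0.
  have -> : (n%:R + 1) * ((2 * n%:R + 1) / (2 * (n%:R + 1)) * C) ^+ 2 - n%:R * C ^+ 2
     = C ^+ 2 / (4 * (n%:R + 1)) by field; rewrite gt_eqF.
  by rewrite divr_ge0 ?sqr_ge0// mulr_ge0// ltW.
have ub n : (2 * n%:R + 1) * ('C(n.*2, n)%:R / 4 ^+ n) ^+ 2 <= 1 :> R.
  elim: n => [|n IHn]; first by rewrite bin0 expr0; lra.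
  apply: le_trans IHn.
  have n0 : 0 < n%:R + 1 :> R by rewrite natr1 ltr0n.
  rewrite bin_midS [4 ^+ n.+1]exprS -[n.+1%:R]natr1 -subr_ge0; set C := 'C(_, _)%:R.
  have p4 : 4 ^+ n != 0 :> R by rewrite expf_neq0.
  have -> : (2 * n%:R + 1) * (C / 4 ^+ n) ^+ 2 -
     (2 * (n%:R + 1) + 1) * (2 * (2 * n%:R + 1) / (n%:R + 1) * C / (4 * 4 ^+ n)) ^+ 2
     = (2 * n%:R + 1) * (C / 4 ^+ n) ^+ 2 / (4 * (n%:R + 1) ^+ 2).
    by field; rewrite p4 gt_eqF.
  by rewrite divr_ge0 ?mulr_ge0 ?sqr_ge0// addr_ge0.
have ub' n : wallis R n <= 1.
  apply: le_trans (ub n); rewrite ler_wpM2r ?sqr_ge0//.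
  by have : 0 <= n%:R :> R by []; lra.
have cv : cvgn (wallis R).
  by apply: nondecreasing_is_cvgn => //; exists 1 => _ [n _ <-].
exists (limn (wallis R)) => //.
apply: lt_le_trans (nondecreasing_cvgn_le nd cv 1%N).
by rewrite /wallis mul1r exprn_gt0// divr_gt0 ?bin_mid_gt0.
Qed.

Lemma big_ord_int_sym (R : realType) (F : int -> R) (p : nat) :
  \sum_(i < p.*2.+1) F (i%:Z - p%:Z) =
  F 0 + \sum_(k < p) (F k.+1%:Z + F (- k.+1%:Z)).
Proof.
elim: p => [|p IHp]; first by rewrite big_ord1 big_ord0 subrr addr0.
rewrite doubleS big_ord_recr big_ord_recl [in RHS]big_ord_recr /= addrA -IHp.
have -> : p.*2.+2%:Z - p.+1%:Z = p.+1%:Z by rewrite -addnn; lia.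
rewrite sub0r.
under eq_bigr => i _.
  rewrite (_ : (bump 0 i)%:Z - p.+1%:Z = i%:Z - p%:Z); last by rewrite /bump; lia.
  over.
by rewrite addrAC [RHS]addrC [X in X + _ = _]addrC.
Qed.

Lemma sum_multiples (R : realType) (F : nat -> R) (K n : nat) : (0 < K)%N ->
  \sum_(m < n) (if (K %| m.+1)%N then F m.+1 else 0) =
  \sum_(j < n %/ K) F (K * j.+1)%N.
Proof.
move=> K0; elim: n => [|n IHn]; first by rewrite div0n !big_ord0.
rewrite big_ord_recr /= IHn divnS//; case: ifP => [d|_]; last by rewrite addr0.
rewrite add1n big_ord_recr /=; congr (_ + F _).
by have := divnK d; rewrite divnS// d add1n mulnC.
Qed.

(** Half angles turn [cos^2] into [(2 + 2 cos) / 4], to which the binomial theorem applies; summing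
    over [2p + 1] equispaced points keeps the frequencies divisible by [2p + 1]. The index is
    centred so that the terms of fixed index converge. *)
Lemma poisson_finite (R : realType) (p n : nat) (w : R) :
  \sum_(i < p.*2.+1) (cos ((w + 2 * pi * (i%:Z - p%:Z)%:~R) / (2 * p.*2.+1%:R)) ^+ 2) ^+ n =
  p.*2.+1%:R * ('C(n.*2, n)%:R / 4 ^+ n) *
  (1 + \sum_(j < n) 2 * bin_ratio R n (p.*2.+1 * j.+1) * cos (j.+1%:R * w)).
Proof.
set K := p.*2.+1; have K0 : (0 < K)%N by [].
have KR : K%:R != 0 :> R by rewrite pnatr_eq0.
set C := 'C(_, _)%:R; have C0 : C != 0 by rewrite gt_eqF// bin_mid_gt0.
have p4 : 4 ^+ n != 0 :> R by rewrite expf_neq0.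
transitivity ((\sum_(i < K) (2 + 2 * cos ((w + 2 * pi * (i%:Z - p%:Z)%:~R) / K%:R)) ^+ n)
   / 4 ^+ n).
  rewrite mulr_suml; apply: eq_bigr => i _; rewrite -exprVn -exprMn; congr (_ ^+ _).
  set y := _ / (2 * _).
  have -> : (w + 2 * pi * (i%:Z - p%:Z)%:~R) / K%:R = y *+ 2.
    by rewrite -mulr_natr /y; field.
  by rewrite cos_mulr2n -mulr_natr; field.
under eq_bigr do rewrite cos_expE.
rewrite big_split /= sumr_const card_ord exchange_big /= addn0.
have -> : \sum_(m < n) \sum_(i < K) 2 * 'C(n.*2, n + m.+1)%:R *
    cos (m.+1%:R * ((w + 2 * pi * (i%:Z - p%:Z)%:~R) / K%:R)) =
    K%:R * C * \sum_(j < n) 2 * bin_ratio R n (K * j.+1) * cos (j.+1%:R * w).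
  pose F k : R := K%:R * (2 * 'C(n.*2, n + k)%:R * cos ((k %/ K)%N%:R * w)).
  transitivity (\sum_(m < n) (if (K %| m.+1)%N then F m.+1 else 0)).
    apply: eq_bigr => m _; rewrite -mulr_sumr.
    have := @sum_cos_node R K m.+1 (m.+1%:R * (w - 2 * pi * p%:R) / K%:R) K0.
    have -> : \sum_(k < K) cos (m.+1%:R * (w - 2 * pi * p%:R) / K%:R +
        2 * pi * (m.+1%:R * k%:R / K%:R)) =
        \sum_(i < K) cos (m.+1%:R * ((w + 2 * pi * (i%:Z - p%:Z)%:~R) / K%:R)).
      apply: eq_bigr => i _; congr cos.
      by rewrite intrB !pmulrn; field.
    move=> ->; case: ifP => [/dvdnP[j mj]|]; last by rewrite mulr0.
    have -> : cos (m.+1%:R * (w - 2 * pi * p%:R) / K%:R) = cos (j%:R * w).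
      rewrite -[LHS](cosDn2pi _ (j * p)); congr cos.
      by rewrite mj !natrM; field.
    by rewrite /F mj mulnK// mulrCA.
  rewrite sum_multiples// mulr_sumr.
  rewrite (big_ord_widen n (fun j => F (K * j.+1)%N) (leq_div n K)) big_mkcond /=.
  apply: eq_bigr => j _; case: ltnP => [_|jK].
    by rewrite /F mulKn// /bin_ratio -/C; field.
  rewrite bin_ratio_gt ?mulr0 ?mul0r ?mulr0//.
  by rewrite mulnC -ltn_divLR// ltnS.
rewrite -[C *+ K]mulr_natl -/C; field.
by [].
Qed.

Lemma expR_le_one_sub (R : realType) (x : R) : x < 1 -> expR (- (x / (1 - x))) <= 1 - x.
Proof.
move=> x1; have p : 0 < 1 - x by rewrite subr_gt0.
rewrite expRN -[leRHS]invrK lef_pV2 ?posrE ?expR_gt0 ?invr_gt0//.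
apply: le_trans (expR_ge1Dx _).
have <- : (1 - x)^-1 = 1 + x / (1 - x) by field; rewrite gt_eqF.
exact: lexx.
Qed.

Lemma cos_sqr_le_expR (R : realType) (y : R) : `|y| <= pi / 2 ->
  cos y ^+ 2 <= expR (- y ^+ 2).
Proof.
move=> ypi; have c0 : 0 <= cos y.
  by apply: cos_ge0_pihalf; rewrite -ler_norml.
apply: (@le_trans _ _ (expR (- y ^+ 2 / 2) ^+ 2)).
  by rewrite lerXn2r ?nnegrE ?expR_ge0// cos_le_expR.
by rewrite expr2 -expRD -splitr.
Qed.

Lemma cos_sqr_ge_expR (R : realType) (y : R) : `|y| < 1 ->
  expR (- (y ^+ 2 / (1 - y ^+ 2))) <= cos y ^+ 2.
Proof.
move=> y1; have y2 : y ^+ 2 < 1 by rewrite -real_normK ?num_real// exprn_ilt1.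
apply: le_trans (expR_le_one_sub y2) _; rewrite cos2sin2 lerD2l lerN2.
exact: sin_sqr_le.
Qed.

(* Sampling [cos^(2 n)] at [w = 2 p + 1] equispaced points with [n ~ t w^2]
   turns the binomial theorem into Poisson summation as [p] tends to infinity. *)
Definition poisson_width (R : realType) (p : nat) : R := p.*2.+1%:R.
Definition poisson_size (R : realType) (t : R) (p : nat) : nat :=
  Num.truncn (t * poisson_width R p ^+ 2).
Definition poisson_rate (R : realType) (t : R) (p : nat) : R :=
  (poisson_size t p)%:R / poisson_width R p ^+ 2.

Lemma poisson_width_gt0 (R : realType) (p : nat) : 0 < poisson_width R p.
Proof. by rewrite ltr0n. Qed.

Lemma cvg_poisson_widthV (R : realType) : (poisson_width R p)^-1 @[p --> \oo] --> (0 : R).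
Proof.
apply: (@squeeze_cvgr _ _ _ _ (fun=> 0) (@harmonic R)); last exact: cvg_harmonic.
  apply: nearW => p; rewrite invr_ge0 (ltW (poisson_width_gt0 R p))/= lef_pV2 ?posrE//.
  by rewrite ler_nat; lia.
exact: cvg_cst.
Qed.

Lemma poisson_sizeE (R : realType) (t : R) (p : nat) :
  (poisson_size t p)%:R = poisson_rate t p * poisson_width R p ^+ 2.
Proof. by rewrite divfK// expf_neq0// gt_eqF// poisson_width_gt0. Qed.

Lemma poisson_rate_bounds (R : realType) (t : R) (p : nat) : 0 <= t ->
  t - (poisson_width R p)^-1 <= poisson_rate t p <= t.
Proof.
move=> t0; have K0 := poisson_width_gt0 R p.
have K1 : 1 <= poisson_width R p by rewrite ler1n.
have /andP[le gt] := @truncn_itv R (t * poisson_width R p ^+ 2)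
  (mulr_ge0 t0 (exprn_ge0 _ (ltW K0))).
have K2 : 0 < poisson_width R p ^+ 2 by rewrite exprn_gt0.
rewrite ler_pdivlMr// ler_pdivrMr// le andbT mulrBl.
have -> : (poisson_width R p)^-1 * poisson_width R p ^+ 2 = poisson_width R p.
  by field; rewrite gt_eqF.
move: gt; rewrite -natr1 -/(poisson_size t p); lra.
Qed.

Lemma cvg_poisson_rate (R : realType) (t : R) : 0 <= t ->
  poisson_rate t p @[p --> \oo] --> t.
Proof.
move=> t0; apply: (@squeeze_cvgr _ _ _ _
  (fun p => t - (poisson_width R p)^-1) (fun=> t)); last exact: cvg_cst.
  by apply: nearW => p; exact: poisson_rate_bounds.
rewrite -[X in _ --> X]subr0; apply: cvgB; [exact: cvg_cst|exact: cvg_poisson_widthV].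
Qed.

Lemma near_poisson_rate (R : realType) (t : R) : 0 < t ->
  \forall p \near \oo, t / 2 <= poisson_rate t p.
Proof.
move=> t0; have t2 : 0 < t / 2 by rewrite divr_gt0.
have /cvgrPdist_le/(_ _ t2) := cvg_poisson_rate (ltW t0).
apply: filterS => p; rewrite ler_norml => /andP[_]; lra.
Qed.

Lemma cvg_cos_pow (R : realType) (t A : R) : 0 < t ->
  (cos (A / poisson_width R p) ^+ 2) ^+ poisson_size t p @[p --> \oo] -->
  expR (- (t * A ^+ 2)).
Proof.
move=> t0; have cr := cvg_poisson_rate (ltW t0).
have cK := @cvg_poisson_widthV R.
have cy : A / poisson_width R p @[p --> \oo] --> (0 : R).
  by rewrite -[X in _ --> X](mulr0 A); apply: cvgMr.
have cy2 : (A / poisson_width R p) ^+ 2 @[p --> \oo] --> (0 : R).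
  rewrite -[X in _ --> X](expr0n R 2).
  apply: (@continuous_cvg _ _ _ _ _ _ (fun y : R => y ^+ 2) _ _ cy).
  exact: exprn_continuous.
apply: (@squeeze_cvgr _ _ _ _
   (fun p => expR (- (poisson_rate t p * A ^+ 2 / (1 - (A / poisson_width R p) ^+ 2))))
   (fun p => expR (- (poisson_rate t p * A ^+ 2)))).
- have /cvgrPdist_lt/(_ _ ltr01) := cy; apply: filterS => p; rewrite sub0r normrN => y1.
  set y := A / _ in y1 *; set n := poisson_size t p.
  have E : poisson_rate t p * A ^+ 2 = n%:R * y ^+ 2.
    by rewrite poisson_sizeE /y; field; rewrite gt_eqF// poisson_width_gt0.
  rewrite E; apply/andP; split.
    rewrite -mulrA -mulrN expRM_natl lerXn2r ?nnegrE ?expR_ge0 ?sqr_ge0//.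
    exact: cos_sqr_ge_expR.
  rewrite -mulrN expRM_natl lerXn2r ?nnegrE ?expR_ge0 ?sqr_ge0//.
  by apply: cos_sqr_le_expR; rewrite (le_trans (ltW y1))// pihalf_ge1.
- apply: continuous_cvg; first exact: continuous_expR.
  apply: cvgN; rewrite -[X in _ --> X]mulr1; apply: cvgM; first exact: cvgMl.
  rewrite -[X in _ --> X]invr1; apply: cvgV; first exact: oner_neq0.
  by rewrite -[X in _ --> X]subr0; apply: cvgB; first exact: cvg_cst.
- apply: continuous_cvg; first exact: continuous_expR.
  by apply: cvgN; exact: cvgMl.
Qed.

Lemma cvg_bin_ratio (R : realType) (t : R) (j : nat) : 0 < t ->
  bin_ratio R (poisson_size t p) (p.*2.+1 * j) @[p --> \oo] -->
  expR (- (j%:R ^+ 2 / t)).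
Proof.
move=> t0; have cr := cvg_poisson_rate (ltW t0).
have cK := @cvg_poisson_widthV R.
have cj : j%:R / poisson_width R p @[p --> \oo] --> (0 : R).
  by rewrite -[X in _ --> X](mulr0 j%:R); apply: cvgMr.
(* With [w] the width, [r] the rate, [k = w j] and [n = r w^2], the quotients [k^2 / (n - k)] and
   [k^2 / (n + k)] become [j^2 / (r - j / w)] and [j^2 / (r + j / w)]: the two bounds on [bin_ratio]
   for [K = k]. *)
apply: (@squeeze_cvgr _ _ _ _
   (fun p => expR (- (j%:R ^+ 2 / (poisson_rate t p - j%:R / poisson_width R p))))
   (fun p => expR (- (j%:R ^+ 2 / (poisson_rate t p + j%:R / poisson_width R p))))).
- have t4 : 0 < t / 4 by rewrite divr_gt0.
  have /cvgrPdist_lt/(_ _ t4) := cj; have := near_poisson_rate t0.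
  apply: filterS2 => p rt; rewrite sub0r normrN ger0_norm; last first.
    by rewrite divr_ge0// ltW// poisson_width_gt0.
  move=> jt; set k := (p.*2.+1 * j)%N; set n := poisson_size t p.
  have kE : k%:R = poisson_width R p * j%:R by rewrite natrM.
  have nE := poisson_sizeE t p; rewrite -/n in nE.
  have K0 := poisson_width_gt0 R p.
  have jK : j%:R < poisson_rate t p * poisson_width R p.
    by rewrite -ltr_pdivrMr// (lt_le_trans jt)// (le_trans _ rt)//; lra.
  have kn : (k < n)%N.
    by rewrite -(ltr_nat R) kE nE [ltLHS]mulrC expr2 mulrA ltr_pM2r.
  have r0 : 0 < poisson_rate t p - j%:R / poisson_width R p.
    by rewrite subr_gt0 ltr_pdivrMr.
  have r1 : 0 < poisson_rate t p + j%:R / poisson_width R p.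
    by rewrite ltr_wpDr ?divr_ge0// ?(ltW K0)// (lt_le_trans _ rt)// divr_gt0.
  apply/andP; split.
    have -> : j%:R ^+ 2 / (poisson_rate t p - j%:R / poisson_width R p) =
        k%:R ^+ 2 / (n - k)%:R.
      have -> : (n - k)%:R = poisson_width R p ^+ 2 * (poisson_rate t p - j%:R / poisson_width R p).
        by rewrite natrB ?(ltnW kn)// kE nE; field; rewrite gt_eqF.
      by rewrite kE exprMn -mulf_div divff ?mul1r// expf_neq0// gt_eqF.
    exact: bin_ratio_ge.
  have -> : j%:R ^+ 2 / (poisson_rate t p + j%:R / poisson_width R p) =
      k%:R ^+ 2 / (n + k)%:R.
    have -> : (n + k)%:R = poisson_width R p ^+ 2 * (poisson_rate t p + j%:R / poisson_width R p).
      by rewrite natrD kE nE; field; rewrite gt_eqF.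
    by rewrite kE exprMn -mulf_div divff ?mul1r// expf_neq0// gt_eqF.
  by apply: bin_ratio_le => //; exact: ltnW.
- apply: continuous_cvg; first exact: continuous_expR.
  apply: cvgN; apply: cvgMr; apply: cvgV; first exact: lt0r_neq0.
  by rewrite -[X in _ --> X]subr0; apply: cvgB.
- apply: continuous_cvg; first exact: continuous_expR.
  apply: cvgN; apply: cvgMr; apply: cvgV; first exact: lt0r_neq0.
  by rewrite -[X in _ --> X]addr0; apply: cvgD.
Qed.

Lemma limn_series_fin (R : realType) (u : nat -> R) (N : nat) :
  (forall k, (N <= k)%N -> u k = 0) -> limn (series u) = \sum_(k < N) u k.
Proof.
move=> u0; apply: (@lim_near_cst R) => //.
exists N => // n /= Nn; rewrite /series /= -(subnKC Nn) big_mkord big_split_ord /=.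
by rewrite [X in _ + X]big1 ?addr0// => i _; rewrite u0// leq_addr.
Qed.

Definition gauss_term (R : realType) (t w : R) (m : int) : R :=
  expR (- (t * ((w + 2 * pi * m%:~R) / 2) ^+ 2)).

Definition gauss_sum (R : realType) (t w : R) : R :=
  gauss_term t w 0 +
  limn (series (fun k => gauss_term t w k.+1%:Z + gauss_term t w (- k.+1%:Z))).

Lemma near_poisson_size (R : realType) (t : R) (B : nat) : 0 < t ->
  \forall p \near \oo, (B <= poisson_size t p)%N.
Proof.
move=> t0; exists (Num.truncn (B%:R / t)) => // p /= pB.
rewrite truncn_ge_nat; last by rewrite mulr_ge0 ?sqr_ge0// ltW.
rewrite mulrC -ler_pdivrMr//.
have : B%:R / t < (Num.truncn (B%:R / t)).+1%:R.
  by have /andP[] := @truncn_itv R (B%:R / t) (divr_ge0 (ler0n _ _) (ltW t0)).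
move=> /ltW/le_trans; apply; rewrite -natrX ler_nat.
by apply: (@leq_trans p.+1) => //; nia.
Qed.

(** As soon as the size is positive, the square of the sequence is [wallis] at the size divided by
    the rate. *)
Lemma cvg_poisson_scale (R : realType) (k t : R) : 0 < t ->
  wallis R n @[n --> \oo] --> k ->
  poisson_width R p * ('C((poisson_size t p).*2, poisson_size t p)%:R /
    4 ^+ poisson_size t p) @[p --> \oo] --> Num.sqrt (k / t).
Proof.
move=> t0 wk.
have cw : wallis R (poisson_size t p) @[p --> \oo] --> k.
  apply: (@cvg_comp _ _ _ (poisson_size t) (wallis R) _ \oo) => //.
  by apply/cvgnyPge => B; exact: near_poisson_size.
have c2 : Num.sqrt (wallis R (poisson_size t p) / poisson_rate t p) @[p --> \oo] -->
    Num.sqrt (k / t).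
  apply: continuous_cvg; first exact: sqrt_continuous.
  apply: cvgM => //; apply: cvgV; first exact: lt0r_neq0.
  by apply: cvg_poisson_rate; exact: ltW.
apply: cvg_trans c2; apply: near_eq_cvg.
have := near_poisson_size 1 t0; apply: filterS => p n0.
set n := poisson_size t p in n0 *.
have K0 := poisson_width_gt0 R p.
have nR : 0 < n%:R :> R by rewrite ltr0n.
set C := 'C(_, _)%:R / _.
have -> : wallis R n / poisson_rate t p = (poisson_width R p * C) ^+ 2.
  by rewrite /wallis /poisson_rate -/n -/C; field; rewrite !gt_eqF.
by rewrite sqrtr_sqr ger0_norm// mulr_ge0 ?(ltW K0)// divr_ge0.
Qed.

(** Domination for Tannery's theorem. As [|w| <= pi] and [k < p], the argument of the cosine stays
    within [pi / 2], where [cos^2] is below the Gaussian, while [(w + 2 pi m) / 2] has modulus at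
    least [k + 1]. *)
Lemma poisson_term_le (R : realType) (t w : R) (p k : nat) (m : int) :
  0 < t -> `|w| <= pi -> (`|m| = k.+1)%N -> (k < p)%N -> t / 2 <= poisson_rate t p ->
  (cos ((w + 2 * pi * m%:~R) / 2 / poisson_width R p) ^+ 2) ^+ poisson_size t p
  <= expR (- (t / 2)) ^+ k.
Proof.
move=> t0 wpi mk kp rt.
have pi2 := pi_ge2 R; have K0 := poisson_width_gt0 R p.
have mR : `|m%:~R| = k.+1%:R :> R by rewrite -intr_norm -abszE mk.
set A := (w + _) / 2.
have A1 : `|2 * pi * m%:~R| = 2 * pi * k.+1%:R :> R.
  by rewrite normrM mR ger0_norm// mulr_ge0 ?pi_ge0.
have A2 : `|A| = `|w + 2 * pi * m%:~R| / 2.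
  by rewrite normrM [ `|2^-1|]ger0_norm.
have Aub : `|A| <= pi / 2 * poisson_width R p.
  rewrite A2 [leRHS]mulrAC ler_pM2r// (le_trans (ler_normD _ _))// A1.
  apply: (@le_trans _ _ (pi + 2 * pi * p%:R)).
    by rewrite lerD// ler_wpM2l ?mulr_ge0 ?pi_ge0// ler_nat.
  have -> : poisson_width R p = 2 * p%:R + 1 by rewrite /poisson_width -natr1 -mul2n natrM.
  by rewrite le_eqVlt; apply/orP; left; apply/eqP; ring.
have Alb : k.+1%:R <= `|A|.
  rewrite A2 ler_pdivlMr//.
  have : `|2 * pi * m%:~R| <= `|w + 2 * pi * m%:~R| + `|w|.
    by have := ler_normB (w + 2 * pi * m%:~R) w; rewrite addrAC subrr add0r.
  rewrite A1; have k1 : 1 <= k.+1%:R :> R by rewrite ler1n.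
  have : (pi - 2) * 1 <= (pi - 2) * k.+1%:R :> R by rewrite ler_wpM2l// subr_ge0.
  move: wpi pi2 k1; set Z := `|w + _|; set W := `|w|; set x := k.+1%:R.
  by move: (pi : R) Z W x; clear => P Z W x; lra.
apply: (@le_trans _ _ (expR (- (poisson_rate t p * A ^+ 2)))).
  have -> : - (poisson_rate t p * A ^+ 2) =
      (poisson_size t p)%:R * - (A / poisson_width R p) ^+ 2.
    by rewrite poisson_sizeE; field; rewrite gt_eqF.
  rewrite expRM_natl lerXn2r ?nnegrE ?expR_ge0 ?sqr_ge0// cos_sqr_le_expR//.
  by rewrite normrM normfV [X in _ / X]ger0_norm ?(ltW K0)// ler_pdivrMr.
rewrite -expRM_natl ler_expR mulrN lerN2 mulrC ler_pM ?divr_ge0 ?(ltW t0)//.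
apply: (@le_trans _ _ (k.+1%:R ^+ 2)); first by rewrite -natrX ler_nat; nia.
by rewrite -[leRHS]real_normK ?num_real// lerXn2r// nnegrE.
Qed.

Lemma is_cvg_series_expR (R : realType) (s : R) : 0 < s ->
  cvgn (series (fun k => 2 * expR (- s) ^+ k)).
Proof.
move=> s0; apply: is_cvg_geometric_series.
by rewrite ger0_norm ?expR_ge0// expR_lt1 oppr_lt0.
Qed.

Lemma poisson_summation (R : realType) : exists2 k : R, 0 < k &
  forall t w : R, 0 < t -> `|w| <= pi ->
  gauss_sum t w = Num.sqrt (k / t) * theta_cos (expR (- t^-1)) w.
Proof.
have [k k0 wk] := wallis_cvg R; exists k => // t w t0 wpi.
pose c p (m : int) : R :=
  (cos ((w + 2 * pi * m%:~R) / 2 / poisson_width R p) ^+ 2) ^+ poisson_size t p.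
pose a p j := if (j < p)%N then c p j.+1%:Z + c p (- j.+1%:Z) else 0.
pose b p j : R := 2 * bin_ratio R (poisson_size t p) (p.*2.+1 * j.+1) * cos (j.+1%:R * w).
have cc m : c p m @[p --> \oo] --> gauss_term t w m by exact: cvg_cos_pow.
have finE p : c p 0 + limn (series (a p)) =
    poisson_width R p * ('C((poisson_size t p).*2, poisson_size t p)%:R /
    4 ^+ poisson_size t p) * (1 + limn (series (b p))).
  rewrite (@limn_series_fin _ (a p) p); last by move=> j; rewrite /a leqNgt => /negbTE ->.
  rewrite (@limn_series_fin _ (b p) (poisson_size t p)); last first.
    by move=> j nj; rewrite /b bin_ratio_gt ?mulr0 ?mul0r//; nia.
  rewrite -poisson_finite.
  under eq_bigr do rewrite /a ltn_ord.
  rewrite -big_ord_int_sym; apply: eq_bigr => i _; rewrite /c /poisson_width; congr ((cos _ ^+ 2) ^+ _).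
  by rewrite invfM mulrA.
have cvL : c p 0 + limn (series (a p)) @[p --> \oo] --> gauss_sum t w.
  apply: cvgD; first exact: cc.
  apply: (tannery (M := fun j => 2 * expR (- (t / 2)) ^+ j)).
  - have := near_poisson_rate t0; apply: filterS => p rt j.
    rewrite /a; case: ifPn => [jp|_]; last by rewrite normr0 mulr_ge0// exprn_ge0// expR_ge0.
    have c_ge0 m : 0 <= c p m by rewrite exprn_ge0// sqr_ge0.
    rewrite ger0_norm ?addr_ge0// -[2]/(1 + 1) mulrDl mul1r.
    by apply: lerD; apply: poisson_term_le => //.
  - by apply: is_cvg_series_expR; rewrite divr_gt0.
  - move=> j; apply: (cvg_trans _ (cvgD (cc j.+1%:Z) (cc (- j.+1%:Z)))).
    apply: near_eq_cvg; exists j.+1 => // p /= jp; by rewrite /a jp.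
have cvR : 1 + limn (series (b p)) @[p --> \oo] --> theta_cos (expR (- t^-1)) w.
  apply: cvgD; first exact: cvg_cst.
  apply: (tannery (M := fun j => 2 * expR (- ((2 * t)^-1)) ^+ j)).
  - apply: nearW => p j.
    rewrite /b normrM (ger0_norm (_ : 0 <= 2 * _)); last first.
      by rewrite mulr_ge0// bin_ratio_ge0.
    rewrite -[leRHS]mulr1; apply: ler_pM => //; last exact: cos_max.
      by rewrite mulr_ge0// bin_ratio_ge0.
    rewrite ler_pM2l//; set m := (p.*2.+1 * j.+1)%N; set n := poisson_size t p.
    have [nm|mn] := ltnP n m; first by rewrite bin_ratio_gt// exprn_ge0// expR_ge0.
    (* Here [K = n], so the bound is [expR (- m^2 / (2n))]; since [n <= t (2p+1)^2] and
       [m = (2p+1) (j+1)], it lies below the geometric one. *)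
    apply: le_trans (bin_ratio_le R mn mn) _.
    rewrite -expRM_natl ler_expR mulrN lerN2.
    have n0 : (0 < n)%N by apply: leq_trans mn; rewrite muln_gt0.
    have nR : 0 < n%:R :> R by rewrite ltr0n.
    have nt : n%:R / t <= p.*2.+1%:R ^+ 2.
      have /andP[_ rt] := poisson_rate_bounds p (ltW t0).
      by rewrite ler_pdivrMr// poisson_sizeE mulrC ler_wpM2l ?sqr_ge0.
    rewrite addnn -mul2n natrM ler_pdivlMr ?mulr_gt0// natrM exprMn.
    have -> : j%:R / (2 * t) * (2 * n%:R) = n%:R / t * j%:R by field; rewrite gt_eqF.
    apply: ler_pM => //; first by rewrite divr_ge0// ltW.
    by rewrite -natrX ler_nat; nia.
  - by apply: is_cvg_series_expR; rewrite invr_gt0 mulr_gt0.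
  - move=> j; apply: cvgMl; apply: cvgMr.
    have := @cvg_bin_ratio R t j.+1 t0; rewrite -natrX -mulrN expRM_natl.
    exact.
rewrite -(cvg_lim (@Rhausdorff R) cvL) (funext finE).
by apply: (cvg_lim (@Rhausdorff R)); apply: cvgM => //; exact: cvg_poisson_scale.
Qed.

(** * Convexity of the logarithm of the theta function *)

(** Finite sums are used so that no series has to be differentiated; Jensen's inequality is what
    passes to the limit. The next two sums are the negated first derivative and the second
    derivative. *)
Definition gauss_trunc (R : realType) (M : nat) (x : R) : R :=
  \sum_(n < M) 2 * expR (- (pi * n.+1%:R ^+ 2 * expR x)).

Definition gauss_trunc1 (R : realType) (M : nat) (x : R) : R :=
  \sum_(n < M) 2 * (pi * n.+1%:R ^+ 2 * expR x) * expR (- (pi * n.+1%:R ^+ 2 * expR x)).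

Definition gauss_trunc2 (R : realType) (M : nat) (x : R) : R :=
  \sum_(n < M) 2 * (pi * n.+1%:R ^+ 2 * expR x) * (pi * n.+1%:R ^+ 2 * expR x - 1) *
     expR (- (pi * n.+1%:R ^+ 2 * expR x)).

Lemma is_derive_expN (R : realType) (c x : R) :
  is_derive x 1 (fun y => expR (- (c * expR y)))
    (- (c * expR x * expR (- (c * expR x)))).
Proof.
have -> : (fun y => expR (- (c * expR y))) = expR \o (- c \*: expR).
  by apply/funext => y /=; rewrite /GRing.scale /= mulNr.
apply: is_derive_eq; rewrite /= /GRing.scale /= !mulNr mulrC; ring.
Qed.

Lemma is_derive_big_ord (R : realType) (M : nat) (h dh : nat -> R -> R) (x : R) :
  (forall n, is_derive x 1 (h n) (dh n x)) ->
  is_derive x 1 (fun y => \sum_(n < M) h n y) (\sum_(n < M) dh n x).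
Proof.
move=> dhx; elim: M => [|M IHM].
  under eq_fun do rewrite big_ord0.
  by rewrite big_ord0; exact: is_derive_cst.
under eq_fun do rewrite big_ord_recr /=.
by rewrite big_ord_recr /=; exact: is_deriveD.
Qed.

Lemma is_derive_gauss_trunc (R : realType) (M : nat) (x : R) :
  is_derive x 1 (gauss_trunc M) (- gauss_trunc1 M x).
Proof.
rewrite /gauss_trunc1 -sumrN.
pose dh (n : nat) (x : R) :=
  - (2 * (pi * n.+1%:R ^+ 2 * expR x) * expR (- (pi * n.+1%:R ^+ 2 * expR x))).
apply: (@is_derive_big_ord _ _ (fun n y => 2 * expR (- (pi * n.+1%:R ^+ 2 * expR y))) dh) => n.
apply: (is_derive_eq (is_deriveZ 2 (is_derive_expN (pi * n.+1%:R ^+ 2) x))).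
by rewrite /dh /GRing.scale /=; ring.
Qed.

Lemma is_derive_gauss_trunc1 (R : realType) (M : nat) (x : R) :
  is_derive x 1 (gauss_trunc1 M) (- gauss_trunc2 M x).
Proof.
rewrite /gauss_trunc2 -sumrN.
pose dh (n : nat) (x : R) := - (2 * (pi * n.+1%:R ^+ 2 * expR x) *
   (pi * n.+1%:R ^+ 2 * expR x - 1) * expR (- (pi * n.+1%:R ^+ 2 * expR x))).
apply: (@is_derive_big_ord _ _ (fun n y => 2 * (pi * n.+1%:R ^+ 2 * expR y) *
  expR (- (pi * n.+1%:R ^+ 2 * expR y))) dh) => n.
under eq_fun do rewrite mulrA.
apply: (is_derive_eq (is_deriveM
  (is_deriveZ (2 * (pi * n.+1%:R ^+ 2)) (is_derive_expR x))
  (is_derive_expN (pi * n.+1%:R ^+ 2) x))).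
by rewrite /dh /= /GRing.scale /= /GRing.scale /=; ring.
Qed.

Lemma gauss_trunc_ge0 (R : realType) (M : nat) (x : R) : 0 <= gauss_trunc M x.
Proof. by apply: sumr_ge0 => n _; rewrite mulr_ge0// expR_ge0. Qed.

Lemma gauss_trunc1_ge0 (R : realType) (M : nat) (x : R) : 0 <= gauss_trunc1 M x.
Proof.
apply: sumr_ge0 => n _; rewrite !mulr_ge0 ?expR_ge0 ?pi_ge0//.
Qed.

Lemma five_le_expR (R : realType) (u : R) : 9 / 5 <= u -> 5 <= expR u.
Proof.
move=> u18; apply: (@le_trans _ _ (expR (1 / 10) ^+ 18)).
  apply: (@le_trans _ _ ((11 / 10) ^+ 18)); first by lra.
  have h : 11 / 10 <= expR (1 / 10) :> R by apply: le_trans (expR_ge1Dx _); lra.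
  have h0 : 0 <= 11 / 10 :> R by lra.
  by rewrite lerXn2r// nnegrE (le_trans h0).
by rewrite -expRM_natl ler_expR; lra.
Qed.

(** With [u = pi e^x], the term of index [n] is at most [2 u e^(-u) r^n] for
    [r = 4 e^(-3u) <= 4/125], because [(n+1)^2 <= 4^n] and [(n+1)^2 >= 1 + 3n]. The total is at most
    [(50/121) u], which is below [u - 1] once [u >= 9/5]. *)
Lemma gauss_trunc1_le (R : realType) (M : nat) (x : R) : 9 / 5 <= pi * expR x ->
  gauss_trunc1 M x <= pi * expR x - 1.
Proof.
set u := pi * expR x => u18; have u0 : 0 < u by lra.
have E5 := five_le_expR u18.
pose r : R := 4 * expR (- (3 * u)).
have r0 : 0 <= r by rewrite mulr_ge0 ?expR_ge0.
have r1 : r <= 4 / 125.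
  rewrite /r expRN expRM_natl ler_pM2l//.
  rewrite lef_pV2 ?posrE ?exprn_gt0 ?expR_gt0//.
  by apply: (@le_trans _ _ (5 ^+ 3)); [lra|rewrite lerXn2r ?nnegrE ?expR_ge0].
have geo : \sum_(n < M) r ^+ n <= 125 / 121.
  have S0 : 0 <= \sum_(n < M) r ^+ n by apply: sumr_ge0 => n _; exact: exprn_ge0.
  have := subrX1 r M; have := exprn_ge0 M r0.
  by move: (r ^+ M) (\sum_(n < M) _) S0 => a S; nra.
apply: (@le_trans _ _ (2 * u * expR (- u) * (125 / 121))); last first.
  have e5 : (expR u)^-1 <= 5^-1 by rewrite lef_pV2 ?posrE ?expR_gt0.
  have : 2 * u * expR (- u) <= 2 * u * 5^-1.
    by rewrite expRN ler_wpM2l// mulr_ge0// ltW.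
  by move: (2 * u * expR _) => y; lra.
apply: (@le_trans _ _ (2 * u * expR (- u) * \sum_(n < M) r ^+ n)); last first.
  by rewrite ler_wpM2l// mulr_ge0 ?expR_ge0// mulr_ge0// ltW.
rewrite mulr_sumr; apply: ler_sum => n _.
have n2 : n.+1%:R ^+ 2 <= 4 ^+ n :> R.
  rewrite -!natrX ler_nat; elim: (nat_of_ord n) => // k IH.
  by rewrite [leqRHS]expnS; apply: leq_trans (leq_mul (leqnn 4) IH); nia.
have -> : pi * n.+1%:R ^+ 2 * expR x = u * n.+1%:R ^+ 2 by rewrite /u; ring.
have -> : 2 * u * expR (- u) * r ^+ n =
    2 * u * (4 ^+ n * expR (- u - n%:R * (3 * u))).
  by rewrite expRD /r exprMn -expRM_natl mulrN; ring.
rewrite [2 * (u * _)]mulrA -[leLHS]mulrA ler_pM2l ?(mulr_gt0 _ u0)//.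
apply: ler_pM; [exact: sqr_ge0|exact: expR_ge0|exact: n2|].
rewrite ler_expR -natr1.
have : 0 <= n%:R * (n%:R - 1) * u.
  rewrite mulr_ge0 ?(ltW u0)//; case: (nat_of_ord n) => [|k]; first by rewrite mul0r.
  by rewrite mulr_ge0// subr_ge0 ler1n.
by move: (n%:R : R) => y; lra.
Qed.

Lemma gauss_trunc2_ge (R : realType) (M : nat) (x : R) :
  (pi * expR x - 1) * gauss_trunc1 M x <= gauss_trunc2 M x.
Proof.
rewrite mulr_sumr; apply: ler_sum => n _.
set a := pi * _ * _; rewrite [leRHS]mulrAC [leLHS]mulrC.
have a0 : 0 <= 2 * a * expR (- a) by rewrite !mulr_ge0 ?expR_ge0 ?pi_ge0.
rewrite ler_wpM2l// lerD2r /a mulrAC ler_peMr ?mulr_ge0 ?expR_ge0 ?pi_ge0//.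
by rewrite -natrX ler1n expn_gt0.
Qed.

Lemma one_add_gauss_trunc_gt0 (R : realType) (M : nat) (x : R) : 0 < 1 + gauss_trunc M x.
Proof. by rewrite ltr_pwDl// gauss_trunc_ge0. Qed.

Lemma is_derive_ln_gauss (R : realType) (M : nat) (x : R) :
  is_derive x 1 (fun y => ln (1 + gauss_trunc M y))
    (- (gauss_trunc1 M x / (1 + gauss_trunc M x))).
Proof.
have d1 := is_deriveD (is_derive_cst (1 : R) x 1) (is_derive_gauss_trunc M x).
have d2 := is_derive1_ln (one_add_gauss_trunc_gt0 M x).
rewrite -[X in is_derive _ _ X]/((@ln R) \o (cst 1 + gauss_trunc M)).
apply: (is_derive_eq (@is_derive1_comp _ (@ln R) (cst 1 + gauss_trunc M) _ _ _ d2 d1)).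
by rewrite add0r mulrN mulrC.
Qed.

(* [pi * expR (- (1 / 10)) >= 9 / 5], and beyond this value the crude bounds on
   [gauss_trunc1] and [gauss_trunc2] make the logarithm convex. *)
Lemma ln_gauss_slope_le (R : realType) (M : nat) (x y : R) : - (1 / 10) <= x -> x <= y ->
  - (gauss_trunc1 M x / (1 + gauss_trunc M x)) <= - (gauss_trunc1 M y / (1 + gauss_trunc M y)).
Proof.
move=> x1 xy.
pose F (z : R) : R := 1 + gauss_trunc M z.
have F0 z : 0 < F z by exact: one_add_gauss_trunc_gt0.
have dF (z : R) : is_derive z 1 F (- gauss_trunc1 M z).
  apply: (is_derive_eq (is_deriveD (is_derive_cst (1 : R) z 1) (is_derive_gauss_trunc M z))).
  by rewrite add0r.
pose d (z : R) : R := (gauss_trunc2 M z * F z - gauss_trunc1 M z ^+ 2) / F z ^+ 2.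
apply: (@is_derive_ge0_le R (fun z => - (gauss_trunc1 M z / F z)) d) => // z /andP[xz zy].
  have Fz : F z != 0 by rewrite gt_eqF.
  have H := is_deriveN (is_deriveM (is_derive_gauss_trunc1 M z) (is_deriveV Fz (dF z))).
  apply: (is_derive_eq H); rewrite /d /= /GRing.scale /=; field.
  by rewrite gt_eqF.
rewrite divr_ge0 ?sqr_ge0// subr_ge0.
have pz : 9 / 5 <= pi * expR z.
  have e9 : 9 / 10 <= expR z.
    by apply: le_trans (expR_ge1Dx _); apply: (@le_trans _ _ (1 + x)); lra.
  have : 0 <= (pi - 2) * expR z by rewrite mulr_ge0 ?expR_ge0// subr_ge0 pi_ge2.
  by rewrite mulrBl; move: (pi * expR z) => q; lra.
(* Together the two bounds give [gauss_trunc1^2 <= gauss_trunc2], and [F z >= 1] then makes the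
   numerator of [d] nonnegative. *)
have S1 := gauss_trunc1_le M pz; have S2 := gauss_trunc2_ge M z.
have S1_0 := gauss_trunc1_ge0 M z.
have S12 : gauss_trunc1 M z ^+ 2 <= gauss_trunc2 M z.
  by apply: le_trans S2; rewrite expr2 ler_wpM2r.
apply: (le_trans S12); rewrite ler_peMr ?(le_trans (sqr_ge0 _) S12)//.
by rewrite lerDl gauss_trunc_ge0.
Qed.

Lemma derive_ndecr_tangent (R : realType) (f df : R -> R) (a x y : R) :
  (forall z : R, is_derive z 1 f (df z)) ->
  (forall z t, a <= z -> z <= t -> df z <= df t) ->
  a <= x -> a <= y -> f y + df y * (x - y) <= f x.
Proof.
move=> fd dnd ax ay.
have cf (b c : R) : {within `[b, c], continuous f}.
  by apply: derivable_within_continuous => z _; exact: ex_derive.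
have [yx|xy] := leP y x.
  have [c + E] := MVT_segment yx (fun z _ => fd z) (cf _ _).
  rewrite in_itv /= => /andP[yc cx]; rewrite addrC -lerBrDr E.
  by rewrite ler_wpM2r ?subr_ge0// dnd.
have [c + E] := MVT_segment (ltW xy) (fun z _ => fd z) (cf _ _).
rewrite in_itv /= => /andP[xc cy].
have : df c * (y - x) <= df y * (y - x).
  by rewrite ler_wpM2r ?subr_ge0 ?(ltW xy)// dnd// (le_trans ax).
by rewrite -E -[x - y]opprB mulrN; move: (df y * _) => q; lra.
Qed.

Lemma ln_gauss_tangent (R : realType) (M : nat) (x y : R) :
  - (1 / 10) <= x -> - (1 / 10) <= y ->
  ln (1 + gauss_trunc M y) -
    gauss_trunc1 M y / (1 + gauss_trunc M y) * (x - y) <=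
  ln (1 + gauss_trunc M x).
Proof.
move=> x1 y1; rewrite -mulNr.
exact: (derive_ndecr_tangent (@is_derive_ln_gauss R M) (@ln_gauss_slope_le R M)).
Qed.

Definition lattice_theta (R : realType) (s : R) : R :=
  1 + limn (series (fun n => 2 * expR (- (s * n.+1%:R ^+ 2)))).

Lemma is_cvg_lattice_theta (R : realType) (s : R) : 0 < s ->
  cvgn (series (fun n => 2 * expR (- (s * n.+1%:R ^+ 2)))).
Proof.
move=> s0; apply: (@series_le_cvg _ _ (fun k => 2 * expR (- s) ^+ k)).
- by move=> n; rewrite mulr_ge0// expR_ge0.
- by move=> n; rewrite mulr_ge0// exprn_ge0// expR_ge0.
- move=> n; rewrite ler_pM2l// -expRM_natl ler_expR mulrN lerN2 mulrC ler_pM2l//.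
  by rewrite -natrX ler_nat; nia.
- apply: is_cvg_geometric_series.
  by rewrite ger0_norm ?expR_ge0// expR_lt1 oppr_lt0.
Qed.

Lemma lattice_theta_ge1 (R : realType) (s : R) : 0 < s -> 1 <= lattice_theta s.
Proof.
move=> s0; rewrite lerDl; apply: limr_ge; first exact: is_cvg_lattice_theta.
by apply: nearW => n; apply: sumr_ge0 => k _; rewrite mulr_ge0// expR_ge0.
Qed.

Lemma cvg_gauss_trunc (R : realType) (x : R) :
  ln (1 + gauss_trunc M x) @[M --> \oo] --> ln (lattice_theta (pi * expR x)).
Proof.
have u0 : 0 < pi * expR x by rewrite mulr_gt0 ?pi_gt0 ?expR_gt0.
apply: continuous_cvg.
  by apply: continuous_ln; apply: lt_le_trans (lattice_theta_ge1 u0).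
apply: cvgD; first exact: cvg_cst.
have -> : (fun M => gauss_trunc M x) =
    series (fun n => 2 * expR (- (pi * expR x * n.+1%:R ^+ 2))).
  apply/funext => M; rewrite /series /= big_mkord; apply: eq_bigr => n _.
  by rewrite mulrAC.
exact: is_cvg_lattice_theta.
Qed.

(** Averaging the tangents at the barycentre cancels the slope, so the inequality left to pass to
    the limit is free of derivatives. *)
Lemma ln_theta_jensen (R : realType) (I : finType) (c x : I -> R) :
  (forall i, 0 <= c i) -> \sum_i c i = 1 -> (forall i, - (1 / 10) <= x i) ->
  ln (lattice_theta (pi * expR (\sum_i c i * x i))) <=
  \sum_i c i * ln (lattice_theta (pi * expR (x i))).
Proof.
move=> c0 c1 x1; set y := \sum_i c i * x i.
have y1 : - (1 / 10) <= y.
  have <- : \sum_i c i * - (1 / 10) = - (1 / 10) by rewrite -mulr_suml c1 mul1r.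
  apply: ler_sum => i _.
  by rewrite ler_wpM2l.
have cr : \sum_i c i * ln (1 + gauss_trunc M (x i)) @[M --> \oo] -->
    \sum_i c i * ln (lattice_theta (pi * expR (x i))).
  apply: cvg_big => [|i _]; first exact: add_continuous.
  by apply: cvgMr; exact: cvg_gauss_trunc.
apply: (ler_cvg_to (@cvg_gauss_trunc _ y) cr); apply: nearW => M.
have affine (L s z : R) : \sum_i c i * (L - s * (x i - z)) =
    (\sum_i c i) * (L + s * z) - s * \sum_i c i * x i.
  rewrite mulr_suml [X in _ - X]mulr_sumr -sumrB; apply: eq_bigr => i _; ring.
set L := ln (1 + gauss_trunc M y); set s := gauss_trunc1 M y / (1 + gauss_trunc M y).
apply: (@le_trans _ _ (\sum_i c i * (L - s * (x i - y)))).
  by rewrite affine c1 -/y mul1r addrK.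
by apply: ler_sum => i _; rewrite ler_wpM2l// ln_gauss_tangent.
Qed.

(** Convexity across [0] and evenness put the minimum at [0], so [f] is nondecreasing on the
    positive side. Replacing each [x i] by its absolute value then increases the left side,
    preserves the right side and brings all arguments into the half-line. *)
Lemma even_jensen (R : realType) (f : R -> R) (a : R) : 0 < a ->
  (forall x, f (- x) = f x) ->
  (forall (I : finType) (c x : I -> R), (forall i, 0 <= c i) -> \sum_i c i = 1 ->
    (forall i, - a <= x i) -> f (\sum_i c i * x i) <= \sum_i c i * f (x i)) ->
  forall (I : finType) (c x : I -> R), (forall i, 0 <= c i) -> \sum_i c i = 1 ->
    f (\sum_i c i * x i) <= \sum_i c i * f (x i).
Proof.
move=> a0 ev cvx.
have cvx2 l x y : 0 <= l <= 1 -> - a <= x -> - a <= y ->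
    f (l * x + (1 - l) * y) <= l * f x + (1 - l) * f y.
  move=> /andP[l0 l1] ax ay.
  have := cvx bool (fun b => if b then l else 1 - l) (fun b => if b then x else y).
  by rewrite !big_bool /=; apply; [case; rewrite ?subr_ge0|rewrite subrKC|case].
have f0 y : 0 <= y -> y <= a -> f 0 <= f y.
  move=> y0 ya; have := cvx2 2^-1 y (- y).
  rewrite ev -mulrDl subrKC mul1r mulrN -mulrBl.
  rewrite (_ : 2^-1 - (1 - 2^-1) = 0) ?mul0r; last by lra.
  by apply; [lra|lra|lra].
have {}f0 y : 0 <= y -> f 0 <= f y.
  move=> y0; have [|ay] := leP y a; first exact: f0.
  have yp : 0 < y by exact: lt_trans ay.
  have l01 : 0 <= a / y <= 1.
    by rewrite divr_ge0 ?(ltW a0)//= ler_pdivrMr// mul1r ltW.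
  have := cvx2 (a / y) y 0 l01; rewrite mulr0 addr0 divfK ?gt_eqF//.
  have fa := f0 a (ltW a0) (lexx _).
  have l0 : 0 < a / y by rewrite divr_gt0.
  move=> H; have {}H := le_trans fa (H ltac:(lra) ltac:(lra)).
  rewrite -(ler_pM2l l0); move: H; rewrite mulrBl mul1r; lra.
have fnd x y : 0 <= x -> x <= y -> f x <= f y.
  rewrite le_eqVlt => /predU1P[<-|x0] xy; first exact: f0.
  have y0 : 0 < y by exact: lt_le_trans xy.
  have l01 : 0 <= x / y <= 1.
    by rewrite divr_ge0 ?(ltW x0) ?(ltW y0)//= ler_pdivrMr// mul1r.
  have := cvx2 (x / y) y 0 l01; rewrite mulr0 addr0 divfK ?gt_eqF//.
  move=> /(_ ltac:(lra) ltac:(lra))/le_trans; apply.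
  case/andP: l01 => _ l1.
  have := ler_wpM2l (_ : 0 <= 1 - x / y) (f0 y (ltW y0)).
  rewrite subr_ge0 => /(_ l1); rewrite !mulrBl !mul1r; lra.
have fabs x : f `|x| = f x by case: (ger0P x).
move=> I c x c0 c1.
rewrite -fabs; apply: (@le_trans _ _ (f (\sum_i c i * `|x i|))).
  apply: fnd => //; apply: le_trans (ler_norm_sum _ _ _) _.
  by apply: ler_sum => i _; rewrite normrM ger0_norm.
apply: le_trans (cvx I c (fun i => `|x i|) c0 c1 _) _.
  by move=> i; rewrite (le_trans _ (normr_ge0 _))// oppr_le0 ltW.
by apply: ler_sum => i _; rewrite fabs.
Qed.

Lemma eq_limn_series (R : realType) (u v : nat -> R) :
  u =1 v -> limn (series u) = limn (series v).
Proof. by move=> /funext ->. Qed.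

(** * The functional equation and the product inequality *)

Lemma theta_cos0 (R : realType) (s : R) : theta_cos (expR (- s)) 0 = lattice_theta s.
Proof.
rewrite /theta_cos /lattice_theta; congr (_ + _); apply: eq_limn_series => j.
rewrite mulr0 cos0 mulr1 -expRM_natl; congr (2 * expR _).
by rewrite natrX mulrN mulrC.
Qed.

Lemma gauss_sum0 (R : realType) (t : R) : gauss_sum t 0 = lattice_theta (t * pi ^+ 2).
Proof.
have term m : gauss_term t 0 m = expR (- (t * pi ^+ 2 * m%:~R ^+ 2)).
  by rewrite /gauss_term add0r; congr (expR (- _)); field.
rewrite /gauss_sum /lattice_theta term expr0n mulr0 oppr0 expR0.
congr (_ + _); apply: eq_limn_series => j.
by rewrite !term rmorphN sqrrN -pmulrn; ring.
Qed.

(** Poisson summation at [w = 0] and [t = e^x / pi] exchanges [pi e^x] and [pi e^(-x)] up to a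
    factor [e^(-x/2)], which the terms in [x / 4] share evenly. *)
Lemma theta_func_eq (R : realType) (x : R) :
  ln (lattice_theta (pi * expR (- x))) + (- x) / 4 =
  ln (lattice_theta (pi * expR x)) + x / 4.
Proof.
have [k k0 P] := poisson_summation R.
have pi0 : (pi : R) != 0 by rewrite gt_eqF// pi_gt0.
have th0 (y : R) : 0 < lattice_theta (pi * expR y).
  apply: (lt_le_trans ltr01); apply: lattice_theta_ge1.
  by apply: mulr_gt0; [exact: pi_gt0|exact: expR_gt0].
have sq (y : R) : lattice_theta (pi * expR y) ^+ 2 =
    k * pi * expR (- y) * lattice_theta (pi * expR (- y)) ^+ 2.
  have t0 : 0 < expR y / pi by rewrite divr_gt0 ?pi_gt0 ?expR_gt0.
  have := P (expR y / pi) 0 t0; rewrite normr0 pi_ge0 => /(_ isT).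
  rewrite gauss_sum0 theta_cos0 invf_div expRN.
  have -> : expR y / pi * pi ^+ 2 = pi * expR y.
    by move: (pi : R) pi0 => p p0; field.
  move=> ->; rewrite exprMn sqr_sqrtr; last first.
    by rewrite mulr_ge0 ?divr_ge0 ?pi_ge0 ?expR_ge0// ltW.
  by rewrite [k * (_ / _)]mulrA.
(* At [y = 0] the two theta values coincide, which determines the constant left open by Poisson
   summation. *)
have kpi : k * pi = 1.
  have := sq 0; rewrite oppr0 expR0 !mulr1 => H.
  apply: (mulIf (lt0r_neq0 (exprn_gt0 2 (th0 0)))).
  by rewrite mul1r expR0 mulr1 -H.
have := sq x; rewrite kpi mul1r.
move: (lattice_theta _) (lattice_theta _) (th0 x) (th0 (- x)) => A B A0 B0.
move=> /(congr1 (@ln R)).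
rewrite (lnXn 2 A0) lnM ?posrE ?expR_gt0 ?exprn_gt0// (lnXn 2 B0) expRK !mulr2n.
by move: (ln A) (ln B) => a b; lra.
Qed.

(** In logarithmic coordinates the geometric mean is a barycentre. The linear term [x / 4]
    contributes equally to both sides of Jensen's inequality and cancels. *)
Lemma lattice_theta_prod (R : realType) (d : nat) (s : 'I_d -> R) (m : R) :
  (0 < d)%N -> (forall l, 0 < s l) -> 0 < m -> m ^+ d = \prod_l s l ->
  lattice_theta m ^+ d <= \prod_l lattice_theta (s l).
Proof.
move=> d0 s0 m0 md; have pi0 := pi_gt0 R.
have dR : d%:R != 0 :> R by rewrite pnatr_eq0 -lt0n.
pose f (x : R) := ln (lattice_theta (pi * expR x)) + x / 4.
pose x l := ln (s l / pi).
have sx l : s l = pi * expR (x l).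
  by rewrite /x lnK ?posrE ?divr_gt0// mulrC divfK// gt_eqF.
have th0 l : 0 < lattice_theta (s l).
  by rewrite (lt_le_trans ltr01)// lattice_theta_ge1.
have mx : m = pi * expR (\sum_l d%:R^-1 * x l).
  have e0 : 0 <= pi * expR (\sum_l d%:R^-1 * x l).
    by rewrite mulr_ge0 ?expR_ge0 ?ltW.
  apply: (pexpIrn d0); rewrite ?nnegrE ?(ltW m0)//.
  rewrite md exprMn -expRM_natl -mulr_sumr mulrA divff// mul1r expR_sum.
  under eq_bigr do rewrite sx.
  by rewrite big_split /= prodr_const card_ord.
have := @even_jensen R f (1 / 10) ltac:(lra) _ _ 'I_d (fun=> d%:R^-1) x.
have c1 : \sum_(i < d) d%:R^-1 = 1 :> R by rewrite sumr_const card_ord -[d%:R^-1 *+ d]mulr_natr mulVf.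
move=> /(_ _ _ _ c1) H.
have {}H : f (\sum_l d%:R^-1 * x l) <= \sum_l d%:R^-1 * f (x l).
  apply: H => [y|I c y c0 cc1 yb|i]; first exact: theta_func_eq.
    rewrite /f; under [leRHS]eq_bigr do rewrite mulrDr.
    rewrite big_split /= lerD ?ln_theta_jensen// mulr_suml.
    by apply: ler_sum => i _; rewrite mulrA.
  by rewrite invr_ge0.
have {}H : ln (lattice_theta m) <= \sum_l d%:R^-1 * ln (lattice_theta (s l)).
  move: H; rewrite /f; under [leRHS]eq_bigr do rewrite mulrDr -sx.
  rewrite big_split /= -mx mulr_suml.
  by under [X in _ + X <= _]eq_bigr do rewrite -mulrA; rewrite lerD2r.
have thm : 0 < lattice_theta m by rewrite (lt_le_trans ltr01)// lattice_theta_ge1.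
rewrite -[leLHS]lnK ?posrE ?exprn_gt0// lnXn// -mulr_natl.
have -> : \prod_l lattice_theta (s l) =
    expR (d%:R * \sum_l d%:R^-1 * ln (lattice_theta (s l))).
  rewrite -mulr_sumr mulrA divff// mul1r expR_sum.
  by apply: eq_bigr => l _; rewrite lnK// posrE.
by rewrite ler_expR ler_wpM2l.
Qed.

(** * Periodic sets and their potentials *)

Lemma nneseries_EFin (R : realType) (u : nat -> R) :
  cvgn (series u) -> (\sum_(0 <= k <oo) (u k)%:E)%E = (limn (series u))%:E.
Proof.
move=> cu; rewrite -EFin_lim//.
rewrite (_ : (fun n => _) = EFin \o series u)//.
by apply/funext => n; rewrite /= /series /= sumEFin.
Qed.

Lemma esum_int (R : realType) (f : int -> R) : (forall z, 0 <= f z) ->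
  cvgn (series (fun n => f n.+1%:Z + f (- n.+1%:Z))) ->
  (\esum_(z in [set: int]) (f z)%:E)%E =
  (f 0 + limn (series (fun n => f n.+1%:Z + f (- n.+1%:Z))))%:E.
Proof.
move=> f0 cf.
have f0' z : (0 <= (f z)%:E)%E by rewrite lee_fin.
rewrite (esumID (range Posz))// !setTI.
have -> : ~` range Posz = range Negz.
  apply/seteqP; split => [[n|n] /= H|_ [n _ <-] [m _]]//.
    by exfalso; apply: H; exists n.
  by exists n.
rewrite !esum_image; try by move=> a b _ _ [].
rewrite -!nneseries_esumT// nneseries_recl//= EFinD -addeA; congr (_ + _)%E.
rewrite -nneseries_EFin//.
under [RHS]eq_eseriesr do rewrite EFinD.
rewrite nneseriesD//; congr (_ + _)%E.
rewrite -(@nneseries_addn _ (fun k => (f (Posz k))%:E) 1)//.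
by apply: eq_eseriesr => n _; rewrite addn1.
Qed.

(** [P] is the disjoint union of the cosets [x i + L] of a subgroup [L]. The same form covers the
    line, boxes and configurations in any dimension, and lets one set carry several
    presentations. *)
Record presents (T : zmodType) (I : finType) (L : set T)
    (x : I -> T) (P : set T) : Prop := Presents {
  presents0 : L 0;
  presentsB : forall a b, L a -> L b -> L (a - b);
  presentsP : forall p, P p <-> exists i, L (p - x i);
  presents_inj : forall i j, L (x i - x j) -> i = j
}.

Lemma presentsD (T : zmodType) (I : finType) (L : set T) (x : I -> T) (P : set T) :
  presents L x P -> forall a b, L a -> L b -> L (a + b).
Proof.
case=> L0 LB _ _ a b La Lb; rewrite -[b]opprK; apply: (LB _ _ La).
by rewrite -sub0r; exact: LB.
Qed.

Lemma presentsN (T : zmodType) (I : finType) (L : set T) (x : I -> T) (P : set T) :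
  presents L x P -> forall a, L a -> L (- a).
Proof. by case=> L0 LB _ _ a La; rewrite -sub0r; exact: LB. Qed.

Lemma presents_mem (T : zmodType) (I : finType) (L : set T) (x : I -> T) (P : set T) :
  presents L x P -> forall i, P (x i).
Proof. by move=> pr i; apply/(presentsP pr); exists i; rewrite subrr; exact: presents0 pr. Qed.

Lemma presents_shift (T : zmodType) (I : finType) (L : set T) (x : I -> T) (P : set T) :
  presents L x P -> forall l p, L l -> P p -> P (p + l).
Proof.
move=> pr l p Ll /(presentsP pr)[i Li]; apply/(presentsP pr); exists i.
by rewrite addrAC; exact: presentsD pr _ _ Li Ll.
Qed.

Lemma presents_uniq (T : zmodType) (I : finType) (L : set T) (x : I -> T) (P : set T) :
  presents L x P -> forall p i j, L (p - x i) -> L (p - x j) -> i = j.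
Proof.
move=> pr p i j Li Lj; apply: (presents_inj pr).
by have := presentsB pr Lj Li; rewrite opprB addrC addrA subrK.
Qed.

Lemma esum_presents (R : realType) (T : zmodType) (I : finType) (L : set T)
    (x : I -> T) (P : set T) (g : T -> \bar R) :
  presents L x P -> (forall p, (0 <= g p)%E) ->
  (\esum_(p in P) g p = \sum_i \esum_(l in L) g (l + x i)%R)%E.
Proof.
move=> pr g0; rewrite esum_mkcond.
transitivity (\esum_(p in [set: T])
    \sum_i (if p \in [set p | L (p - x i)%R] then g p else 0))%E.
  apply: eq_esum => p _; case: ifPn => [|nP].
    rewrite inE => /(presentsP pr)[i Li].
    rewrite (bigD1 i)//= ifT ?inE// big1 ?adde0// => j ji.
    rewrite ifF//; apply/negbTE; rewrite notin_setE /= => Lj.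
    by case/eqP: ji; exact: presents_uniq pr _ _ _ Lj Li.
  rewrite big1// => i _; rewrite ifF//; apply/negbTE; rewrite notin_setE /= => Li.
  by move/negP: nP; apply; rewrite inE; apply/(presentsP pr); exists i.
rewrite esum_sum; last by move=> p i _ _; case: ifP.
apply: eq_bigr => i _; rewrite -esum_mkcond.
apply: (@reindex_esum _ _ _ L _ (fun l => l + x i)); split.
- by move=> l Ll /=; rewrite addrK.
- by move=> a b _ _ /addIr.
- by move=> p /= Lp; exists (p - x i) => //; rewrite subrK.
Qed.

Definition meet_rel (T : zmodType) (L M : set T) (a b : T) : bool :=
  `[< exists l m, [/\ L l, M m & a - b = l + m] >].

(** Translation by [x i' - x i] carries the orbit of [x i] under [L + M] to that of [x i']. Both
    orbits lie in [P], which is invariant under [L] and [M], and the translation is injective on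
    classes modulo [M]. *)
Lemma card_meet_le (T : zmodType) (I J : finType) (L M : set T) (x : I -> T)
    (y : J -> T) (P : set T) (i i' : I) :
  presents L x P -> presents M y P ->
  (#|[pred j | meet_rel L M (x i) (y j)]| <= #|[pred j | meet_rel L M (x i') (y j)]|)%N.
Proof.
move=> prL prM.
have ex j : meet_rel L M (x i) (y j) -> exists j', M (y j + (x i' - x i) - y j').
  move=> /asboolP[l [m [Ll Mm E]]]; apply/(presentsP prM).
  have -> : y j + (x i' - x i) = x i' + - l + - m.
    by rewrite -addrA -opprD -E opprB addrCA.
  apply: (presents_shift prM); first exact: presentsN prM _ Mm.
  by apply: (presents_shift prL); [exact: presentsN prL _ Ll|exact: presents_mem prL _].
pose h j := if pselect (exists j', M (y j + (x i' - x i) - y j')) is left e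
  then projT1 (cid e) else j.
have hP j : meet_rel L M (x i) (y j) -> M (y j + (x i' - x i) - y (h j)).
  by move=> /ex e; rewrite /h; case: pselect => // e'; exact: projT2 (cid e').
rewrite -(card_in_image (f := h)); last first.
  move=> j1 j2 r1 r2 h12.
  have H1 := hP j1 r1; have H2 := hP j2 r2; apply: (presents_inj prM).
  have := presentsB prM H1 H2; rewrite h12.
  by rewrite opprB addrA subrK opprD addrACA subrr addr0.
apply: subset_leq_card; apply/fintype.subsetP => _ /fintype.imageP[j + ->].
move=> r; have Mh := hP j r; have {r} : meet_rel L M (x i) (y j) := r; move=> /asboolP[l [m [Ll Mm E]]].
apply/asboolP; exists l, (m + (y j + (x i' - x i) - y (h j))); split=> //.
  exact: presentsD prM _ _ Mm Mh.
rewrite [RHS]addrA -E [RHS]addrA; congr (_ - _).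
by rewrite addrA subrK addrC subrK.
Qed.

Lemma meet_relC (T : zmodType) (I J : finType) (L M : set T) (x : I -> T)
    (y : J -> T) (P : set T) (a b : T) :
  presents L x P -> presents M y P -> meet_rel L M a b = meet_rel M L b a.
Proof.
move=> prL prM; apply/asboolP/asboolP => -[l [m [Ll Mm E]]].
  exists (- m), (- l); split; [exact: presentsN prM _ Mm|exact: presentsN prL _ Ll|].
  by rewrite -opprB E opprD addrC.
exists (- m), (- l); split; [exact: presentsN prL _ Mm|exact: presentsN prM _ Ll|].
by rewrite -opprB E opprD addrC.
Qed.

(* The orbits of [L + M] on [P] all have the same number of classes modulo [L],
   hence averaging over [P / L] and over [P / M] agree. *)
Lemma presents_average (R : realType) (T : zmodType) (I J : finType) (L M : set T)
    (x : I -> T) (y : J -> T) (P : set T) (v : T -> R) :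
  presents L x P -> presents M y P -> (0 < #|I|)%N ->
  (forall p l, L l -> v (p + l) = v p) -> (forall p m, M m -> v (p + m) = v p) ->
  #|J|%:R * \sum_i v (x i) = #|I|%:R * \sum_j v (y j).
Proof.
move=> prL prM I0 vL vM; have [i0 _] := card_gt0P I0.
set r := fun i j => meet_rel L M (x i) (y j).
have [j0 r0] : exists j, r i0 j.
  have /(presentsP prM)[j Mj] := presents_mem prL i0.
  exists j; apply/asboolP; exists 0, (x i0 - y j); split=> //; last by rewrite add0r.
  exact: presents0 prL.
pose b := #|[pred j | r i0 j]|; pose a := #|[pred i | r i j0]|.
have cb i : #|[pred j | r i j]| = b.
  by apply/eqP; rewrite eqn_leq; apply/andP; split; exact: card_meet_le prL prM.
have ca j : #|[pred i | r i j]| = a.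
  have sw j' : #|[pred i | r i j']| = #|[pred i | meet_rel M L (y j') (x i)]|.
    by apply: eq_card => i; exact: meet_relC prL prM.
  rewrite /a !sw; apply/eqP; rewrite eqn_leq.
  by apply/andP; split; exact: card_meet_le prM prL.
have vr i j : r i j -> v (x i) = v (y j).
  move=> /asboolP[l [m [Ll Mm E]]].
  have -> : x i = y j + l + m by rewrite -addrA -E addrC subrK.
  by rewrite vM// vL.
(* Double counting of the pairs in a common orbit, where each [i] has [b] partners and each [j] has
   [a]; it is applied to [v] and to the constant [1]. *)
have dbl (u : I -> R) (w : J -> R) : (forall i j, r i j -> u i = w j) ->
    b%:R * \sum_i u i = a%:R * \sum_j w j.
  move=> uw; rewrite !mulr_sumr.
  transitivity (\sum_i \sum_(j | r i j) u i).
    by apply: eq_bigr => i _; rewrite sumr_const cb mulr_natl.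
  rewrite (exchange_big_dep xpredT)//=; apply: eq_bigr => j _.
  rewrite mulr_natl -(ca j) -sumr_const; apply: eq_bigr => i; exact: uw.
have E1 := dbl (v \o x) (v \o y) vr.
have E2 : b%:R * #|I|%:R = a%:R * #|J|%:R :> R.
  by have := dbl (fun=> 1) (fun=> 1) (fun _ _ _ => erefl); rewrite !sumr_const.
have b0 : b%:R != 0 :> R.
  by rewrite pnatr_eq0 -lt0n; apply/card_gt0P; exists j0.
apply: (mulfI b0); rewrite mulrCA E1 !mulrA [X in X * _]mulrC -E2; ring.
Qed.

Lemma esumZl (R : realType) (T : choiceType) (S : set T) (a : T -> \bar R) (c : R) :
  0 <= c -> (forall i, (0 <= a i)%E) ->
  (\esum_(i in S) (c%:E * a i) = c%:E * \esum_(i in S) a i)%E.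
Proof.
move=> c0 a0; rewrite /esum -ereal_supZl//; last first.
  by apply/set0P; exists (\sum_(x \in set0) a x)%E, set0 => //; exact: fsets_set0.
congr ereal_sup; apply/seteqP; split => _ /= [A SA <-].
  by exists (\sum_(x \in A) a x)%E; [exists A|rewrite ge0_mule_fsumr].
by case: SA => B SB <-; exists B => //; rewrite ge0_mule_fsumr.
Qed.

Definition boxset (R : realType) (d : nat) (A : 'I_d -> set R) : set 'rV[R]_d :=
  [set v | forall l, A l (v ord0 l)].

Lemma esum_box_cons (R : realType) (d : nat) (A : 'I_(1 + d) -> set R)
    (g : 'rV[R]_(1 + d) -> \bar R) : (forall v, (0 <= g v)%E) ->
  (\esum_(v in boxset A) g v =
   \esum_(t in A (lshift d ord0)) \esum_(w in boxset (fun l => A (rshift 1 l)))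
     g (row_mx t%:M w))%E.
Proof.
move=> g0; rewrite esum_esum//.
apply: (@reindex_esum _ _ _ _ _ (fun k => row_mx k.1%:M k.2)); split.
- move=> [t w] [/= At Aw] l; case: (split_ordP l) => j ->.
    by rewrite row_mxEl !ord1 mxE eqxx mulr1n.
  by rewrite row_mxEr; exact: Aw.
- move=> [t w] [t' w'] _ _ /= /eq_row_mx[/matrixP/(_ ord0 ord0) + ->].
  by rewrite !mxE eqxx !mulr1n => ->.
- move=> v Av /=; exists (v ord0 (lshift d ord0), rsubmx v) => /=.
    by split => [|l] /=; rewrite ?mxE; exact: Av.
  rewrite -[RHS]hsubmxK; congr row_mx.
  by apply/matrixP => i j; rewrite !ord1 !mxE eqxx mulr1n.
Qed.

Lemma esum_box_prod (R : realType) (d : nat) (A : 'I_d -> set R)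
    (f : 'I_d -> R -> R) (S : 'I_d -> R) :
  (forall l t, 0 <= f l t) ->
  (forall l, (\esum_(t in A l) (f l t)%:E = (S l)%:E)%E) ->
  (\esum_(v in boxset A) (\prod_l f l (v ord0 l))%:E = (\prod_l S l)%:E)%E.
Proof.
elim: d => [|d IHd] in A f S *; move=> f0 fS.
  have -> : boxset A = [set 0].
    by apply/seteqP; split => v _ /=; [apply/matrixP => ? []|case].
  by rewrite esum_set1 ?big_ord0.
have S0 l : 0 <= S l.
  by rewrite -lee_fin -fS; apply: esum_ge0 => t _; rewrite lee_fin.
rewrite (@esum_box_cons _ d A); last by move=> v; rewrite lee_fin prodr_ge0.
have e0 : ord0 = @lshift 1 d ord0 :> 'I_d.+1 by apply: val_inj.
rewrite big_ord_recl e0.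
transitivity (\esum_(t in A (@lshift 1 d ord0))
  ((\prod_(i < d) S (lift ord0 i))%:E * (f (@lshift 1 d ord0) t)%:E))%E.
  apply: eq_esum => t _.
  have -> : \prod_(i < d) S (lift ord0 i) = \prod_(i < d) S (rshift 1 i).
    by apply: eq_bigr => i _; congr S; apply: val_inj.
  rewrite -(IHd (fun l => A (rshift 1 l)) (fun l => f (rshift 1 l)))//.
  rewrite muleC -esumZl//; last by move=> w; rewrite lee_fin prodr_ge0.
  apply: eq_esum => w _; rewrite -EFinM; congr (_%:E).
  rewrite big_ord_recl; congr (_ * _).
    rewrite e0; congr (f _ _); apply: (etrans (@row_mxEl _ 1 1 d t%:M w ord0 ord0)).
    by rewrite mxE eqxx mulr1n.
  apply: eq_bigr => i _; have -> : lift ord0 i = rshift 1 i by apply: val_inj.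
  by congr (f _ _); exact: (@row_mxEr _ 1 1 d t%:M w ord0 i).
rewrite esumZl ?fS ?prodr_ge0// -?EFinM; last by move=> t; rewrite lee_fin.
by rewrite mulrC.
Qed.

Lemma prod_sum_fprod (R : realType) (I : finType) (T_ : I -> finType)
    (F : forall i, T_ i -> R) :
  \sum_(k : fprod T_) \prod_i F i (k i) = \prod_i \sum_(j : T_ i) F i j.
Proof.
pose G i := [ffun j => F i j].
transitivity (\sum_(k : fprod T_) \prod_(i in I) G i (k i)).
  by apply: eq_bigr => k _; apply: eq_bigr => i _; rewrite ffunE.
rewrite big_fprod; under [RHS]eq_bigr do rewrite big_tag.
rewrite bigA_distr_big_dep; apply: eq_bigr => g _; apply: eq_bigr => i _.
by congr (untag 0 _ _); apply/funext => j; rewrite ffunE.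
Qed.

Lemma presents_box (R : realType) (d : nat) (J : 'I_d -> finType) (L P : 'I_d -> set R)
    (y : forall l, J l -> R) : (forall l, presents (L l) (y l) (P l)) ->
  presents (boxset L) (fun k : fprod J => \row_l y l (k l)) (boxset P).
Proof.
move=> pr; split.
- by move=> l; rewrite mxE; exact: presents0 (pr l).
- by move=> a b La Lb l; rewrite !mxE; exact: (presentsB (pr l)).
- move=> p; split=> [Pp|[k Lk] l]; last first.
    by apply/(presentsP (pr l)); exists (k l); have := Lk l; rewrite !mxE.
  have ex l : exists i, L l (p ord0 l - y l i) by apply/(presentsP (pr l)).
  exists [fprod l => projT1 (cid (ex l))] => l.
  by rewrite !mxE fprodE; exact: projT2 (cid (ex l)).
- move=> k k' H; apply/fprodP => l; apply: (presents_inj (pr l)).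
  by have := H l; rewrite !mxE.
Qed.

Lemma config_presents (R : realType) (d : nat) (G : periodic_config R d) :
  presents (lattice (pc_basis G)) (@pc_shift R d G) (points G).
Proof.
split.
- by exists 0; rewrite map_mx0 mul0mx.
- by move=> _ _ [a ->] [b ->]; exists (a - b); rewrite map_mxB mulmxBl.
- move=> p; split => [[j _ [l Ll <-]]|[i Li]]; first by exists j; rewrite addrK.
  by exists i => //; exists (p - pc_shift i) => //; rewrite subrK.
- move=> i j Lij; apply/eqP/negP => /negP ij; exact: (pc_shift_distinct ij).
Qed.

Definition potential (R : realType) (d : nat) (alpha : R) (P : set 'rV[R]_d)
    (x : 'rV[R]_d) : \bar R :=
  (\esum_(p in P) (gaussian alpha (enorm (x - p)))%:E)%E.

Lemma gaussian_ge0 (R : realType) (alpha r : R) : 0 <= gaussian alpha r.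
Proof. exact: expR_ge0. Qed.

Lemma potential_shift (R : realType) (d : nat) (alpha : R) (I : finType)
    (L : set 'rV[R]_d) (x : I -> 'rV[R]_d) (P : set 'rV[R]_d) :
  presents L x P -> forall p l, L l -> potential alpha P (p + l) = potential alpha P p.
Proof.
move=> pr p l Ll; rewrite /potential.
rewrite (@reindex_esum _ _ _ P P (fun q => q + l)).
  by apply: eq_esum => q _; rewrite opprD addrACA subrr addr0.
split => [q Pq|a b _ _ /addIr//|q Pq]; first exact: presents_shift pr _ _ Ll Pq.
exists (q - l); last by rewrite subrK.
by apply: (presents_shift pr) => //; exact: presentsN pr _ Ll.
Qed.

Lemma enorm0 (R : realType) (d : nat) : enorm (0 : 'rV[R]_d) = 0.
Proof.
by rewrite /enorm big1 ?sqrtr0// => i _; rewrite mxE expr0n.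
Qed.

(* Adding the self-interaction [1] turns the energy into the average over one
   period of the potential of the whole point set. *)
Lemma energy_potential (R : realType) (d : nat) (alpha : R) (G : periodic_config R d) :
  (energy alpha G + 1 =
   ((pc_num G)%:R^-1)%:E * \sum_(j < pc_num G) potential alpha (points G) (pc_shift j))%E.
Proof.
have pr := config_presents G; have N0 := pc_num_gt0 G.
have NR : (pc_num G)%:R != 0 :> R by rewrite pnatr_eq0 -lt0n.
have g0 x : (0 <= (gaussian alpha (enorm (x : 'rV[R]_d)))%:E)%E.
  by rewrite lee_fin gaussian_ge0.
have pj (j : 'I_(pc_num G)) : potential alpha (points G) (pc_shift j) =
   (\sum_(k < pc_num G) \esum_(l in lattice (pc_basis G))
     (gaussian alpha (enorm (l + pc_shift j - pc_shift k)))%:E)%E.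
  rewrite /potential (esum_presents pr); last by move=> p; exact: g0.
  apply: eq_bigr => k _.
  rewrite (@reindex_esum _ _ _ (lattice (pc_basis G)) _ -%R); last first.
    split => [l /(presentsN pr)//|a b _ _ /oppr_inj//|l Ll].
    by exists (- l); [exact: presentsN pr _ Ll|rewrite opprK].
  by apply: eq_esum => l _; rewrite opprD opprK addrA [pc_shift j + l]addrC.
have {}pj (j : 'I_(pc_num G)) : (potential alpha (points G) (pc_shift j) =
   \sum_(k < pc_num G) \esum_(l in [set l | lattice (pc_basis G) l /\
                           (l + pc_shift j - pc_shift k != 0)%R])
        (gaussian alpha (enorm (l + pc_shift j - pc_shift k)%R))%:E + 1)%E.
  rewrite pj (bigD1 j)//= [in RHS](bigD1 j)//= addeAC; congr (_ + _)%E.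
    rewrite (esumID [set 0])//.
    rewrite addeC; congr (_ + _)%E.
      congr (esum _ _); apply/seteqP; split => l /= [Ll l0]; split=> //.
        by rewrite addrK; apply/eqP.
      by move=> E; move: l0; rewrite E addrK eqxx.
    have -> : lattice (pc_basis G) `&` [set 0] = [set 0].
      apply/seteqP; split => l /=; first by case.
      by move=> ->; split=> //; exact: presents0 pr.
    by rewrite esum_set1 ?g0// addrK enorm0 /gaussian expr0n mulr0 expR0.
  (* For [k != j] the cosets are disjoint and no difference vanishes, so the self-interaction is
     missing from the term [k = j] alone. *)
  apply: eq_bigr => k kj; congr (esum _ _); apply/seteqP; split => l /=; last by case.
  move=> Ll; split=> //; apply/eqP => E.
  case/eqP: kj; apply: (presents_inj pr).
  suff -> : pc_shift k - pc_shift j = l by [].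
  by move/eqP: E; rewrite -addrA addr_eq0 opprB => /eqP.
rewrite /energy; pose E (j : 'I_(pc_num G)) :=
  (\sum_(k < pc_num G) \esum_(l in [set l | lattice (pc_basis G) l /\
                           (l + pc_shift j - pc_shift k != 0)%R])
        (gaussian alpha (enorm (l + pc_shift j - pc_shift k)%R))%:E)%E.
have E0 j : (0 <= E j)%E.
  by apply: sume_ge0 => k _; apply: esum_ge0 => l _; exact: g0.
under [in RHS]eq_bigr => j _ do rewrite pj -/(E j).
rewrite big_split /= ge0_muleDr ?sume_ge0//; congr (_ + _)%E.
by rewrite sumEFin sumr_const card_ord -EFinM mulVf.
Qed.

(** * Configurations on the line *)

Definition zline (R : realType) (L : R) : set R := [set t | exists z : int, t = z%:~R * L].

Definition theta_line (R : realType) (alpha : R) (P : set R) (x : R) : \bar R :=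
  (\esum_(p in P) (expR (- alpha * (x - p) ^+ 2))%:E)%E.

Lemma gauss_term_le (R : realType) (t w : R) (k : nat) (m : int) :
  0 < t -> `|w| <= pi -> (`|m| = k.+1)%N ->
  gauss_term t w m <= expR (- (t / 2)) ^+ k.
Proof.
move=> t0 wpi mk; rewrite /gauss_term.
have cv := @cvg_cos_pow R t ((w + 2 * pi * m%:~R) / 2) t0.
apply: (cvgr_to_le cv).
near=> p; apply: poisson_term_le => //.
  by near: p; exists k.+1.
by near: p; exact: near_poisson_rate.
Unshelve. all: by end_near. Qed.

Lemma gauss_term_ge0 (R : realType) (t w : R) (m : int) : 0 <= gauss_term t w m.
Proof. exact: expR_ge0. Qed.

Lemma is_cvg_gauss_sum (R : realType) (t w : R) : 0 < t -> `|w| <= pi ->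
  cvgn (series (fun k => gauss_term t w k.+1%:Z + gauss_term t w (- k.+1%:Z))).
Proof.
move=> t0 wpi.
apply: (@series_le_cvg _ _ (fun k => 2 * expR (- (t / 2)) ^+ k)).
- by move=> n; rewrite addr_ge0 ?gauss_term_ge0.
- by move=> n; rewrite mulr_ge0// exprn_ge0// expR_ge0.
- by move=> n; rewrite -[2]/(1 + 1) mulrDl mul1r lerD// gauss_term_le.
- by apply: is_cvg_series_expR; rewrite divr_gt0.
Qed.

(** The parameter is such that, for [w = 2 pi u / L], the exponent in [gauss_term] is
    [- alpha (u + m L)^2]. *)
Lemma theta_line_zline (R : realType) (alpha L u : R) : 0 < alpha -> 0 < L ->
  `|2 * pi * u / L| <= pi ->
  theta_line alpha (zline L) u =
  (gauss_sum (alpha * L ^+ 2 / pi ^+ 2) (2 * pi * u / L))%:E.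
Proof.
move=> a0 L0 upi; have t0 : 0 < alpha * L ^+ 2 / pi ^+ 2.
  by rewrite divr_gt0 ?mulr_gt0 ?exprn_gt0 ?pi_gt0.
rewrite /theta_line (@reindex_esum _ _ _ [set: int] _ (fun z => - z%:~R * L)); last first.
  split => [z _|a b _ _|t [z ->]]; first by exists (- z); rewrite rmorphN.
    by move=> /(mulIf (lt0r_neq0 L0))/oppr_inj/intr_inj.
  by exists (- z) => //; rewrite rmorphN opprK.
rewrite -esum_int; [|by move=> z; exact: gauss_term_ge0|exact: is_cvg_gauss_sum].
apply: eq_esum => z _; rewrite /gauss_term; congr (expR _)%:E.
have := lt0r_neq0 (pi_gt0 R); have := lt0r_neq0 L0.
by move: (pi : R) => p L1 p0; field; rewrite p0 L1.
Qed.

Lemma cosDz2pi (R : realType) (a : R) (z : int) : cos (a + 2 * pi * z%:~R) = cos a.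
Proof.
case: z => n; first exact: cosDn2pi.
by have := cosDn2pi (a - 2 * pi * n.+1%:R) n.+1; rewrite subrK NegzE rmorphN mulrN => ->.
Qed.

Lemma theta_cosDz2pi (R : realType) (q a : R) (z : int) :
  theta_cos q (a + 2 * pi * z%:~R) = theta_cos q a.
Proof.
congr (_ + _); apply: eq_limn_series => j; rewrite mulrDr; congr (_ * _).
by rewrite mulrCA -(cosDz2pi (_ * a) (j.+1%:Z * z)) rmorphM /=.
Qed.

Lemma theta_cosN (R : realType) (q a : R) : theta_cos q (- a) = theta_cos q a.
Proof. by congr (_ + _); apply: eq_limn_series => j; rewrite mulrN cosN. Qed.

Lemma theta_lineDz (R : realType) (alpha L u : R) (z : int) :
  theta_line alpha (zline L) (u + z%:~R * L) = theta_line alpha (zline L) u.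
Proof.
rewrite /theta_line (@reindex_esum _ _ _ (zline L) _ (fun t => t + z%:~R * L)).
  by apply: eq_esum => t _; rewrite opprD addrACA subrr addr0.
split => [t [k ->]|a b _ _ /addIr//|t [k ->]].
  by exists (k + z); rewrite rmorphD mulrDl.
by exists ((k - z)%:~R * L); [exists (k - z)|rewrite -mulrDl -rmorphD subrK].
Qed.

(** Both sides are periodic in [u], so a shift brings the argument into the range of Poisson
    summation. Positivity at [pi] is invisible in the alternating series; up to the factor [C] the
    value is a sum of Gaussians at the half-period. *)
Lemma theta_line_cos (R : realType) (alpha L : R) : 0 < alpha -> 0 < L ->
  exists C q : R, [/\ 0 < C, 0 < q < 1, 0 < theta_cos q pi &
    forall u, theta_line alpha (zline L) u = (C * theta_cos q (2 * pi * u / L))%:E].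
Proof.
move=> a0 L0; have [k k0 P] := poisson_summation R.
set t := alpha * L ^+ 2 / pi ^+ 2.
have t0 : 0 < t by rewrite divr_gt0 ?mulr_gt0 ?exprn_gt0 ?pi_gt0.
pose C := Num.sqrt (k / t); pose q := expR (- t^-1).
have C0 : 0 < C by rewrite sqrtr_gt0 divr_gt0.
have E u : theta_line alpha (zline L) u = (C * theta_cos q (2 * pi * u / L))%:E.
  pose z := Num.floor (u / L + 1 / 2).
  have -> : u = (u - z%:~R * L) + z%:~R * L by rewrite subrK.
  rewrite theta_lineDz; set v := u - _.
  have -> : 2 * pi * (v + z%:~R * L) / L = 2 * pi * v / L + 2 * pi * z%:~R.
    by field; rewrite gt_eqF.
  rewrite theta_cosDz2pi.
  have vL : `|v / L| <= 1 / 2.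
    have /andP[z1 z2] := floor_itv (u / L + 1 / 2).
    have -> : v / L = u / L - z%:~R by rewrite mulrBl mulfK// gt_eqF.
    move: z1 z2; rewrite -/z rmorphD /= ler_norml.
    by move: (u / L) (z%:~R : R) => a b; lra.
  have vpi : `|2 * pi * v / L| <= pi.
    rewrite -mulrA normrM ger0_norm ?mulr_ge0 ?pi_ge0//.
    have := ler_wpM2l (_ : 0 <= 2 * pi :> R) vL.
    rewrite mulr_ge0 ?pi_ge0// => /(_ isT)/le_trans; apply.
    by rewrite mul1r mulrAC divff// mul1r.
  by rewrite theta_line_zline// P.
exists C, q; split=> //; first by rewrite expR_gt0 expR_lt1 oppr_lt0 invr_gt0.
have : (0 < theta_line alpha (zline L) (L / 2))%E.
  rewrite /theta_line (esumID [set 0])//.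
  have -> : zline L `&` [set 0] = [set 0].
    by apply/seteqP; split => [x []//|x ->]; split=> //; exists 0; rewrite mul0r.
  rewrite esum_set1 ?lee_fin ?expR_ge0//.
  have p : (0 < (expR (- alpha * (L / 2 - 0) ^+ 2))%:E)%E by rewrite lte_fin expR_gt0.
  by apply: (lt_le_trans p); rewrite leeDl// esum_ge0.
rewrite E lte_fin pmulr_rgt0//.
by have -> : 2 * pi * (L / 2) / L = pi by field; rewrite gt_eqF.
Qed.

Lemma theta_line_zline0 (R : realType) (alpha L : R) : 0 < alpha -> 0 < L ->
  theta_line alpha (zline L) 0 = (lattice_theta (alpha * L ^+ 2))%:E.
Proof.
move=> a0 L0; rewrite theta_line_zline// ?mulr0 ?mul0r ?normr0 ?pi_ge0//.
rewrite gauss_sum0; congr (lattice_theta _)%:E.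
by have := lt0r_neq0 (pi_gt0 R); move: (pi : R) => p p0; field.
Qed.

Lemma cos_eq1_2pi (R : realType) (w : R) : cos w = 1 -> exists z : int, w = 2 * pi * z%:~R.
Proof.
move=> cw; pose z := Num.floor (w / (2 * pi) + 1 / 2); exists z.
have pi0 : 0 < 2 * pi :> R by rewrite mulr_gt0 ?pi_gt0.
have /andP[z1 z2] := floor_itv (w / (2 * pi) + 1 / 2); rewrite -/z in z1 z2.
pose v := w - 2 * pi * z%:~R.
have vw : w = v + 2 * pi * z%:~R by rewrite subrK.
have cv : cos v = 1 by rewrite -cw vw cosDz2pi.
have vb : `|v / (2 * pi)| <= 1 / 2.
  have -> : v / (2 * pi) = w / (2 * pi) - z%:~R.
    by rewrite mulrBl [2 * pi * _]mulrC mulfK// gt_eqF.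
  move: z1 z2; rewrite rmorphD /= ler_norml.
  by move: (w / (2 * pi)) (z%:~R : R) => a b; lra.
have v0 : `|v| = 0.
  apply: (@cos_inj R); rewrite ?in_itv /= ?lexx ?pi_ge0 ?normr_ge0//=; last first.
    by rewrite cos_norm cv cos0.
  move: vb; rewrite normrM [ `|_^-1|]ger0_norm ?invr_ge0 ?(ltW pi0)//.
  rewrite ler_pdivrMr// => /le_trans; apply.
  by rewrite mul1r mulrA mulVf// mul1r.
by rewrite vw (normr0_eq0 v0) add0r.
Qed.

Lemma zline_sub (R : realType) (L a b : R) : zline L a -> zline L b -> zline L (a - b).
Proof. by move=> [z ->] [t ->]; exists (z - t); rewrite rmorphB mulrBl. Qed.

Lemma zline0 (R : realType) (L : R) : zline L 0.
Proof. by exists 0; rewrite mul0r. Qed.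

Definition progression (R : realType) (c x : R) : set R :=
  [set c * z%:~R + x | z in [set: int]].

Lemma presents_progression (R : realType) (c x : R) (P : set R) :
  P = progression c x ->
  presents (zline c) (fun _ : 'I_1 => x) P.
Proof.
move=> ->; split; [exact: zline0|by move=> a b; exact: zline_sub| |].
- move=> p; split => [[z _ <-]|[_ [z E]]]; first by exists ord0, z; rewrite addrK mulrC.
  by exists z => //; rewrite mulrC -E subrK.
- by move=> i j _; rewrite !ord1.
Qed.

Lemma presents_multiples (R : realType) (c : R) (N : nat) : 0 < c -> (0 < N)%N ->
  presents (zline (c * N%:R)) (fun k : 'I_N => k%:R * c) (zline c).
Proof.
move=> c0 N0; have cn : c != 0 by rewrite gt_eqF.
split; [exact: zline0|by move=> a b; exact: zline_sub| |].
- move=> p; split => [[z ->]|[k [z E]]]; last first.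
    exists (z * N%:Z + k%:Z); rewrite -[LHS](subrK (k%:R * c)) E.
    by rewrite rmorphD rmorphM /= -!pmulrn; ring.
  have zN : (0 <= (z %% N%:Z)%Z < N%:Z)%R.
    by rewrite modz_ge0 ?ltz_pmod//; lia.
  have kN : (`|(z %% N%:Z)%Z| < N)%N by lia.
  exists (Ordinal kN), (z %/ N%:Z)%Z.
  rewrite {1}(divz_eq z N%:Z) /=.
  have -> : `|(z %% N%:Z)%Z|%:R = (z %% N%:Z)%Z%:~R :> R.
    by rewrite pmulrn gez0_abs//; case/andP: zN.
  by rewrite rmorphD rmorphM /= -pmulrn; ring.
- move=> i j [z E]; have {E} : i%:Z - j%:Z = z * N%:Z.
    apply/(@intr_inj R); rewrite rmorphB rmorphM /= -!pmulrn.
    by apply: (mulIf cn); rewrite mulrBl E; ring.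
  have := ltn_ord i; have := ltn_ord j => jN iN E; apply: val_inj => /=.
  have [h|h|h] := ltgtP z 0; [|have h1 : 1 <= z by []|by move: E; rewrite h mul0r; lia].
    have : (z + 1) * N%:Z <= 0 by rewrite mulr_le0_ge0// -ltzD1 ltrD2r.
    by rewrite mulrDl mul1r -E; lia.
  have : 0 <= (z - 1) * N%:Z by rewrite mulr_ge0// subr_ge0.
  by rewrite mulrBl mul1r -E; lia.
Qed.

Lemma absz_modz_lt (N : nat) (t : int) : (0 < N)%N -> (`|(t %% N%:Z)%Z| < N)%N.
Proof. by move=> N0; rewrite -ltz_nat abszE ger0_norm ?modz_ge0 ?ltz_pmod// -lt0n. Qed.

Lemma absz_modz_inj (N : nat) (s t : int) : (0 < N)%N ->
  `|(s %% N%:Z)%Z|%N = `|(t %% N%:Z)%Z|%N -> (s %% N%:Z)%Z = (t %% N%:Z)%Z.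
Proof.
move=> N0; have m0 u : 0 <= (u %% N%:Z)%Z by rewrite modz_ge0// -lt0n.
by move=> st; rewrite -[LHS]gez0_abs// -[RHS]gez0_abs// st.
Qed.

(** * Optimality of equispaced points on the line *)

Definition line_average (R : realType) (alpha : R) (P : set R) (N : nat)
    (y : 'I_N -> R) : R :=
  N%:R^-1 * \sum_j fine (theta_line alpha P (y j)).

Lemma theta_line_presents (R : realType) (alpha : R) (I : finType) (L P : set R)
    (y : I -> R) (x : R) : presents L y P ->
  theta_line alpha P x = (\sum_k theta_line alpha L (x - y k))%E.
Proof.
move=> pr; rewrite /theta_line (esum_presents pr); last first.
  by move=> p; rewrite lee_fin expR_ge0.
apply: eq_bigr => k _; apply: eq_esum => l _.
by rewrite opprD [- l - _]addrC addrA.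
Qed.

Lemma theta_line_shift (R : realType) (alpha : R) (I : finType) (L P : set R)
    (y : I -> R) : presents L y P ->
  forall p l, L l -> theta_line alpha P (p + l) = theta_line alpha P p.
Proof.
move=> pr p l Ll; rewrite /theta_line.
rewrite (@reindex_esum _ _ _ P P (fun q => q + l)).
  by apply: eq_esum => q _; rewrite opprD addrACA subrr addr0.
split => [q Pq|a b _ _ /addIr//|q Pq]; first exact: presents_shift pr _ _ Ll Pq.
exists (q - l); last by rewrite subrK.
by apply: (presents_shift pr) => //; exact: presentsN pr _ Ll.
Qed.

(** The family [y] may present the progression with a longer period. The average does not depend on
    the presentation, so it is computed from a single point. *)
Lemma line_average_progression (R : realType) (alpha L c x : R) (N : nat)
    (y : 'I_N -> R) (P : set R) :
  0 < alpha -> 0 < c -> (0 < N)%N -> presents (zline L) y P ->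
  P = progression c x ->
  line_average alpha P y = lattice_theta (alpha * c ^+ 2).
Proof.
move=> a0 c0 N0 pr Pc; have prc := presents_progression Pc.
have NR : N%:R != 0 :> R by rewrite pnatr_eq0 -lt0n.
have := @presents_average R R _ _ _ _ _ _ _ (fun x => fine (theta_line alpha P x)) pr prc.
rewrite !card_ord big_ord1 mul1r => /(_ N0) H.
rewrite /line_average H.
- rewrite mulrA mulVf// mul1r (theta_line_presents _ _ prc) big_ord1 subrr.
  by rewrite theta_line_zline0.
- by move=> p l Ll; rewrite (theta_line_shift _ pr).
- by move=> p l Ll; rewrite (theta_line_shift _ prc).
Qed.

(** In the angles [2 pi y_j / L] the excess over the optimum is a positive multiple of the pair gap
    of [theta_cos]. If it vanishes, so does the gap of the power [N - 1], and [cos_gap_eq0]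
    applies. *)
Lemma line_optimal (R : realType) (alpha L : R) (N : nat) (y : 'I_N -> R) (P : set R) :
  0 < alpha -> 0 < L -> (0 < N)%N -> presents (zline L) y P ->
  [/\ forall x, exists2 s, 0 < s & theta_line alpha P x = s%:E,
      lattice_theta (alpha * (L / N%:R) ^+ 2) <= line_average alpha P y &
      line_average alpha P y = lattice_theta (alpha * (L / N%:R) ^+ 2) ->
      exists x, P = progression (L / N%:R) x].
Proof.
move=> a0 L0 N0 pr; have NR : 0 < N%:R :> R by rewrite ltr0n.
have [C [q [C0 q01 qpi E]]] := theta_line_cos a0 L0.
have VE x : theta_line alpha P x =
    (\sum_k C * theta_cos q (2 * pi * x / L - 2 * pi * y k / L))%:E.
  rewrite (theta_line_presents _ _ pr) -sumEFin; apply: eq_bigr => k _.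
  by rewrite E; congr (_ * theta_cos q _)%:E; ring.
set c := L / N%:R; have c0 : 0 < c by rewrite divr_gt0.
have LE : L = c * N%:R by rewrite divfK// gt_eqF.
(* Presenting the multiples of [c] with the period [L = c N] writes the optimum as the sum over
   nodes that occurs in [pair_gap]. *)
have thc : lattice_theta (alpha * c ^+ 2) =
    \sum_(k < N) C * theta_cos q (2 * pi * k%:R / N%:R).
  apply: EFin_inj; rewrite -theta_line_zline0//.
  rewrite (theta_line_presents _ _ (presents_multiples c0 N0)) -LE -sumEFin.
  apply: eq_bigr => k _; rewrite E sub0r -theta_cosN; congr (_ * theta_cos q _)%:E.
  by rewrite LE; field; rewrite !gt_eqF.
pose x j := 2 * pi * y j / L.
have avE : line_average alpha P y =
    N%:R^-1 * \sum_j \sum_k C * theta_cos q (x j - x k).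
  by congr (_ * _); apply: eq_bigr => j _; rewrite VE.
have gapE : line_average alpha P y - lattice_theta (alpha * c ^+ 2) =
    N%:R^-1 * C * pair_gap x (theta_cos q).
  rewrite avE thc /pair_gap -mulr_sumr; under eq_bigr do rewrite -mulr_sumr.
  by rewrite -mulr_sumr; field; rewrite gt_eqF.
have gap := pair_gap_theta x q01.
have k0 : 0 < \prod_(i < N.-1) q ^+ i.*2.+1.
  by case/andP: q01 => q0 _; apply: prodr_gt0 => i _; rewrite exprn_gt0.
have g0 : 0 <= pair_gap x (fun y => (2 + 2 * cos y) ^+ N.-1).
  by rewrite subr_ge0; exact: cos_gap_ge0.
have NC : 0 < N%:R^-1 * C by rewrite mulr_gt0 ?invr_gt0.
split.
- move=> z; exists (fine (theta_line alpha P z)); last by rewrite VE.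
  rewrite -lte_fin fineK ?VE//= -VE.
  rewrite /theta_line; have := presents_mem pr (Ordinal N0); set p := y _ => Pp.
  have p0 : (0 < (expR (- alpha * (z - p) ^+ 2))%:E)%E by rewrite lte_fin expR_gt0.
  rewrite (esumID [set p])//; have -> : P `&` [set p] = [set p].
    by apply/seteqP; split => [t []//|t ->].
  by rewrite esum_set1 ?(ltW p0)//; apply: (lt_le_trans p0); rewrite leeDl// esum_ge0.
- rewrite -subr_ge0 gapE mulr_ge0 ?(ltW NC)//; apply: le_trans gap.
  by rewrite !mulr_ge0// ltW.
move=> /eqP; rewrite -subr_eq0 gapE mulf_eq0 gt_eqF//= => /eqP gap0.
have gN : pair_gap x (fun y => (2 + 2 * cos y) ^+ N.-1) = 0.
  apply/eqP; rewrite eq_le g0 andbT -(pmulr_rle0 _ (mulr_gt0 k0 qpi)).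
  by rewrite -gap0.
have {gN}cosN j k : cos (N%:R * (x j - x k)) = 1.
  by apply: cos_gap_eq0; apply/eqP; rewrite -subr_eq0; exact/eqP.
pose j0 := Ordinal N0; exists (y j0).
have zj j : exists z : int, y j - y j0 = z%:~R * c.
  have [z Ez] := cos_eq1_2pi (cosN j j0); exists z.
  have pi0 : 2 * pi != 0 :> R by rewrite mulf_neq0// gt_eqF// pi_gt0.
  apply: (mulfI pi0); have := Ez; rewrite /x /c.
  move: (pi : R) pi0 => p p0 H.
  rewrite [RHS](_ : _ = (2 * p * z%:~R) * (L / N%:R)); last by ring.
  by rewrite -H; field; rewrite !gt_eqF.
pose z j := projT1 (cid (zj j)).
have zE j : y j - y j0 = (z j)%:~R * c := projT2 (cid (zj j)).
have modN t := absz_modz_lt t N0.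
have modL (s t : int) : Ordinal (modN s) = Ordinal (modN t) ->
    zline L (s%:~R * c - t%:~R * c).
  move=> [] /(absz_modz_inj N0) st.
  exists ((s %/ N%:Z)%Z - (t %/ N%:Z)%Z).
  rewrite [in LHS](divz_eq s N%:Z) [in LHS](divz_eq t N%:Z) st LE.
  by rewrite !rmorphD !rmorphN !rmorphM /= -!pmulrn; ring.
(* The [N] points lie in distinct classes modulo [L] of a progression that has only [N] classes, so
   every class is hit. *)
have inj : injective (fun j => Ordinal (modN (z j))).
  move=> j k /modL; rewrite -!zE opprB addrA subrK; exact: presents_inj pr j k.
apply/seteqP; split => [p /(presentsP pr)[j [t Et]]|_ [t _ <-]].
  exists (t * N%:Z + z j) => //.
  rewrite -[RHS](subrK (y j)) Et -[y j in RHS](subrK (y j0)) zE addrA; congr (_ + _).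
  by rewrite rmorphD rmorphM /= -pmulrn LE; ring.
apply/(presentsP pr); have [g _ gK] := injF_bij inj.
exists (g (Ordinal (modN t))).
have := modL t (z (g (Ordinal (modN t)))) (esym (gK _)).
rewrite -zE mulrC opprB.
by rewrite addrA.
Qed.

(** * Volumes of balls and densities *)

(** Parametrised by the squared radius, because fixing a coordinate [t] just subtracts [t^2] from
    it; negative values arise in this way and give empty balls. *)
Definition qball (R : realType) (d : nat) (a : R) : set 'rV[R]_d :=
  [set v | \sum_i v ord0 i ^+ 2 <= a].

Definition qvol (R : realType) (d : nat) (a : R) : \bar R := volume (qball (d := d) a).

Lemma sum_sqr_row_mx (R : realType) (d : nat) (t : R) (w : 'rV[R]_d) :
  \sum_(i < 1 + d) (row_mx t%:M w) ord0 i ^+ 2 = t ^+ 2 + \sum_i w ord0 i ^+ 2.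
Proof.
rewrite big_split_ord big_ord1 /= row_mxEl mxE eqxx mulr1n; congr (_ + _).
by apply: eq_bigr => i _; rewrite row_mxEr.
Qed.

Lemma eball_qball (R : realType) (d : nat) (r : R) : 0 <= r ->
  eball (d := d) r = qball (d := d) (r ^+ 2).
Proof.
move=> r0; apply/seteqP; split => v; rewrite /eball /qball /enorm /=.
  by rewrite -(ler_sqr (sqrtr_ge0 _))// sqr_sqrtr// sumr_ge0// => i _; rewrite sqr_ge0.
by move=> h; rewrite -[r]ger0_norm// -sqrtr_sqr ler_wsqrtr.
Qed.

Lemma qvol0 (R : realType) (a : R) : qvol 0 a = (0 <= a)%R%:R%:E.
Proof.
rewrite /qvol /= indicE; congr ((nat_of_bool _)%:R%:E).
have E : qball (d := 0) a 0 = (0 <= a) by rewrite /qball /= big_ord0.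
by apply/idP/idP; rewrite inE E.
Qed.

Lemma qvolS (R : realType) (d : nat) (a : R) :
  qvol d.+1 a = (\int[@lebesgue_measure R]_t qvol d (a - t ^+ 2))%E.
Proof.
rewrite {1}/qvol /=; apply: eq_integral => t _; congr volume.
by apply/seteqP; split => v; rewrite /qball /= sum_sqr_row_mx -lerBrDl.
Qed.

Lemma qvol_lt0 (R : realType) (d : nat) (a : R) : a < 0 -> qvol d a = 0%E.
Proof.
elim: d => [|d IHd] in a *; move=> a0; first by rewrite qvol0 leNgt a0.
rewrite qvolS integral0_eq// => t _; rewrite IHd//.
by rewrite (le_lt_trans _ a0)// gerBl sqr_ge0.
Qed.

Lemma measurable_nondecreasing_fin (R : realType) (f : R -> \bar R) :
  (forall a, f a \is a fin_num) -> (forall a b, a <= b -> (f a <= f b)%E) ->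
  measurable_fun setT f.
Proof.
move=> ff fm; have -> : f = EFin \o (fine \o f).
  by apply/funext => a /=; rewrite fineK.
apply/measurable_EFinP; apply: nondecreasing_measurable => // a b ab.
by apply: fine_le => //; exact: fm.
Qed.

Lemma measurable_comp_sqr (R : realType) (f : R -> \bar R) (a : R) :
  measurable_fun setT f -> measurable_fun setT (fun t : R => f (a - t ^+ 2)).
Proof.
move=> mf; apply: (measurableT_comp mf).
by apply: measurable_funB => //; exact: measurable_funX.
Qed.

(** A joint induction: monotonicity and finiteness make the slices measurable, as the integral in
    the next dimension requires. *)
Lemma qvol_fin_homo (R : realType) (d : nat) :
  [/\ forall a : R, (0 <= qvol d a)%E, forall a : R, qvol d a \is a fin_num &
      forall a b : R, a <= b -> (qvol d a <= qvol d b)%E].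
Proof.
elim: d => [|d [q0 qf qm]].
  split=> [a|a|a b ab]; rewrite !qvol0 ?lee_fin//.
  by case: (leP 0 a) => // a0; rewrite (le_trans a0 ab).
have mq (a : R) : measurable_fun setT (fun t : R => qvol d (a - t ^+ 2)).
  by apply: measurable_comp_sqr; exact: measurable_nondecreasing_fin.
have Q0 (a : R) : (0 <= qvol d.+1 a)%E by rewrite qvolS integral_ge0.
split=> // [a|a b ab]; last first.
  rewrite !qvolS; apply: ge0_le_integral => //; [exact: mq|exact: mq|].
  by move=> t _; apply: qm; rewrite lerD2r.
rewrite ge0_fin_numE// qvolS.
(* Outside this interval [t^2 > a] and the slice is empty. *)
set b := 1 + `|a|; set I := `[- b, b]%classic.
apply: (@le_lt_trans _ _ (\int[@lebesgue_measure R]_(t in I) qvol d a)%E).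
  rewrite [leRHS]integral_mkcond; apply: ge0_le_integral => //.
    exact: mq.
    by apply: (measurable_restrictT _ _).1 => //; exact: measurable_itv.
  move=> t _; rewrite patchE; case: ifPn => [_|].
    by apply: qm; rewrite gerBl sqr_ge0.
  rewrite notin_setE /I /= in_itv /= -ler_norml => /negP; rewrite -ltNge => bt.
  rewrite qvol_lt0// subr_lt0 -real_normK ?num_real//.
  have aa := ler_norm a; have a0 := normr_ge0 a; rewrite /b in bt.
  by move: (`|t|) bt => u bt; nra.
rewrite integral_cst; last exact: measurable_itv.
rewrite [X in (_ * X)%E](lebesgue_measure_itv `[- b, b]) /=.
case: ifP => _; last by rewrite mule0 ltry.
rewrite -EFinD -ge0_fin_numE; first by rewrite fin_numM//; exact: qf.
by apply: mule_ge0; [exact: q0|rewrite lee_fin opprK !addr_ge0].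
Qed.

(** * Cells of a progression and points in balls *)

Definition int_of_code (n : nat) : int := if odd n then Negz n./2 else Posz n./2.

Lemma int_of_code_bij : set_bij [set: nat] [set: int] int_of_code.
Proof.
split=> // [m n _ _|[n|n] _]; rewrite /int_of_code.
- case: ifPn => om; case: ifPn => on //= [] e.
    by rewrite -[m]odd_double_half -[n]odd_double_half om on e.
  by rewrite -[m]odd_double_half -[n]odd_double_half (negPf om) (negPf on) e.
- by exists n.*2 => //; rewrite odd_double doubleK.
- by exists n.*2.+1 => //; rewrite /= odd_double /= uphalf_double.
Qed.

Lemma progression_bij (R : realType) (c x : R) : 0 < c ->
  set_bij [set: nat] (progression c x) (fun n => c * (int_of_code n)%:~R + x).
Proof.
move=> c0; have [_ inj sur] := int_of_code_bij.
split=> [n _|m n _ _ /addIr/(mulfI (lt0r_neq0 c0))/intr_inj/inj|_ [z _ <-]].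
- by exists (int_of_code n).
- by apply; rewrite inE.
- by have [n _ <-] := sur z I; exists n.
Qed.

Lemma mem_cell (R : realType) (c x t : R) (z : int) : 0 < c ->
  (c * z%:~R + x <= t < c * z%:~R + x + c) = (z == Num.floor ((t - x) / c)).
Proof.
move=> c0; rewrite eq_sym floor_eq ler_pdivlMr// ltr_pdivrMr// lerBrDr ltrBlDr.
by rewrite rmorphD /= mulrDl mul1r addrAC [_ * c]mulrC.
Qed.

Lemma integral_cells (R : realType) (c x : R) (F : R -> \bar R) : 0 < c ->
  measurable_fun setT F -> (forall t, (0 <= F t)%E) ->
  (\int[@lebesgue_measure R]_t F t =
   \esum_(p in progression c x) \int[@lebesgue_measure R]_(t in `[p, (p + c)%R[) F t)%E.
Proof.
move=> c0 mF F0; rewrite (@reindex_esum R _ _ _ _ _ _ (progression_bij x c0)).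
rewrite -nneseries_esumT; last by move=> n; apply: integral_ge0.
pose C n := `[c * (int_of_code n)%:~R + x, c * (int_of_code n)%:~R + x + c[%classic : set R.
have [_ inj sur] := int_of_code_bij.
have CE n t : C n t = (int_of_code n == Num.floor ((t - x) / c)) :> Prop.
  by rewrite /C /= in_itv /= mem_cell.
have CT : [set: R] = \bigcup_n C n.
  apply/seteqP; split => t //= _; have [n _ e] := sur (Num.floor ((t - x) / c)) I.
  by exists n => //; rewrite CE e.
rewrite CT; apply: ge0_integral_bigcup.
- by move=> n; exact: measurable_itv.
- by rewrite -CT.
- by move=> t _; exact: F0.
- move=> m n _ _ [t []]; rewrite !CE => /eqP em /eqP en.
  by apply: inj; rewrite ?inE// em en.
Qed.

Lemma integral_cell_le (R : realType) (p c : R) (F : R -> \bar R) (K : \bar R) : 0 < c ->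
  measurable_fun setT F -> (forall t, (0 <= F t)%E) ->
  (forall t, p <= t < p + c -> (F t <= K)%E) -> 
  (\int[@lebesgue_measure R]_(t in `[p, (p + c)%R[) F t <= c%:E * K)%E.
Proof.
move=> c0 mF F0 FK.
have K0 : (0 <= K)%E by apply: le_trans (F0 p) (FK _ _); rewrite lexx ltrDl.
apply: (@le_trans _ _ (\int[@lebesgue_measure R]_(t in `[p, (p + c)%R[) K)%E).
  by apply: ge0_le_integral => //; exact: measurable_funS mF.
rewrite integral_cst; last exact: measurable_itv.
rewrite [X in (_ * X)%E](lebesgue_measure_itv `[p, (p + c)%R[) /= lte_fin ltrDl c0.
by rewrite -EFinD addrAC subrr add0r muleC.
Qed.

Lemma integral_cell_ge (R : realType) (p c : R) (F : R -> \bar R) (K : \bar R) : 0 < c ->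
  measurable_fun setT F -> (0 <= K)%E ->
  (forall t, p <= t < p + c -> (K <= F t)%E) -> 
  (c%:E * K <= \int[@lebesgue_measure R]_(t in `[p, (p + c)%R[) F t)%E.
Proof.
move=> c0 mF K0 FK.
apply: (@le_trans _ _ (\int[@lebesgue_measure R]_(t in `[p, (p + c)%R[) K)%E).
  rewrite integral_cst; last exact: measurable_itv.
  rewrite [X in (_ <= _ * X)%E](lebesgue_measure_itv `[p, (p + c)%R[) /= lte_fin ltrDl c0.
  by rewrite -EFinD addrAC subrr add0r muleC.
by apply: ge0_le_integral => //; exact: measurable_funS mF.
Qed.

(** A sum of indicators instead of a cardinal: slicing becomes an iterated sum, and finiteness can
    be derived afterwards from that of the volumes. *)
Definition lcount (R : realType) (d : nat) (B : set 'rV[R]_d) (a : R) : \bar R :=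
  (\esum_(v in B) ((\sum_i v ord0 i ^+ 2 <= a)%R%:R)%:E)%E.

Lemma lcount_le (R : realType) (d : nat) (B : set 'rV[R]_d) (a b : R) : a <= b ->
  (lcount B a <= lcount B b)%E.
Proof.
move=> ab; apply: le_esum => v _; rewrite lee_fin.
by case: (leP _ a) => // h; rewrite (le_trans h ab).
Qed.

Lemma lcount_ge0 (R : realType) (d : nat) (B : set 'rV[R]_d) (a : R) : (0 <= lcount B a)%E.
Proof. by apply: esum_ge0 => v _; rewrite lee_fin. Qed.

Lemma lcount_lt0 (R : realType) (d : nat) (B : set 'rV[R]_d) (a : R) : a < 0 ->
  lcount B a = 0%E.
Proof.
move=> a0; rewrite /lcount esum1// => v _; rewrite leNgt (lt_le_trans a0)//.
by rewrite sumr_ge0// => i _; rewrite sqr_ge0.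
Qed.

Lemma lcount_box_cons (R : realType) (d : nat) (A : 'I_(1 + d) -> set R) (a : R) :
  (lcount (boxset A) a = \esum_(t in A (lshift d ord0))
     lcount (boxset (fun l => A (rshift 1 l))) (a - t ^+ 2)%R)%E.
Proof.
rewrite /lcount esum_box_cons; last by move=> v; rewrite lee_fin.
apply: eq_esum => t _; apply: eq_esum => w _.
by rewrite sum_sqr_row_mx -lerBrDl.
Qed.

(** Moving the first coordinate from [t] to [p] and widening the remaining radius from [s] to
    [s + c] costs [L + c] in total: [s] and [|t|] are at most [r], so the cross terms are at most
    [2 r (L + c)]. *)
Lemma radius_le (R : realType) (t p s c L r : R) : 0 <= s -> 0 <= c -> 0 <= L -> 0 <= r ->
  t ^+ 2 + s ^+ 2 <= r ^+ 2 -> `|p - t| <= L ->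
  (s + c) ^+ 2 <= (r + (L + c)) ^+ 2 - p ^+ 2.
Proof.
move=> s0 c0 L0 r0 H pt.
have pu : `|p| <= `|t| + L.
  by rewrite -[p](subrK t) addrC (le_trans (ler_normD _ _))// lerD2l.
rewrite -(real_normK (num_real p)); rewrite -(real_normK (num_real t)) in H.
have u0 := normr_ge0 t; have v0 := normr_ge0 p.
move: (`|t|) (`|p|) u0 v0 H pu => {pt t p} u v u0 v0 H vu.
have ur : u <= r by rewrite -ler_sqr//; nra.
have sr : s <= r by rewrite -ler_sqr//; nra.
have v2 : v ^+ 2 <= (u + L) ^+ 2 by rewrite ler_sqr// nnegrE addr_ge0.
have h1 : u * L <= r * L by rewrite ler_wpM2r.
have h2 : s * c <= r * c by rewrite ler_wpM2r.
have h3 := mulr_ge0 L0 c0.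
lra.
Qed.

(* Each point is compared with the half-open box of side lengths [L] based at
   it, one coordinate at a time; such a box has diameter at most [\sum_l L l]. *)
Lemma qvol_lcount (R : realType) (d : nat) (L y : 'I_d -> R) (r : R) :
  (forall l, 0 < L l) -> 0 <= r ->
  let B := boxset (fun l => progression (L l) (y l)) in
  let c := \sum_l L l in
  (qvol d (r ^+ 2) <= (\prod_l L l)%:E * lcount B ((r + c) ^+ 2))%E /\
  ((\prod_l L l)%:E * lcount B (r ^+ 2) <= qvol d ((r + c) ^+ 2))%E.
Proof.
elim: d => [|d IHd] in L y r *; move=> L0 r0 B c.
  rewrite !qvol0 /B /c !big_ord0 addr0 !mul1e sqr_ge0.
  have -> : boxset (fun l => progression (L l) (y l)) = [set 0].
    by apply/seteqP; split => v _ /=; [apply/matrixP => ? []|case].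
  by rewrite /lcount esum_set1 ?lee_fin ?ler0n// !big_ord0 !sqr_ge0.
have [q0 qf qm] := qvol_fin_homo R d.
have mq (a : R) : measurable_fun setT (fun t : R => qvol d (a - t ^+ 2)).
  by apply: measurable_comp_sqr; exact: measurable_nondecreasing_fin.
have e0 : ord0 = @lshift 1 d ord0 :> 'I_d.+1 by apply: val_inj.
pose L' (l : 'I_d) := L (rshift 1 l); pose y' (l : 'I_d) := y (rshift 1 l).
pose l0 := L (@lshift 1 d ord0); pose z0 := y (@lshift 1 d ord0).
pose B' := boxset (fun l => progression (L' l) (y' l)); pose c' := \sum_l L' l.
have L'0 l : 0 < L' l by exact: L0.
have l00 : 0 < l0 by exact: L0.
have c'0 : 0 <= c' by apply: sumr_ge0 => l _; exact: ltW.
have IH s s0 := IHd L' y' s L'0 s0.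
have cE : c = l0 + c'.
  rewrite /c big_ord_recl e0; congr (_ + _).
  by apply: eq_bigr => l _; congr L; exact: val_inj.
have pE : \prod_l L l = l0 * \prod_l L' l.
  by rewrite big_ord_recl e0; congr (_ * _); apply: eq_bigr => l _; congr L; exact: val_inj.
have pL0 : 0 <= \prod_l L' l by apply: prodr_ge0 => l _; exact: ltW.
have BE a : (lcount B a = \esum_(t in progression l0 z0) lcount B' (a - t ^+ 2)%R)%E.
  exact: lcount_box_cons.
have near t p : p <= t < p + l0 -> `|p - t| <= l0.
  by move=> /andP[pt tp]; rewrite distrC ger0_norm ?subr_ge0// lerBlDl ltW.
rewrite !qvolS !(integral_cells z0 l00)// !BE pE cE.
rewrite -!esumZl ?mulr_ge0 ?(ltW l00)//; try by move=> p; exact: lcount_ge0.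
split; apply: le_esum => p _; rewrite EFinM -muleA.
  apply: integral_cell_le => // t tp.
  have [a0|a0] := ltP (r ^+ 2 - t ^+ 2) 0.
    by rewrite qvol_lt0// mule_ge0 ?lcount_ge0.
  rewrite -(sqr_sqrtr a0); have [+ _] := IH _ (sqrtr_ge0 (r ^+ 2 - t ^+ 2)).
  move=> /le_trans; apply; apply: lee_wpmul2l; first by rewrite lee_fin.
  apply: lcount_le; apply: (@radius_le _ t); rewrite ?sqrtr_ge0 ?(ltW l00)//.
    by rewrite sqr_sqrtr// addrC subrK.
  exact: near.
apply: integral_cell_ge => //; first by rewrite mule_ge0 ?lcount_ge0.
move=> t tp; have [a0|a0] := ltP (r ^+ 2 - p ^+ 2) 0.
  by rewrite lcount_lt0// mule0.
rewrite -(sqr_sqrtr a0); have [_] := IH _ (sqrtr_ge0 (r ^+ 2 - p ^+ 2)).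
move=> /le_trans; apply; apply: qm; apply: (@radius_le _ p); rewrite ?sqrtr_ge0 ?(ltW l00)//.
  by rewrite sqr_sqrtr// addrC subrK.
by rewrite distrC near.
Qed.

Lemma lcount_scale (R : realType) (d : nat) (A : 'I_d -> set R) (k a : R) : 0 < k ->
  lcount (boxset (fun l => [set k * t | t in A l])) (k ^+ 2 * a) = lcount (boxset A) a.
Proof.
move=> k0; rewrite /lcount.
rewrite (@reindex_esum R _ _ (boxset A) _ (fun v => k *: v)).
  apply: eq_esum => v _; congr ((nat_of_bool _)%:R%:E).
  rewrite -[RHS](ler_pM2l (exprn_gt0 2 k0)) mulr_sumr; congr (_ <= _).
  by apply: eq_bigr => i _; rewrite mxE exprMn.
split => [v Av l|v w _ _ /(scalerI (lt0r_neq0 k0))//|w kw].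
  by rewrite mxE; exists (v ord0 l).
exists (k^-1 *: w); last by rewrite scalerA mulfV ?gt_eqF// scale1r.
move=> l; rewrite mxE; have [t At <-] := kw l.
by rewrite mulrA mulVf ?gt_eqF// mul1r.
Qed.

Lemma lcount_card (R : realType) (d : nat) (B : set 'rV[R]_d) (a : R) :
  lcount B a \is a fin_num ->
  lcount B a = #|` fset_set (B `&` qball (d := d) a)|%:R%:E.
Proof.
have -> : (lcount B a = \esum_(v in B `&` qball (d := d) a) 1)%E.
  rewrite /lcount (esumID (qball a)); last by move=> v _; rewrite lee_fin.
  rewrite [X in (_ + X)%E]esum1 ?adde0.
    by apply: eq_esum => v [_ ]; rewrite /qball /= => ->.
  by move=> v [_] /=; rewrite /qball /= => /negP/negbTE ->.
set S := B `&` _; have [fS _|iS] := pselect (finite_set S).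
  by rewrite esum_fset// fsbig_finite//= sumEFin card_fset_sum1 natr_sum.
move=> fS; exfalso; set e := (\esum_(v in S) 1)%E in fS.
have [D DS] := infinite_set_fset (Num.bound (fine e)) iS.
apply/negP; rewrite -ltnNge -(ltr_nat R).
apply: le_lt_trans (archi_boundP _); last by rewrite fine_ge0// esum_ge0.
rewrite -lee_fin fineK//; apply: (@le_trans _ _ (\esum_(v in [set` D]) 1)%E).
  by rewrite esum_fset// fsbig_finite//= sumEFin set_fsetK card_fset_sum1 natr_sum.
rewrite /e [leRHS](esumID [set` D])// (_ : S `&` [set` D] = [set` D]).
  by rewrite leeDl// esum_ge0.
by apply/seteqP; split => v //=; [case|move=> Dv; split=> //; exact: DS].
Qed.

(** Homogeneity of the volume up to a boundary error, without a change of variables in the iterated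
    integral: volumes are compared with counts of [k Z^d] and of [Z^d], which scaling identifies.
    Each of the two comparisons adds [d] to the radius [r]. *)
Lemma qvol_scale_le (R : realType) (d : nat) (k r : R) : 0 < k -> 0 <= r ->
  (qvol d ((k * r) ^+ 2) <= (k ^+ d)%:E * qvol d ((r + 2 * d%:R) ^+ 2))%E.
Proof.
move=> k0 r0; have kr0 : 0 <= k * r by rewrite mulr_ge0// ltW.
have [+ _] := @qvol_lcount R d (fun=> k) (fun=> 0) (k * r) (fun=> k0) kr0.
rewrite prodr_const sumr_const card_ord -[k *+ d]mulr_natr -mulrDr => /le_trans; apply.
apply: lee_wpmul2l; first by rewrite lee_fin exprn_ge0// ltW.
have -> : boxset (fun _ : 'I_d => progression k 0) =
    boxset (fun _ : 'I_d => [set k * t | t in progression 1 0]).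
  congr boxset; apply/funext => _; apply/seteqP; split => [_ [z _ <-]|_ [_ [z _ <-] <-]].
    by exists z%:~R; rewrite ?addr0//; exists z; rewrite // addr0 mul1r.
  by exists z; rewrite // !addr0 mul1r.
rewrite exprMn lcount_scale//.
have rd : 0 <= r + d%:R by rewrite addr_ge0.
have [_] := @qvol_lcount R d (fun=> 1) (fun=> 0) _ (fun=> ltr01) rd.
rewrite prodr_const sumr_const card_ord expr1n mul1e => /le_trans; apply.
by rewrite -addrA -mulr2n mulr_natl.
Qed.

Lemma qvol_gt0 (R : realType) (d : nat) (r : R) : d%:R <= r -> (0 < qvol d (r ^+ 2))%E.
Proof.
move=> dr; have [q0 qf qm] := qvol_fin_homo R d.
have dr2 : d%:R ^+ 2 <= r ^+ 2 by rewrite ler_sqr ?nnegrE ?ler0n// (le_trans _ dr) ?ler0n.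
apply: lt_le_trans (qm _ _ dr2).
have [_] := @qvol_lcount R d (fun=> 1) (fun=> 0) 0 (fun=> ltr01) (lexx _).
rewrite prodr_const sumr_const card_ord expr1n mul1e add0r => /(lt_le_trans _); apply.
rewrite /lcount.
have H0 : boxset (fun _ : 'I_d => progression 1 0) (0 : 'rV[R]_d).
  by move=> l; rewrite mxE; exists 0; rewrite // mulr0 addr0.
rewrite (esumID [set 0]); last by move=> v _; rewrite lee_fin.
have -> : boxset (fun _ : 'I_d => progression 1 0) `&` [set 0] = [set (0 : 'rV[R]_d)].
  by apply/seteqP; split => [v []//|v ->].
rewrite esum_set1 ?lee_fin// big1; last by move=> i _; rewrite mxE expr0n.
rewrite expr0n lexx (@lt_le_trans _ _ 1%:E)%E ?lte_fin//.
by rewrite leeDl// esum_ge0// => v _; rewrite lee_fin.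
Qed.

(** An infinite count would force a ball of infinite volume. *)
Lemma lcount_coset_fin (R : realType) (d : nat) (L y : 'I_d -> R) (a : R) :
  (forall l, 0 < L l) ->
  lcount (boxset (fun l => progression (L l) (y l))) a \is a fin_num.
Proof.
move=> L0; have [a0|a0] := ltP a 0; first by rewrite lcount_lt0.
have [_ qf _] := qvol_fin_homo R d.
have [_] := @qvol_lcount R d L y (Num.sqrt a) L0 (sqrtr_ge0 a).
rewrite sqr_sqrtr//; set b := (_ + _) ^+ 2.
have p0 : 0 < \prod_l L l by apply: prodr_gt0.
have := lcount_ge0 (boxset (fun l => progression (L l) (y l))) a.
case: lcount => //= _; rewrite gt0_muley ?lte_fin// leye_eq => /eqP q.
by have := qf b; rewrite q.
Qed.

Lemma lcount_presents_box (R : realType) (d : nat) (N : 'I_d -> nat) (L : 'I_d -> R)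
    (y : forall l, 'I_(N l) -> R) (P : 'I_d -> set R) (a : R) :
  (forall l, presents (zline (L l)) (y l) (P l)) ->
  lcount (boxset P) a = (\sum_(k : fprod (fun l => 'I_(N l)))
    lcount (boxset (fun l => progression (L l) (y l (k l)))) a)%E.
Proof.
move=> pr; rewrite /lcount (esum_presents (presents_box pr)); last first.
  by move=> v; rewrite lee_fin.
apply: eq_bigr => k _; symmetry; apply: (@reindex_esum R) => /=.
split => [v Lv l|v w _ _ /addIr//|v Lv].
  by rewrite !mxE; have [z ->] := Lv l; exists z; rewrite // mulrC.
exists (v - \row_l y l (k l)); last by rewrite subrK.
by move=> l; have [z _ e] := Lv l; exists z; rewrite !mxE -e addrK mulrC.
Qed.

Lemma cvg_ratio_shift (R : realType) (a b : R) : (r + a) / (r + b) @[r --> +oo] --> (1 : R).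
Proof.
have inv0 : (r + b)^-1 @[r --> +oo] --> (0 : R).
  apply/(gtr0_cvgV0 _).2; last exact: cvg_addrr.
  by near=> r; rewrite -ltrBlDr; near: r; apply: nbhs_pinfty_gt; exact: num_real.
have : 1 + (a - b) * (r + b)^-1 @[r --> +oo] --> (1 + (a - b) * 0 : R).
  by apply: cvgD; [exact: cvg_cst|apply: cvgM => //; exact: cvg_cst].
rewrite mulr0 addr0; apply: cvg_trans; apply: near_eq_cvg.
near=> r; have rb : r + b != 0.
  by rewrite gt_eqF// -ltrBlDr; near: r; apply: nbhs_pinfty_gt; exact: num_real.
by field.
Unshelve. all: by end_near. Qed.

Lemma cvg_ratio_shift_exp (R : realType) (a b : R) (n : nat) :
  ((r + a) / (r + b)) ^+ n @[r --> +oo] --> (1 : R).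
Proof.
elim: n => [|n IHn]; first exact: cvg_cst.
under eq_fun do rewrite exprS.
have := cvgM (cvg_ratio_shift a b) IHn; rewrite mulr1; exact.
Qed.

Lemma card_fprod_ord (R : realType) (d : nat) (N : 'I_d -> nat) :
  #|{: fprod (fun l => 'I_(N l))}|%:R = \prod_l (N l)%:R :> R.
Proof.
rewrite -sum1_card natr_sum.
transitivity (\sum_(k : fprod (fun l => 'I_(N l))) \prod_(l < d) (1 : R)).
  by apply: eq_bigr => k _; rewrite big1.
rewrite (prod_sum_fprod (fun l (_ : 'I_(N l)) => 1)); apply: eq_bigr => l _.
by rewrite sumr_const card_ord.
Qed.

Lemma density_box (R : realType) (d : nat) (N : 'I_d -> nat) (L : 'I_d -> R)
    (y : forall l, 'I_(N l) -> R) (P : 'I_d -> set R) :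
  (forall l, 0 < L l) -> (forall l, presents (zline (L l)) (y l) (P l)) ->
  #|` fset_set (boxset P `&` eball r)|%:R / fine (volume (eball (d := d) r))
    @[r --> +oo] --> \prod_l ((N l)%:R / L l).
Proof.
move=> L0 pr; have [q0 qf qm] := qvol_fin_homo R d.
pose v (r : R) := fine (qvol d (r ^+ 2)).
have vE r : qvol d (r ^+ 2) = (v r)%:E by rewrite fineK.
set p := \prod_l L l; have p0 : 0 < p by apply: prodr_gt0.
set c := \sum_l L l; have c0 : 0 <= c by apply: sumr_ge0 => l _; exact: ltW.
pose M : R := \prod_l (N l)%:R; have M0 : 0 <= M by apply: prodr_ge0.
have cardM : #|{: fprod (fun l => 'I_(N l))}|%:R = M := card_fprod_ord R N.
pose f (r : R) := fine (lcount (boxset P) (r ^+ 2)).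
have ff r : lcount (boxset P) (r ^+ 2) \is a fin_num.
  by rewrite (lcount_presents_box _ pr); apply/sum_fin_numP => k _ _; exact: lcount_coset_fin.
have fE r : lcount (boxset P) (r ^+ 2) = (f r)%:E by rewrite fineK.
have sumM (x : R) : (\sum_(k : fprod (fun l => 'I_(N l))) x%:E)%E = (M * x)%:E.
  by rewrite sumEFin sumr_const -[x *+ _]mulr_natl cardM.
have up r : 0 <= r -> p * f r <= M * v (r + c).
  move=> r0; rewrite -lee_fin EFinM -fE (lcount_presents_box _ pr) ge0_sume_distrr.
    rewrite -sumM; apply: lee_sum => k _; rewrite -vE.
    by have [] := qvol_lcount (fun l => y l (k l)) L0 r0.
  by move=> k _; exact: lcount_ge0.
have lo r : 0 <= r -> M * v r <= p * f (r + c).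
  move=> r0; rewrite -lee_fin [leRHS]EFinM -fE (lcount_presents_box _ pr) ge0_sume_distrr.
    rewrite -sumM; apply: lee_sum => k _; rewrite -vE.
    by have [] := qvol_lcount (fun l => y l (k l)) L0 r0.
  by move=> k _; exact: lcount_ge0.
(* The scaling factor is the one that maps the radius [u - 2 d] to [s]. *)
have vs s u : 0 < s -> 2 * d%:R < u -> v s <= (s / (u - 2 * d%:R)) ^+ d * v u.
  move=> s0 du; have w0 : 0 < u - 2 * d%:R by rewrite subr_gt0.
  have := @qvol_scale_le R d (s / (u - 2 * d%:R)) (u - 2 * d%:R).
  by rewrite divfK ?gt_eqF// subrK !vE -EFinM lee_fin; apply; rewrite ?divr_gt0// ltW.
have -> : \prod_l ((N l)%:R / L l) = M / p by rewrite prodf_div.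
have E : \forall r \near +oo, f r / v r =
    #|` fset_set (boxset P `&` eball r)|%:R / fine (volume (eball (d := d) r)).
  near=> r; have r0 : 0 <= r by near: r; apply: nbhs_pinfty_ge; exact: num_real.
  by rewrite eball_qball// /f (lcount_card (ff r)).
apply: cvg_trans (near_eq_cvg E) _.
pose g (r : R) := M / p * ((r + (- c - 2 * d%:R)) / (r + 0)) ^+ d.
pose h (r : R) := M / p * ((r + c) / (r + (- (2 * d%:R)))) ^+ d.
have lim1 a b : M / p * ((r + a) / (r + b)) ^+ d @[r --> +oo] --> M / p.
  rewrite -[X in _ --> X]mulr1; apply: cvgM; first exact: cvg_cst.
  exact: cvg_ratio_shift_exp.
apply: (@squeeze_cvgr _ _ _ _ g h); [|exact: lim1|exact: lim1].
near=> r.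
have r1 : 2 * d%:R + c + 1 < r by near: r; apply: nbhs_pinfty_gt; exact: num_real.
have d0 : 0 <= d%:R :> R by [].
have vr : 0 < v r.
  by rewrite -lte_fin -vE qvol_gt0//; lra.
have r0 : 0 < r by lra.
apply/andP; split.
  set w := r + (- c - 2 * d%:R); have w0 : 0 < w by rewrite /w; lra.
  rewrite /g ler_pdivlMr// -(ler_pM2l p0) -/w addr0; set X := _ ^+ d.
  have -> : p * (M / p * X * v r) = M * (X * v r) by field; rewrite gt_eqF.
  have rc0 : 0 <= r - c by lra.
  have := lo _ rc0; rewrite subrK; apply: le_trans; apply: ler_wpM2l => //.
  have rc : 2 * d%:R < r - c by lra.
  have := vs _ _ r0 rc; rewrite /X (_ : r - c - 2 * d%:R = w); last by rewrite /w; lra.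
  rewrite !expr_div_n; have := exprn_gt0 d r0; have := exprn_gt0 d w0.
  move: (r ^+ d) (w ^+ d) (v r) (v (r - c)) => a b x z b0 a0.
  by rewrite [a / b * z]mulrAC [b / a * x]mulrAC ler_pdivlMr// ler_pdivrMr// [x * b]mulrC [z * a]mulrC.
rewrite ler_pdivrMr// /h -(ler_pM2l p0); set X := _ ^+ d.
have -> : p * (M / p * X * v r) = M * (X * v r) by field; rewrite gt_eqF.
apply: le_trans (up _ (ltW r0)) _; apply: ler_wpM2l => //.
by apply: vs; lra.
Unshelve. all: by end_near. Qed.

(** * Tensors *)

(** The absolute value is taken because the basis vector may point either way. *)
Definition line_period (R : realType) (G : periodic_config R 1) : R :=
  `|pc_basis G ord0 ord0|.

Definition line_shift (R : realType) (G : periodic_config R 1) (k : 'I_(pc_num G)) : R :=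
  pc_shift k ord0 ord0.

Definition line_density (R : realType) (G : periodic_config R 1) : R :=
  (pc_num G)%:R / line_period G.

Lemma line_period_gt0 (R : realType) (G : periodic_config R 1) : 0 < line_period G.
Proof.
rewrite normr_gt0; have := pc_basis_unit G; rewrite unitmxE det_mx11 unitfE; exact.
Qed.

Lemma line_density_gt0 (R : realType) (G : periodic_config R 1) : 0 < line_density G.
Proof. by rewrite divr_gt0 ?line_period_gt0// ltr0n pc_num_gt0. Qed.

Lemma zline_norm (R : realType) (b : R) : zline `|b| = zline b.
Proof.
apply/seteqP; split => _ [z ->]; have [b0|b0] := ltP b 0.
- by exists (- z); rewrite ltr0_norm// rmorphN mulrN mulNr.
- by exists z; rewrite ger0_norm.
- by exists (- z); rewrite ltr0_norm// rmorphN mulrNN.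
- by exists z; rewrite ger0_norm.
Qed.

Lemma lattice_diag (R : realType) (d : nat) (b : 'rV[R]_d) :
  lattice (diag_mx b) = boxset (fun l => zline (b ord0 l)).
Proof.
apply/seteqP; split => [_ [z ->] l|v H].
  by exists (z ord0 l); rewrite mul_mx_diag !mxE.
exists (\row_l projT1 (cid (H l))); apply/rowP => l.
by rewrite mul_mx_diag !mxE; exact: projT2 (cid (H l)).
Qed.

Lemma lattice1 (R : realType) (B : 'M[R]_1) (v : 'rV[R]_1) :
  lattice B v <-> zline `|B ord0 ord0| (v ord0 ord0).
Proof.
have -> : B = diag_mx (const_mx (B ord0 ord0)).
  by rewrite diag_const_mx -mx11_scalar.
rewrite lattice_diag diag_const_mx mxE eqxx mulr1n zline_norm.
split => [H|H l]; first by have := H ord0; rewrite mxE.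
by rewrite mxE [l]ord1.
Qed.

Lemma line_presents (R : realType) (G : periodic_config R 1) :
  presents (zline (line_period G)) (@line_shift R G) (line_points G).
Proof.
have pr := config_presents G.
split; [exact: zline0|by move=> a b; exact: zline_sub| |].
- move=> t; split => [/(presentsP pr)[i /lattice1]|[i Hi]].
    by rewrite !mxE; exists i.
  by apply/(presentsP pr); exists i; apply/lattice1; rewrite !mxE.
- move=> i j Hij; apply: (presents_inj pr); apply/lattice1.
  by rewrite !mxE.
Qed.

Lemma tensor_has_density (R : realType) (d : nat) (G : periodic_config R d)
    (Gl : 'I_d -> periodic_config R 1) : is_tensor G Gl ->
  has_density G (\prod_l line_density (Gl l)).
Proof.
rewrite /is_tensor /has_density => ->.
exact: (density_box (fun l => line_period_gt0 (Gl l)) (fun l => line_presents (Gl l))).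
Qed.

Lemma line_is_tensor (R : realType) (G : periodic_config R 1) : is_tensor G (fun=> G).
Proof.
have cE (v : 'rV[R]_1) l : const_mx (v ord0 l) = v.
  by apply/rowP => i; rewrite mxE (ord1 i) (ord1 l).
apply/seteqP; split => v; first by move=> Gv l; rewrite /line_points /= cE.
by move=> /(_ ord0); rewrite /line_points /= cE.
Qed.

Lemma has_density_unique (R : realType) (d : nat) (G : periodic_config R d) (a b : R) :
  has_density G a -> has_density G b -> a = b.
Proof. by move=> Ga Gb; exact: (cvg_unique _ Ga Gb). Qed.

Lemma line_has_densityE (R : realType) (G : periodic_config R 1) (rho : R) :
  has_density G rho <-> rho = line_density G.
Proof.
have D := tensor_has_density (line_is_tensor G); rewrite big_ord1 in D.
by split => [/has_density_unique/(_ D)//|->].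
Qed.

(** The density is computed twice, from the presentation of [G] and from the one-point presentation
    of the progression. *)
Lemma equispaced_period (R : realType) (G : periodic_config R 1) (c x : R) : 0 < c ->
  line_points G = progression c x -> c = (line_density G)^-1.
Proof.
move=> c0 Gc; apply: invr_inj; rewrite invrK; apply/(line_has_densityE G).
have T := line_is_tensor G; rewrite /has_density T.
have := @density_box R 1 (fun=> 1%N) (fun=> c) (fun _ _ => x) (fun=> line_points G) (fun=> c0).
by rewrite big_ord1 mul1r; apply => l; exact: presents_progression.
Qed.

Lemma line_average_ge (R : realType) (alpha : R) (G : periodic_config R 1) : 0 < alpha ->
  lattice_theta (alpha * (line_density G)^-1 ^+ 2) <=
  line_average alpha (line_points G) (@line_shift R G).
Proof.
move=> a0; rewrite /line_density invf_div.
by have [] := line_optimal a0 (line_period_gt0 G) (pc_num_gt0 G) (line_presents G).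
Qed.

Lemma line_average_eq (R : realType) (alpha : R) (G : periodic_config R 1) : 0 < alpha ->
  line_average alpha (line_points G) (@line_shift R G) =
  lattice_theta (alpha * (line_density G)^-1 ^+ 2) <-> equispaced G.
Proof.
move=> a0; split.
  rewrite /line_density invf_div.
  have [_ _ H] := line_optimal a0 (line_period_gt0 G) (pc_num_gt0 G) (line_presents G).
  move=> /H[x E]; exists (line_period G / (pc_num G)%:R), x; split=> //.
  by rewrite divr_gt0 ?line_period_gt0// ltr0n pc_num_gt0.
move=> [c [x [c0 E]]]; rewrite -(equispaced_period c0 E).
exact: (line_average_progression a0 c0 (pc_num_gt0 G) (line_presents G) E).
Qed.

Lemma gaussian_enorm (R : realType) (d : nat) (alpha : R) (v : 'rV[R]_d) :
  gaussian alpha (enorm v) = \prod_l expR (- alpha * v ord0 l ^+ 2).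
Proof.
rewrite /gaussian /enorm sqr_sqrtr; last by rewrite sumr_ge0// => l _; rewrite sqr_ge0.
by rewrite mulr_sumr expR_sum.
Qed.

(** The potential of the point set factors over the coordinates, whatever lattice presents [G].
    [presents_average] moves its mean to the product presentation, where the mean factors as
    well. *)
Lemma energy_tensor (R : realType) (d : nat) (alpha : R) (G : periodic_config R d)
    (Gl : 'I_d -> periodic_config R 1) : 0 < alpha -> is_tensor G Gl ->
  energy alpha G = (\prod_l line_average alpha (line_points (Gl l)) (@line_shift R (Gl l)) - 1)%:E.
Proof.
move=> a0 GT; have {}GT : points G = boxset (fun l => line_points (Gl l)) := GT.
have prG := config_presents G.
have prB := presents_box (fun l => line_presents (Gl l)).
pose S l t := fine (theta_line alpha (line_points (Gl l)) t).
have SE l t : theta_line alpha (line_points (Gl l)) t = (S l t)%:E.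
  have [/(_ t)[s _ E] _ _] := line_optimal a0 (line_period_gt0 (Gl l))
    (pc_num_gt0 (Gl l)) (line_presents (Gl l)).
  by rewrite /S E.
have potE x : potential alpha (points G) x = (\prod_l S l (x ord0 l))%:E.
  rewrite /potential GT.
  rewrite -(@esum_box_prod _ _ (fun l => line_points (Gl l))
    (fun l t => expR (- alpha * (x ord0 l - t) ^+ 2))).
  - apply: eq_esum => p _; rewrite gaussian_enorm; congr (_%:E).
    by apply: eq_bigr => l _; rewrite !mxE.
  - by move=> l t; exact: expR_ge0.
  - by move=> l; rewrite -SE.
rewrite -GT in prB.
pose w (x : 'rV[R]_d) := \prod_l S l (x ord0 l).
have wshift (I : finType) L (x : I -> 'rV[R]_d) : presents L x (points G) ->
    forall p l, L l -> w (p + l) = w p.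
  move=> pr p l Ll; apply: EFin_inj.
  by rewrite -!potE; exact: potential_shift pr _ _ Ll.
have := presents_average prG prB _ (wshift _ _ _ prG) (wshift _ _ _ prB).
rewrite card_ord => /(_ (pc_num_gt0 G)).
rewrite card_fprod_ord => H.
have NR : (pc_num G)%:R != 0 :> R by rewrite pnatr_eq0 -lt0n pc_num_gt0.
have PR : \prod_l (pc_num (Gl l))%:R != 0 :> R.
  by apply/prodf_neq0 => l _; rewrite pnatr_eq0 -lt0n pc_num_gt0.
have -> : energy alpha G = (energy alpha G + 1 - 1)%E by rewrite addeK.
rewrite energy_potential EFinB; congr (_ - _)%E.
rewrite (eq_bigr _ (fun j _ => potE (pc_shift j))) sumEFin -EFinM; congr (_%:E).
rewrite /line_average big_split /= prodfV -prod_sum_fprod.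
apply: (mulfI PR); rewrite mulrA mulVKf//.
apply: (mulfI NR).
rewrite -mulrA mulrCA mulVKf// H; congr (_ * _); apply: eq_bigr => k _.
by apply: eq_bigr => l _; rewrite mxE.
Qed.

Lemma eq_prod_ge (R : realType) (I : finType) (A T : I -> R) :
  (forall i, 0 < T i) -> (forall i, T i <= A i) ->
  \prod_i A i = \prod_i T i -> forall i, A i = T i.
Proof.
move=> T0 TA e i; apply/eqP; rewrite eq_le TA andbT leNgt; apply/negP => h.
have := ltxx (\prod_i A i); rewrite {1}e.
rewrite (bigD1 i)//= [ltRHS](bigD1 i)//= => /negbT/negP; apply.
have T'0 : 0 < \prod_(j | j != i) T j by apply: prodr_gt0.
apply: (@lt_le_trans _ _ (A i * \prod_(j | j != i) T j)); first by rewrite ltr_pM2r.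
apply: ler_wpM2l; first exact: ltW (lt_trans (T0 i) h).
by apply: ler_prod => j _; rewrite (ltW (T0 j)) TA.
Qed.

Lemma points_lattice_config (R : realType) (d : nat) (B : 'M[R]_d) (B_unit : B \in unitmx) :
  points (lattice_config B_unit) = lattice B.
Proof.
apply/seteqP; split => [_ [j _ [l Ll <-]]|l Ll]; first by rewrite addr0.
by exists ord0 => //; exists l; rewrite // addr0.
Qed.

Lemma diag_unit (R : realType) (d : nat) (b : 'rV[R]_d) :
  (forall l, 0 < b ord0 l) -> diag_mx b \in unitmx.
Proof.
move=> b0; rewrite unitmxE det_diag unitfE; apply/prodf_neq0 => l _.
by rewrite gt_eqF.
Qed.

Lemma cuboid_tensor (R : realType) (d : nat) (b : 'rV[R]_d) (G : periodic_config R d) :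
  (forall l, 0 < b ord0 l) -> points G = lattice (diag_mx b) ->
  exists Gl, [/\ is_tensor G Gl, forall l, equispaced (Gl l) &
                 forall l, line_density (Gl l) = (b ord0 l)^-1].
Proof.
move=> b0 GE.
have u l : diag_mx (const_mx (b ord0 l)) \in @unitmx R 1.
  by apply: diag_unit => i; rewrite mxE.
have lE l : line_points (lattice_config (u l)) =
    progression (b ord0 l) 0.
  rewrite /line_points points_lattice_config lattice_diag.
  apply/seteqP; split => [t /(_ ord0)|_ [z _ <-] i]; rewrite /= !mxE.
    by move=> [z ->]; exists z; rewrite // addr0 mulrC.
  by exists z; rewrite addr0 mulrC.
exists (fun l => lattice_config (u l)); split.
- rewrite /is_tensor GE lattice_diag; apply/seteqP; split => v H l.
    by rewrite lE; have [z ->] := H l; exists z; rewrite // addr0 mulrC.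
  by have := H l; rewrite lE => -[z _ <-]; exists z; rewrite addr0 mulrC.
- by move=> l; exists (b ord0 l), 0.
- by move=> l; rewrite -[LHS]invrK -(equispaced_period (b0 l) (lE l)).
Qed.

Lemma equispaced_cuboid (R : realType) (d : nat) (G : periodic_config R d)
    (Gl : 'I_d -> periodic_config R 1) :
  is_tensor G Gl -> (forall l, equispaced (Gl l)) -> cuboid_shaped G.
Proof.
move=> GT e; have /choice[c /choice[x H]] := e.
exists c, (\row_l x l); split => [l|]; first by have [] := H l.
rewrite GT; apply/seteqP; split => v /=.
  move=> Hv; have ex l : exists z : int, c l * z%:~R + x l = v ord0 l.
    have := Hv l; have [_ ->] := H l.
    by move=> [z _ <-]; exists z.
  have [z zE] := choice ex; exists z => l; by rewrite mxE zE.
move=> [z zE] l; have [_ ->] := H l; exists (z l) => //.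
by rewrite zE mxE.
Qed.

Lemma tensor_energy_ge (R : realType) (d : nat) (alpha : R) (G : periodic_config R d)
    (Gl : 'I_d -> periodic_config R 1) : 0 < alpha -> is_tensor G Gl ->
  let T := (\prod_l lattice_theta (alpha * (line_density (Gl l))^-1 ^+ 2) - 1)%:E in
  (T <= energy alpha G)%E /\ (energy alpha G = T <-> forall l, equispaced (Gl l)).
Proof.
move=> a0 GT; rewrite /= (energy_tensor a0 GT).
have T0 l : 0 < lattice_theta (alpha * (line_density (Gl l))^-1 ^+ 2).
  by apply: lt_le_trans (lattice_theta_ge1 _); rewrite // mulr_gt0// exprn_gt0// invr_gt0 line_density_gt0.
have TA l := line_average_ge (Gl l) a0.
split; first by rewrite lee_fin lerD2r; apply: ler_prod => l _; rewrite (ltW (T0 l)) TA.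
split => [[] /addIr/(eq_prod_ge T0 TA) e l|e]; first exact/(line_average_eq _ a0).
by congr (_ - 1)%:E; apply: eq_bigr => l _; exact/(line_average_eq _ a0).
Qed.

Lemma cubic_energy_le (R : realType) (d : nat) (alpha rho : R) (G : periodic_config R d)
    (Gl : 'I_d -> periodic_config R 1) : (0 < d)%N -> 0 < alpha -> 0 < rho ->
  is_tensor G Gl -> has_density G rho ->
  let T := (lattice_theta (alpha * (rho `^ (- d%:R^-1)) ^+ 2) ^+ d - 1)%:E in
  (T <= energy alpha G)%E /\ (energy alpha G = T -> forall l, equispaced (Gl l)).
Proof.
move=> d0 a0 r0 GT Gr; have [ge eq] := tensor_energy_ge a0 GT.
set c := rho `^ _; move=> T; have c0 : 0 < c by rewrite powR_gt0.
have rE := has_density_unique Gr (tensor_has_density GT).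
have Tle : (T <= (\prod_l lattice_theta (alpha * (line_density (Gl l))^-1 ^+ 2) - 1)%:E)%E.
  rewrite lee_fin lerD2r; apply: lattice_theta_prod => //.
  - by move=> l; rewrite mulr_gt0// exprn_gt0// invr_gt0 line_density_gt0.
  - by rewrite mulr_gt0// exprn_gt0.
  (* The condition on the geometric mean is the multiplicativity of the density: the line densities
     have product [rho]. *)
  rewrite big_split /= prodr_const card_ord exprMn; congr (_ * _).
  rewrite prodrXl prodfV -rE exprAC; congr (_ ^+ 2).
  rewrite /c -powR_mulrn ?powR_ge0// -powRrM mulNr mulVf ?pnatr_eq0 -?lt0n//.
  by rewrite powRN powRr1// ltW.
split; first exact: le_trans Tle ge.
(* The bound for the given line densities lies between the cubic value and the energy, so equality
   of these two forces equality on every line. *)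
by move=> e; apply/eq/eqP; rewrite eq_le ge andbT e.
Qed.

Lemma cubic_lattice_tensor (R : realType) (d : nat) (rho : R) (rho_gt0 : 0 < rho) :
  (0 < d)%N ->
  exists Gl, [/\ is_tensor (cubic_lattice d rho_gt0) Gl,
    has_density (cubic_lattice d rho_gt0) rho & forall alpha, 0 < alpha ->
    energy alpha (cubic_lattice d rho_gt0) =
      (lattice_theta (alpha * (rho `^ (- d%:R^-1)) ^+ 2) ^+ d - 1)%:E].
Proof.
move=> d0; set c := rho `^ _.
have [||Gl [GT Geq Gd]] := @cuboid_tensor R d (const_mx c) (cubic_lattice d rho_gt0).
- by move=> l; rewrite mxE powR_gt0.
- by rewrite points_lattice_config diag_const_mx.
exists Gl; split => //.
  have := tensor_has_density GT; rewrite (eq_bigr _ (fun l _ => Gd l)).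
  under eq_bigr do rewrite mxE; rewrite prodr_const card_ord.
  rewrite /c -powRN opprK -powR_mulrn ?powR_ge0// -powRrM mulVf ?pnatr_eq0 -?lt0n//.
  by rewrite powRr1// ltW.
move=> alpha a0; have [_ /iffRL/(_ Geq) ->] := tensor_energy_ge a0 GT.
rewrite (eq_bigr (fun=> lattice_theta (alpha * c ^+ 2))); last first.
  by move=> l _; rewrite Gd invrK mxE.
by rewrite prodr_const card_ord.
Qed.

Unset Implicit Arguments.
Set Strict Implicit.
Set Printing Implicit Defensive.

Theorem theorem1p2 (R : realType) (d : nat) (d_gt0 : (0 < d)%N) :
  (* the density of every factor is fixed *)
  (forall (alpha : R) (rho : 'I_d -> R),
     0 < alpha -> (forall l, 0 < rho l) ->
     (exists Go, energy_minimizer alpha (factor_tensor_class rho) Go) /\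
     (forall Go, energy_minimizer alpha (factor_tensor_class rho) Go ->
        (forall G (Gl : 'I_d -> periodic_config R 1),
           is_tensor G Gl -> (forall l, has_density (Gl l) (rho l)) ->
           (energy alpha Go <= energy alpha G)%E /\
           (energy alpha Go = energy alpha G <->
            forall l, equispaced (Gl l))) /\
        cuboid_shaped Go)) /\
  (* only the density of the product is fixed *)
  (forall (alpha rho : R), 0 < alpha -> 0 < rho ->
     (exists Go : periodic_config R d,
        energy_minimizer alpha (tensor_class rho) Go) /\
     (forall Go : periodic_config R d,
        energy_minimizer alpha (tensor_class rho) Go ->
        (forall G (Gl : 'I_d -> periodic_config R 1),
           is_tensor G Gl -> has_density G rho ->
           (energy alpha Go <= energy alpha G)%E /\
           (energy alpha Go = energy alpha G ->
            forall l, equispaced (Gl l))) /\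
        cuboid_shaped Go)) /\
  (forall (rho : R) (rho_gt0 : 0 < rho),
     universally_optimal (tensor_class rho) (cubic_lattice d rho_gt0)).
Proof.
split; [|split].
- move=> alpha rho a0 r0.
  (* The cuboid lattice with sides [1 / rho l] attains the lower bound. Hence every minimizer
     attains it too, and the equality case describes its factors. *)
  have [Gc [GlT [GcT Gceq Gcd]]] : exists Gc GlT,
      [/\ is_tensor Gc GlT, forall l, equispaced (GlT l) &
         forall l, line_density (GlT l) = rho l].
    pose b := \row_l (rho l)^-1.
    have b0 l : 0 < b ord0 l by rewrite mxE invr_gt0.
    have [Gl [H1 H2 H3]] := cuboid_tensor b0 (points_lattice_config (diag_unit b0)).
    exists (lattice_config (diag_unit b0)), Gl; split => // l.
    by rewrite H3 mxE invrK.
  pose T := (\prod_l lattice_theta (alpha * (rho l)^-1 ^+ 2) - 1)%:E.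
  have ge G Gl : is_tensor G Gl -> (forall l, has_density (Gl l) (rho l)) ->
      (T <= energy alpha G)%E /\ (energy alpha G = T <-> forall l, equispaced (Gl l)).
    move=> GT Gd; have dE l : rho l = line_density (Gl l) by apply/line_has_densityE.
    have := tensor_energy_ge a0 GT; under eq_bigr do rewrite -dE; exact.
  have Gcd' l : has_density (GlT l) (rho l) by apply/line_has_densityE; rewrite Gcd.
  have GcE : energy alpha Gc = T by apply/(ge _ _ GcT Gcd').2.
  split.
    exists Gc; split; first by exists GlT.
    by move=> G [Gl GT Gd]; rewrite GcE; have [] := ge _ _ GT Gd.
  move=> Go [[Glo GoT God] Gomin].
  have [Goge Goeq] := ge _ _ GoT God.
  have GoE : energy alpha Go = T.
    by apply/eqP; rewrite eq_le Goge andbT -GcE; apply: Gomin; exists GlT.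
  split; last exact: equispaced_cuboid GoT (Goeq.1 GoE).
  move=> G Gl GT Gd; rewrite GoE; have [h1 h2] := ge _ _ GT Gd; split=> //.
  by rewrite -h2; split => ->.
- move=> alpha rho a0 r0.
  have [Glc [GcT Gcd GcE]] := cubic_lattice_tensor r0 d_gt0.
  split.
    exists (cubic_lattice d r0); split; first by split => //; exists Glc.
    move=> G [[Gl GT] Gd]; rewrite GcE//.
    by have [] := cubic_energy_le d_gt0 a0 r0 GT Gd.
  move=> Go [[[Glo GoT] God] Gomin].
  have [Goge Goeq] := cubic_energy_le d_gt0 a0 r0 GoT God.
  have GoE : energy alpha Go = energy alpha (cubic_lattice d r0).
    apply/eqP; rewrite eq_le {2}GcE// Goge andbT; apply: Gomin.
    by split => //; exists Glc.
  rewrite GcE// in GoE.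
  split; last exact: equispaced_cuboid GoT (Goeq GoE).
  move=> G Gl GT Gd; rewrite GoE; have [h1 h2] := cubic_energy_le d_gt0 a0 r0 GT Gd.
  by split => // /esym.
- move=> rho r0; have [Glc [GcT Gcd GcE]] := cubic_lattice_tensor r0 d_gt0.
  split; first by split => //; exists Glc.
  move=> G [[Gl GT] Gd] alpha a0; rewrite GcE//.
  by have [] := cubic_energy_le d_gt0 a0 r0 GT Gd.
Qed.
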